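(* For a generic smooth function $\Psi:\mathbb{R}^2\times\mathbb{R}\to\mathbb{C}$, $(x,y,t)\mapsto\Psi(x,y,t)$, the following holds. At any point and any moment $(x_0,y_0,t_0)$ with $\Psi(x_0,y_0,t_0)=0$, the phase singularity of $\Psi$ at $(x_0,y_0,t_0)$ is radially equivalent to one of the following functions at the origin $(x,y)=(0,0)$: (R, regular singularity) $\psi(x,y)=x+\mathrm{i}y$; (H, hyperbolic singularity) $\psi(x,y)=x^2-y^2+\mathrm{i}y$; (E, elliptic singularity) $\psi(x,y)=x^2+y^2+\mathrm{i}y$.
   Context: Smooth means $C^\infty$; $\mathbb{C}$ is identified with $\mathbb{R}^2$ via $u+\mathrm{i}w=(u,w)$. ''Generic'' means: for all $\Psi$ in a residual subset of $C^\infty(\mathbb{R}^2\times\mathbb{R},\mathbb{C})$ in the Whitney $C^\infty$ topology. A radial transformation near $0\in\mathbb{C}$ is a local diffeomorphism $\tau:(\mathbb{C},0)\to(\mathbb{C},0)$, $\tau(u,w)=(U,W)$, sending each radial line (ray) $\{\theta=\mathrm{const.}\}$ to a radial line, where $u+\mathrm{i}w=re^{\mathrm{i}\theta}$; equivalently $U=\rho(u,w)(au+bw)$, $W=\rho(u,w)(cu+dw)$ with $\rho$ a positive function and $a,b,c,d\in\mathbb{R}$, $ad-bc\neq0$. The phase singularity of $\Psi$ at $(x_0,y_0,t_0)$, where $\Psi(x_0,y_0,t_0)=0$, is the germ at $(x_0,y_0)$ of the momentary function $\Psi(\cdot,\cdot,t_0)$ considered up to radial equivalence. It is radially equivalent to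 a function $\psi(x,y)$ at the origin if there are a local diffeomorphism $\sigma$ of the plane with $\sigma(0,0)=(x_0,y_0)$ and a local radial transformation $\tau$ near $0\in\mathbb{C}$ such that $\Psi(\sigma(x,y),t_0)=\tau(\psi(x,y))$ for $(x,y)$ near the origin. *)

(* Defs.v *)
From HB Require Import structures.
From mathcomp Require Import all_boot all_order all_algebra.
From mathcomp Require Import all_classical all_reals all_analysis.

Set Implicit Arguments.
Unset Strict Implicit.
Unset Printing Implicit Defensive.

Import Order.TTheory GRing.Theory Num.Theory.
Import numFieldNormedType.Exports.

Local Open Scope classical_set_scope.
Local Open Scope ring_scope.

Section Smooth.
Context {R : realType} {V W : normedModType R}.

(* [Ck_on A k f] is meant for open [A]: values of [f] outside [A] are then
   irrelevant.  On a finite-dimensional [V], [forall k, Ck_on A k f] says that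
   all iterated partial derivatives of [f] exist and are continuous on [A]. *)
Fixpoint Ck_on (A : set V) (k : nat) (f : V -> W) : Prop :=
  match k with
  | 0 => forall x, A x -> {for x, continuous f}
  | k'.+1 => (forall x, A x -> differentiable f x) /\
             (forall v, Ck_on A k' (fun x => 'D_v f x))
  end.

Definition smooth_on (A : set V) (f : V -> W) : Prop := forall k, Ck_on A k f.

Definition iter_derive (s : seq V) (f : V -> W) : V -> W :=
  foldr (fun v (g : V -> W) (x : V) => 'D_v g x) f s.

End Smooth.

Definition diffeo {R : realType} {V W : normedModType R}
    (A : set V) (B : set W) (f : V -> W) : Prop :=
  [/\ open A, open B, smooth_on A f, f @` A = B &
      exists2 g : W -> V, smooth_on B g & forall x, A x -> g (f x) = x].

(* The complex number [u + i w] is represented by the pair [(u, w)]; the domain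
   [R * R * R] is [(R * R) * R], plane times time. *)
Record smooth_fun (R : realType) := SmoothFun {
  smooth_val :> R * R * R -> R * R;
  smooth_valP : smooth_on setT smooth_val }.

HB.instance Definition _ (R : realType) := gen_eqMixin (smooth_fun R).
HB.instance Definition _ (R : realType) := gen_choiceMixin (smooth_fun R).

Section Whitney.
Context {R : realType}.

Definition basis3 : seq (R * R * R) := [:: (1, 0, 0); (0, 1, 0); (0, 0, 1)].

(* The functions whose [k]-jet is [eps]-close to that of [f], where [eps] may
   decay arbitrarily fast at infinity. *)
Definition whitney_ball (f : smooth_fun R) (k : nat) (eps : R * R * R -> R) :
    set (smooth_fun R) :=
  [set g : smooth_fun R | forall (p : R * R * R) (s : seq (R * R * R)),
     (size s <= k)%N -> {subset s <= basis3} ->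
     `|iter_derive s g p - iter_derive s f p| < eps p].

Definition whitney_open (O : set (smooth_fun R)) : Prop :=
  forall f, O f -> exists (k : nat) (eps : R * R * R -> R),
    [/\ continuous eps, forall p, 0 < eps p & whitney_ball f k eps `<=` O].

Lemma whitney_openT : whitney_open setT.
Proof.
move=> f _; exists 0%N, (fun=> 1); split => // p.
exact: cvg_cst.
Qed.

Lemma whitney_openI : setI_closed whitney_open.
Proof.
move=> O1 O2 h1 h2 f [/h1[k1 [e1 [c1 p1 s1]]] /h2[k2 [e2 [c2 p2 s2]]]].
exists (maxn k1 k2), (fun p => Num.min (e1 p) (e2 p)); split => [p|p|g hg].
- exact: (@continuous_min _ _ e1 e2 p (c1 p) (c2 p)).
- by rewrite lt_min p1 p2.
- split; [apply: s1|apply: s2] => p s ks sb; have := hg p s;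
    rewrite lt_min leq_max ks ?orbT => /(_ isT sb) /andP[] //.
Qed.

Lemma whitney_open_bigU (I : Type) (F : I -> set (smooth_fun R)) :
  (forall i, whitney_open (F i)) -> whitney_open (\bigcup_i F i).
Proof.
move=> h f [i _ Fif]; have [k [e [ce pe se]]] := h i f Fif.
by exists k, e; split => // g /se Fig; exists i.
Qed.

HB.instance Definition _ := isOpenTopological.Build (smooth_fun R)
  whitney_openT whitney_openI whitney_open_bigU.

End Whitney.

Definition residual {T : topologicalType} (G : set T) : Prop :=
  exists2 F : nat -> set T,
    (forall n, open (F n) /\ dense (F n)) & \bigcap_n F n `<=` G.

Section Radial.
Context {R : realType}.

Definition ray (theta : R) : set (R * R) :=
  [set z | exists2 r : R, 0 <= r & z = (r * cos theta, r * sin theta)].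

Definition local_diffeo (f : R * R -> R * R) (p q : R * R) : Prop :=
  f p = q /\ exists (A B : set (R * R)), A p /\ diffeo A B f.

(* The neighbourhoods [A] and [B] do not depend on [theta]. *)
Definition radial_transformation (tau : R * R -> R * R) : Prop :=
  tau (0, 0) = (0, 0) /\
  exists (A B : set (R * R)), [/\ A (0, 0), diffeo A B tau &
    forall theta, exists theta',
      tau @` (A `&` ray theta) = B `&` ray theta'].

Definition radially_equivalent
    (f : R * R -> R * R) (q0 : R * R) (psi : R * R -> R * R) : Prop :=
  exists sigma tau : R * R -> R * R,
    [/\ local_diffeo sigma (0, 0) q0, radial_transformation tau &
        \forall z \near ((0, 0) : R * R), f (sigma z) = tau (psi z)].

Definition momentary (Psi : smooth_fun R) (t : R) (z : R * R) : R * R :=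
  Psi (z, t).

Definition psi_regular (z : R * R) : R * R := (z.1, z.2).
Definition psi_hyperbolic (z : R * R) : R * R := (z.1 ^+ 2 - z.2 ^+ 2, z.2).
Definition psi_elliptic (z : R * R) : R * R := (z.1 ^+ 2 + z.2 ^+ 2, z.2).

End Radial.

(* Main.v *)
From HB Require Import structures.
Require Import Defs.
From mathcomp Require Import all_boot all_order all_algebra.
From mathcomp Require Import all_classical all_reals all_analysis.
From mathcomp Require Import ring lra.

(** Genericity.  A zero of the momentary function is bad if some nonzero
    combination [h] of the components is critical there and, moreover, either the
    Hessian of [h] is degenerate or the second derivative of [h] vanishes along a
    direction in the kernel of the differential.  In charts for [h] and for the
    direction these are six equations in the three coordinates of space-time and
    two chart parameters ([degeneracy]).  For data in a compact set, the functions
    without bad zeros form an open set by compactness ([nondegenerate_open]).  They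
    are dense: after adding quadratic polynomials with six free coefficients, cut
    off by a bump function, the six equations can be solved for the coefficients,
    so that the bad coefficients are a Lipschitz image of a cube of dimension five
    in a space of dimension six.  By the pigeonhole principle such an image
    contains no cube ([lipschitz_cube_not_onto]), whence [nondegenerate_dense].
    Countably many compact sets and charts give the residual set.

    Normal forms.  At a zero where the differential is invertible the inverse
    function theorem gives the regular form.  At another zero that is not bad, the
    differential has rank one ([classification]); in suitable linear coordinates
    the map is [(h, k)] with [h] critical and [k] a submersion.  The Jacobian
    determinant and [k] are local coordinates [(X, Y)], because the second
    derivative of [h] along the kernel is nonzero.  There the derivative of [h] in
    [X] is [X] times a nonvanishing function, so Hadamard's lemma gives
    [h = g Y + X ^+ 2 * Q] with [Q] nonvanishing, and the nondegenerate Hessian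
    gives [g Y = Y ^+ 2 * c Y] with [c] nonvanishing.

    The point of radial equivalence is the last step.  The curve [U = c W * W ^+ 2]
    of critical values cannot be straightened by a radial transformation, but the
    target may be multiplied by the positive function [`|c W|], which turns the
    curve into the parabola [U = +- W ^+ 2].  In the source coordinates
    [Num.sqrt (`|c Y| * `|Q|) * X] and [`|c Y| * Y] the map then becomes the
    hyperbolic or elliptic form, according to the signs of [c] and [Q]
    ([fold_normal_form]).  The target map is a positive multiple of a linear
    isomorphism, hence radial ([radially_factored_transformation]). *)

Set Implicit Arguments.
Unset Strict Implicit.
Unset Printing Implicit Defensive.

Import Order.TTheory GRing.Theory Num.Theory.
Import numFieldNormedType.Exports.

Local Open Scope classical_set_scope.
Local Open Scope ring_scope.

(** * Calculus of functions of class C^k *)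

Section Differentials.
Context {R : realType} {V W : normedModType R}.
Implicit Types (f g : V -> W) (A : set V).

(** The little-o condition defining the differential in epsilon form; it produces
    a differential from an explicit linear candidate. *)
Lemma is_diff_eps f x (df : {linear V -> W}) : continuous df ->
  (forall e : R, 0 < e ->
    \forall h \near (0 : V), `|f (h + x) - f x - df h| <= e * `|h|) ->
  is_diff x f df.
Proof.
move=> cdf H.
have E : f \o shift x = cst (f x) + df +o_ (0 : V) id.
  apply/eqaddoP => e e0; near=> h.
  by rewrite /= opprD addrA; near: h; exact: H.
have dE := diff_unique cdf E.
apply: DiffDef => //; apply/diff_locallyP; rewrite dE; split => //.
Unshelve. all: by end_near. Qed.

Lemma diff_eps f x : differentiable f x -> forall e : R, 0 < e ->
  \forall h \near (0 : V), `|f (h + x) - f x - 'd f x h| <= e * `|h|.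
Proof.
move=> /diff_locally /eqaddoP H e e0; near=> h.
have : `|(f \o shift x - (cst (f x) + 'd f x)) h| <= e * `|h| by near: h; exact: H.
by rewrite /= opprD addrA.
Unshelve. all: by end_near. Qed.

Lemma near_differentiable f g x : (\forall z \near x, f z = g z) ->
  differentiable f x -> differentiable g x.
Proof.
move=> fg df.
have fgx : f x = g x by exact: (nbhs_singleton fg).
have fgs : \forall h \near (0 : V), f (h + x) = g (h + x).
  by move: fg; rewrite (near_shift 0) /= subr0.
suff [] : is_diff x g ('d f x) by [].
have H1 := @is_diff_eps g x ('d f x). apply: H1 => [|e e0]; first exact: diff_continuous.
near=> h; rewrite -fgx.
have <- : f (h + x) = g (h + x) by near: h.
by near: h; exact: diff_eps.
Unshelve. all: by end_near. Qed.

Lemma is_diff_deriveE f x (df : V -> W) v : is_diff x f df -> 'D_v f x = df v.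
Proof. by move=> H; rewrite deriveE // diff_val. Qed.

End Differentials.
Section Ck.
Context {R : realType} {V W : normedModType R}.
Implicit Types (f g : V -> W) (A : set V).

(** A derivative at a point of an open set only sees nearby values, so the class
    of a function on an open set depends on its restriction to that set. *)
Lemma Ck_ext A k f g : open A -> (forall x, A x -> f x = g x) ->
  Ck_on A k f -> Ck_on A k g.
Proof.
move=> oA; elim: k f g => [|k IH] f g fg /=.
  move=> cf x Ax; have fgn : \forall z \near x, f z = g z.
    by apply: filterS (open_nbhs_nbhs (conj oA Ax)) => z /fg.
  rewrite /prop_for /continuous_at -(fg x Ax).
  by apply: cvg_trans (cf x Ax); apply: near_eq_cvg.
move=> [df cf]; split=> [x Ax|v].
  apply: near_differentiable (df x Ax).
  by apply: filterS (open_nbhs_nbhs (conj oA Ax)) => z /fg.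
apply: IH (cf v) => x Ax; apply: near_eq_derive.
by apply: filterS (open_nbhs_nbhs (conj oA Ax)) => z /fg.
Qed.

Lemma Ck_sub A B k f : B `<=` A -> Ck_on A k f -> Ck_on B k f.
Proof.
move=> BA; elim: k f => [|k IH] f /=; first by move=> cf x /BA /cf.
by move=> [df cf]; split=> [x /BA/df//|v]; apply: IH.
Qed.

Lemma CkW A k f : Ck_on A k.+1 f -> Ck_on A k f.
Proof.
elim: k f => [|k IH] f [df cf] /=; last by split => // v; apply: IH.
by move=> x Ax; apply: differentiable_continuous; exact: df.
Qed.

Lemma Ck_cst A k (c : W) : Ck_on A k (fun=> c).
Proof.
elim: k c => [|k IH] c /=; first by move=> x _; exact: cvg_cst.
split=> [x _|v]; first exact: differentiable_cst.
have -> : 'D_v (fun=> c) = (fun=> 0 : W).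
  by apply/funext => x; exact: derive_cst.
exact: IH.
Qed.

Lemma CkD A k f g : open A -> Ck_on A k f -> Ck_on A k g -> Ck_on A k (f + g).
Proof.
move=> oA; elim: k f g => [|k IH] f g /=.
  by move=> cf cg x Ax; apply: cvgD; [exact: cf|exact: cg].
move=> [df cf] [dg cg]; split=> [x Ax|v].
  by apply: differentiableD; [exact: df|exact: dg].
apply: Ck_ext (IH _ _ (cf v) (cg v)) => // x Ax /=.
by rewrite deriveD //; apply: diff_derivable; [exact: df|exact: dg].
Qed.

Lemma Ck_lin A k (f : {linear V -> W}) : open A -> continuous f -> Ck_on A k f.
Proof.
move=> oA cf; case: k => [|k] /=; first by move=> x _; exact: cf.
split=> [x _|v]; first exact: linear_differentiable.
apply: Ck_ext (Ck_cst A k (f v)) => // x Ax.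
by rewrite deriveE ?diff_lin //; exact: linear_differentiable.
Qed.

Lemma Ck_differentiable A f x : smooth_on A f -> A x -> differentiable f x.
Proof. by move=> sf Ax; exact: (sf 1%N).1. Qed.

Lemma smooth_derive A f v : smooth_on A f -> smooth_on A ('D_v f).
Proof. by move=> sf k; exact: (sf k.+1).2. Qed.

Lemma smooth_continuous A f x : smooth_on A f -> A x -> {for x, continuous f}.
Proof. by move=> sf Ax; exact: (sf 0%N). Qed.

End Ck.

Section CkMul.
Context {R : realType} {V : normedModType R}.
Implicit Types (f g : V -> R) (A : set V).

Lemma CkM A k f g : open A -> Ck_on A k f -> Ck_on A k g -> Ck_on A k (f * g).
Proof.
move=> oA; elim: k f g => [|k IH] f g.
  by move=> cf cg x Ax; apply: cvgM; [exact: cf|exact: cg].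
move=> hf hg; have [df cf] := hf; have [dg cg] := hg; split=> [x Ax|v].
  by apply: differentiableM; [exact: df|exact: dg].
have H := CkD oA (IH _ _ (CkW hf) (cg v)) (IH _ _ (CkW hg) (cf v)).
apply: Ck_ext H => // x Ax /=.
by rewrite deriveM //; apply: diff_derivable; [exact: df|exact: dg].
Qed.

End CkMul.

Section CkPair.
Context {R : realType} {V W1 W2 : normedModType R}.
Implicit Types (A : set V).

Lemma derive_pair (f : V -> W1) (g : V -> W2) x v :
  differentiable f x -> differentiable g x ->
  'D_v (fun z => (f z, g z)) x = ('D_v f x, 'D_v g x).
Proof.
move=> df dg; rewrite deriveE; last exact: differentiable_pair.
by rewrite diff_pair // !deriveE.
Qed.

Lemma Ck_pair A k (f : V -> W1) (g : V -> W2) : open A ->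
  Ck_on A k f -> Ck_on A k g -> Ck_on A k (fun z => (f z, g z)).
Proof.
move=> oA; elim: k f g => [|k IH] f g /=.
  by move=> cf cg x Ax; apply: cvg_pair; [exact: cf|exact: cg].
move=> [df cf] [dg cg]; split=> [x Ax|v].
  by apply: differentiable_pair; [exact: df|exact: dg].
apply: Ck_ext (IH _ _ (cf v) (cg v)) => // x Ax.
by rewrite derive_pair; [|exact: df|exact: dg].
Qed.

Lemma continuous_fst_lin : continuous (fst : W1 * W2 -> W1).
Proof. by move=> x; exact: cvg_fst. Qed.
Lemma continuous_snd_lin : continuous (snd : W1 * W2 -> W2).
Proof. by move=> x; exact: cvg_snd. Qed.

Lemma differentiable_fst (x : W1 * W2) : differentiable fst x.
Proof. exact/linear_differentiable/continuous_fst_lin. Qed.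
Lemma differentiable_snd (x : W1 * W2) : differentiable snd x.
Proof. exact/linear_differentiable/continuous_snd_lin. Qed.

Lemma derive_fst (f : V -> W1 * W2) x v : differentiable f x ->
  'D_v (fun z => (f z).1) x = ('D_v f x).1.
Proof.
move=> df; rewrite !deriveE //; last first.
  by apply: differentiable_comp => //; exact: differentiable_fst.
rewrite (_ : (fun z => (f z).1) = fst \o f) // diff_comp //; last first.
  exact: differentiable_fst.
by rewrite /= diff_lin //; exact: continuous_fst_lin.
Qed.

Lemma derive_snd (f : V -> W1 * W2) x v : differentiable f x ->
  'D_v (fun z => (f z).2) x = ('D_v f x).2.
Proof.
move=> df; rewrite !deriveE //; last first.
  by apply: differentiable_comp => //; exact: differentiable_snd.
rewrite (_ : (fun z => (f z).2) = snd \o f) // diff_comp //; last first.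
  exact: differentiable_snd.
by rewrite /= diff_lin //; exact: continuous_snd_lin.
Qed.

Lemma Ck_fst A k (f : V -> W1 * W2) : open A ->
  Ck_on A k f -> Ck_on A k (fun z => (f z).1).
Proof.
move=> oA; elim: k f => [|k IH] f /=.
  by move=> cf x Ax; apply: (cvg_comp _ _ (cf x Ax)); exact: cvg_fst.
move=> [df cf]; split=> [x Ax|v].
  by apply: differentiable_comp (df x Ax) _; exact: differentiable_fst.
apply: Ck_ext (IH _ (cf v)) => // x Ax.
by rewrite derive_fst //; exact: df.
Qed.

Lemma Ck_snd A k (f : V -> W1 * W2) : open A ->
  Ck_on A k f -> Ck_on A k (fun z => (f z).2).
Proof.
move=> oA; elim: k f => [|k IH] f /=.
  by move=> cf x Ax; apply: (cvg_comp _ _ (cf x Ax)); exact: cvg_snd.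
move=> [df cf]; split=> [x Ax|v].
  by apply: differentiable_comp (df x Ax) _; exact: differentiable_snd.
apply: Ck_ext (IH _ (cf v)) => // x Ax.
by rewrite derive_snd //; exact: df.
Qed.

End CkPair.

Section Chain.
Context {R : realType} {U V W : normedModType R}.

Lemma deriveDv (f : V -> W) x v w : differentiable f x ->
  'D_(v + w) f x = 'D_v f x + 'D_w f x.
Proof. by move=> df; rewrite !deriveE // linearD. Qed.

Lemma deriveZv (f : V -> W) x (a : R) v : differentiable f x ->
  'D_(a *: v) f x = a *: 'D_v f x.
Proof. by move=> df; rewrite !deriveE // linearZ. Qed.

Lemma derive_chain (f : U -> V) (g : V -> W) x v :
  differentiable f x -> differentiable g (f x) ->
  'D_v (g \o f) x = 'D_('D_v f x) g (f x).
Proof.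
move=> df dg; rewrite !deriveE //; last exact: differentiable_comp.
by rewrite diff_comp.
Qed.

End Chain.

Section PairDir.
Context {R : realType} {W : normedModType R}.

Lemma pairE (a b : R) : (a, b) = a *: ((1, 0) : R * R) + b *: ((0, 1) : R * R).
Proof.
rewrite [RHS]surjective_pairing /=.
by congr (_, _); rewrite /GRing.scale /= ?mulr1 ?mulr0 ?addr0 ?add0r.
Qed.

Lemma derive_pairv (g : R * R -> W) y (v : R * R) : differentiable g y ->
  'D_v g y = v.1 *: 'D_(1, 0) g y + v.2 *: 'D_(0, 1) g y.
Proof.
by move=> dg; case: v => a b; rewrite [in LHS]pairE deriveDv // !deriveZv.
Qed.

End PairDir.

Section Comp.
Context {R : realType} {V : normedModType R}.

(** By the chain rule the derivative of the composite is a sum of products of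
    derivatives of [f] and derivatives of [g] composed with [f]; an induction on
    the class then only uses products, sums and composites of lower class.  Here
    the middle space is the line, in [Ck_comp2] it is the plane. *)
Lemma Ck_comp1 (A : set V) (B : set R) k (f : V -> R) (g : R -> R) :
  open A -> (forall x, A x -> B (f x)) ->
  Ck_on A k f -> Ck_on B k g -> Ck_on A k (g \o f).
Proof.
move=> oA fAB; elim: k f g fAB => [|k IH] f g fAB.
  move=> cf cg x Ax; apply: continuous_comp; [exact: cf|exact/cg/fAB].
move=> hf hg; have [df cf] := hf; have [dg cg] := hg; split=> [x Ax|v].
  by apply: differentiable_comp; [exact: df|exact/dg/fAB].
have H := CkM oA (cf v) (IH _ _ fAB (CkW hf) (cg 1)).
apply: Ck_ext H => // x Ax /=.
rewrite derive_chain; [|exact: df|exact/dg/fAB].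
have E : 'D_v f x = 'D_v f x *: (1 : R) by exact: esym (mulr1 _).
by rewrite [in RHS]E (deriveZv _ _ (dg _ (fAB _ Ax))).
Qed.

Lemma Ck_comp2 (A : set V) (B : set (R * R)) k (f : V -> R * R) (g : R * R -> R) :
  open A -> (forall x, A x -> B (f x)) ->
  Ck_on A k f -> Ck_on B k g -> Ck_on A k (g \o f).
Proof.
move=> oA fAB; elim: k f g fAB => [|k IH] f g fAB.
  move=> cf cg x Ax; apply: continuous_comp; [exact: cf|exact/cg/fAB].
move=> hf hg; have [df cf] := hf; have [dg cg] := hg; split=> [x Ax|v].
  by apply: differentiable_comp; [exact: df|exact/dg/fAB].
have I w := IH _ _ fAB (CkW hf) (cg w).
have H := CkD oA (CkM oA (Ck_fst oA (cf v)) (I (1, 0)))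
                 (CkM oA (Ck_snd oA (cf v)) (I (0, 1))).
apply: Ck_ext H => // x Ax /=.
rewrite derive_chain; [|exact: df|exact/dg/fAB].
by rewrite [RHS]derive_pairv //; exact/dg/fAB.
Qed.

Lemma Ck_comp22 (A : set V) (B : set (R * R)) k (f : V -> R * R)
    (g : R * R -> R * R) :
  open A -> open B -> (forall x, A x -> B (f x)) ->
  Ck_on A k f -> Ck_on B k g -> Ck_on A k (g \o f).
Proof.
move=> oA oB fAB cf cg.
have H := Ck_pair oA (Ck_comp2 oA fAB cf (Ck_fst oB cg))
                     (Ck_comp2 oA fAB cf (Ck_snd oB cg)).
by apply: Ck_ext H => // x Ax /=; rewrite -surjective_pairing.
Qed.

End Comp.

Section MeanValue.
Context {R : realType} {V : normedModType R}.

Lemma derive_line (f : V -> R) (x v : V) (s : R) :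
  differentiable f (x + s *: v) ->
  is_derive s 1 (fun t : R => f (x + t *: v)) ('D_v f (x + s *: v)).
Proof.
move=> df.
have dl : is_diff s (fun t : R => x + t *: v) (fun t => t *: v).
  rewrite (_ : (fun t : R => t *: v) = cst 0 + (fun t : R => t *: v)); last first.
    by apply/funext => t; rewrite /= add0r.
  have -> : (fun t : R => x + t *: v) = cst x + (fun t => t *: v) by [].
  exact: is_diffD.
have dl' : differentiable (fun t : R => x + t *: v) s by [].
have D1 : 'D_1 (fun t : R => x + t *: v) s = v.
  by rewrite (is_diff_deriveE _ dl) scale1r.
have := @derive_chain R R V R _ _ _ 1 dl' df; rewrite D1 => E.
apply: DeriveDef; last by [].
by apply: diff_derivable; apply: differentiable_comp dl' df.
Qed.

Lemma mean_value (f : V -> R) (x y : V) :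
  (forall s : R, 0 <= s <= 1 -> differentiable f (x + s *: (y - x))) ->
  exists2 s : R, 0 <= s <= 1 & f y - f x = 'D_(y - x) f (x + s *: (y - x)).
Proof.
move=> df; set v := y - x.
pose phi (t : R) := f (x + t *: v).
have dphi (s : R) : 0 <= s <= 1 -> is_derive s (1 : R) phi ('D_v f (x + s *: v)).
  by move=> s01; apply: derive_line; exact: df.
have [||c] := @MVT_segment R phi (fun s => 'D_v f (x + s *: v)) 0 1 ler01.
- by move=> s; rewrite in_itv /= => /andP[/ltW s0 /ltW s1]; apply: dphi; rewrite s0.
- apply: derivable_within_continuous => s; rewrite in_itv /= => s01.
  by have [] := dphi s s01.
rewrite in_itv /= => c01 E; exists c => //.
by rewrite -[RHS]mulr1 -[X in _ * X]subr0 -E /phi scale1r scale0r addr0 subrKC.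
Qed.

End MeanValue.

(** * Norms, compact balls and quotients *)

Lemma pair_ext {T U : Type} (x y : T * U) : x.1 = y.1 -> x.2 = y.2 -> x = y.
Proof. by case: x y => [? ?] [? ?] /= -> ->. Qed.

Section Norms.
Context {R : realType}.

Lemma lincombB {V : lmodType R} (a b : R) (x y x' y' : V) :
  a *: x + b *: y - (a *: x' + b *: y') = a *: (x - x') + b *: (y - y').
Proof. by rewrite opprD addrACA !scalerBr. Qed.

Lemma norm_pair_le {U V : normedModType R} (x : U * V) (e : R) :
  (`|x| <= e) = (`|x.1| <= e) && (`|x.2| <= e).
Proof. by rewrite prod_normE /= ge_max. Qed.

Lemma norm_pair_lt {U V : normedModType R} (x : U * V) (e : R) :
  (`|x| < e) = (`|x.1| < e) && (`|x.2| < e).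
Proof. by rewrite prod_normE /= gt_max. Qed.

Lemma norm_fst_le {U V : normedModType R} (x : U * V) : `|x.1| <= `|x|.
Proof. by have := lexx `|x|; rewrite norm_pair_le => /andP[]. Qed.

Lemma norm_snd_le {U V : normedModType R} (x : U * V) : `|x.2| <= `|x|.
Proof. by have := lexx `|x|; rewrite norm_pair_le => /andP[]. Qed.

Lemma cball_prod {U V : normedModType R} (p : U * V) (r : R) :
  [set z | `|z - p| <= r] =
  [set u | `|u - p.1| <= r] `*` [set v | `|v - p.2| <= r].
Proof.
by apply/seteqP; split => z /=; rewrite norm_pair_le => /andP.
Qed.

Lemma compact_cball1 (p r : R) : compact [set u : R | `|u - p| <= r].
Proof.
rewrite (_ : [set _ | _] = `[p - r, p + r]%classic); first exact: segment_compact.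
by apply/seteqP; split => z /=; rewrite in_itv /= ler_distl.
Qed.

Lemma compact_cball2 (p : R * R) (r : R) : compact [set z | `|z - p| <= r].
Proof. by rewrite cball_prod; apply: compact_setX; exact: compact_cball1. Qed.

Lemma compact_cball3 (p : R * R * R) (r : R) : compact [set z | `|z - p| <= r].
Proof.
by rewrite cball_prod; apply: compact_setX; [exact: compact_cball2|exact: compact_cball1].
Qed.

Lemma compact_min {T : topologicalType} (K : set T) (f : T -> R) :
  compact K -> K !=set0 -> (forall x, K x -> {for x, continuous f}) ->
  exists2 c, K c & forall x, K x -> f c <= f x.
Proof.
move=> cK K0 cf; have [|c /set_mem Kc H] := compact_EVT_min K0 cK (f := f).
  by apply: continuous_in_subspaceT => x /set_mem /cf.
by exists c => // x Kx; apply: H; exact: mem_set.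
Qed.

Lemma compact_ubound {T : topologicalType} (K : set T) (f : T -> R) :
  compact K -> (forall x, K x -> {for x, continuous f}) ->
  exists2 M, 0 < M & forall x, K x -> `|f x| <= M.
Proof.
move=> cK cf; have [K0|K0] := pselect (K !=set0); last first.
  by exists 1 => // x Kx; exfalso; apply: K0; exists x.
have [|c /set_mem Kc H] := compact_EVT_max K0 cK (f := fun x => `|f x|).
  apply: continuous_in_subspaceT => x /set_mem /cf cfx.
  exact: continuous_comp cfx (@norm_continuous _ _ _).
exists (`|f c| + 1) => [|x Kx]; first by rewrite ltr_wpDl.
by rewrite (le_trans (H x (mem_set Kx))) // lerDl.
Qed.

Lemma cvg_norm_eps {T : topologicalType} {V : normedModType R} (f : T -> V) x :
  {for x, continuous f} -> forall e : R, 0 < e -> \forall z \near x, `|f z - f x| < e.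
Proof.
move=> cf e e0; have /cvgrPdist_lt /(_ e e0) := cf.
by apply: filterS => z; rewrite distrC.
Qed.

Lemma near_radius {V : normedModType R} (p : V) (P : V -> Prop) :
  (\forall z \near p, P z) -> exists2 r : R, 0 < r & forall z, `|z - p| <= r -> P z.
Proof.
move=> /nbhs_ballP [r /= r0 Hr]; exists (r / 2) => [|z zp]; first by rewrite divr_gt0.
apply: Hr; rewrite -ball_normE /ball_ /= distrC (le_lt_trans zp) //.
by rewrite ltr_pdivrMr // ltr_pMr // ltr1n.
Qed.

Lemma radius_near {V : normedModType R} (p : V) (P : V -> Prop) (r : R) : 0 < r ->
  (forall z, `|z - p| < r -> P z) -> \forall z \near p, P z.
Proof.
move=> r0 H; apply/nbhs_ballP; exists r => // z.
by rewrite -ball_normE /ball_ /= distrC => /H.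
Qed.

Lemma open_oball {V : normedModType R} (p : V) (r : R) : open [set z | `|z - p| < r].
Proof.
rewrite openE => z /= zp; apply: (radius_near (r := r - `|z - p|)).
  by rewrite subr_gt0.
move=> w; rewrite ltrBrDr => h; apply: le_lt_trans h.
by rewrite -(subrKA z) ler_normD.
Qed.

End Norms.

Section SmoothOne.
Context {R : realType}.

Lemma open_neq0 : open [set x : R | x != 0].
Proof. exact: open_neq. Qed.

Lemma Ck_inv k : Ck_on [set x : R | x != 0] k (fun x : R => x^-1).
Proof.
elim: k => [|k IH].
  by move=> x x0; apply: cvgV => //; exact: cvg_id.
split=> [x x0|v]; first by apply: differentiable_Rinv.
have H := CkM open_neq0 (Ck_cst _ k (- v : R)) (CkM open_neq0 IH IH).
apply: Ck_ext open_neq0 _ H => x /= x0.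
rewrite deriveE; last exact: differentiable_Rinv.
rewrite diff_Rinv //=.
have -> : x ^- 2 = x^-1 * x^-1 by rewrite expr2 invfM.
transitivity ((- v) * (x^-1 * x^-1)) => //.
by rewrite scaleNr mulNr; congr (- _); exact: mulrC.
Qed.

Context {V : normedModType R}.

Lemma CkV (A : set V) k (f : V -> R) : open A -> (forall x, A x -> f x != 0) ->
  Ck_on A k f -> Ck_on A k (fun x => (f x)^-1).
Proof.
move=> oA f0 cf.
exact: (Ck_comp1 (B := [set x : R | x != 0]) oA f0 cf (Ck_inv k)).
Qed.

Lemma CkN (A : set V) k (f : V -> R) : open A -> Ck_on A k f ->
  Ck_on A k (fun x => - f x).
Proof.
move=> oA cf; apply: Ck_ext (CkM oA (Ck_cst A k (-1 : R)) cf) => // x _.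
by rewrite [LHS]mulN1r.
Qed.

Lemma CkB (A : set V) k (f g : V -> R) : open A -> Ck_on A k f -> Ck_on A k g ->
  Ck_on A k (fun x => f x - g x).
Proof. by move=> oA cf cg; exact: (CkD oA cf (CkN oA cg)). Qed.

End SmoothOne.

Section Lin22.
Context {R : realType}.

Definition lin22 (a b c d : R) (v : R * R) : R * R :=
  (a * v.1 + b * v.2, c * v.1 + d * v.2).

Fact lin22_linear a b c d : linear (lin22 a b c d).
Proof.
move=> k u v; rewrite [RHS]surjective_pairing /lin22 /=.
by congr (_, _); rewrite /GRing.scale /=; ring.
Qed.

HB.instance Definition _ a b c d := GRing.isLinear.Build R (R * R)%type (R * R)%type
  *:%R (lin22 a b c d) (lin22_linear a b c d).

Lemma Ck_lin22 (A : set (R * R)) k (a b c d : R) : open A -> Ck_on A k (lin22 a b c d).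
Proof.
move=> oA.
have i1 : Ck_on A k (fst : R * R -> R) by apply: Ck_lin => // x; exact: cvg_fst.
have i2 : Ck_on A k (snd : R * R -> R) by apply: Ck_lin => // x; exact: cvg_snd.
apply: (@Ck_pair _ _ _ _ A k (fun v => a * v.1 + b * v.2)) => //.
  exact: (CkD oA (CkM oA (Ck_cst A k a) i1) (CkM oA (Ck_cst A k b) i2)).
exact: (CkD oA (CkM oA (Ck_cst A k c) i1) (CkM oA (Ck_cst A k d) i2)).
Qed.

Definition lin21 (a b : R) (v : R * R) : R := v.1 * a + v.2 * b.

Fact lin21_linear a b : linear (lin21 a b).
Proof. by move=> k u v; rewrite /lin21 /= /GRing.scale /=; ring. Qed.

HB.instance Definition _ a b := GRing.isLinear.Build R (R * R)%type R
  *:%R (lin21 a b) (lin21_linear a b).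

Lemma lin21_continuous a b : continuous (lin21 a b).
Proof.
move=> x; apply: cvgD; apply: cvgM; try exact: cvg_cst; [exact: cvg_fst|exact: cvg_snd].
Qed.

Lemma lin22_continuous a b c d : continuous (lin22 a b c d).
Proof. by move=> x; exact: (@Ck_lin22 setT 0 a b c d openT). Qed.

End Lin22.

(** * Inverse function theorem in the plane *)

Section InverseId.
Context {R : realType}.
Notation C := (R * R)%type.
Variables (A : set C) (F : C -> C) (p : C).
Hypotheses (oA : open A) (Ap : A p) (sF : smooth_on A F).
Hypothesis DFp : forall v, 'D_v F p = v.

Let dF z : A z -> differentiable F z.
Proof. exact: Ck_differentiable. Qed.

(** If the differential of [F] at [p] is the identity, it stays uniformly close to
    the identity on a small ball; this ball supports the whole construction of
    the local inverse. *)
Lemma near_id_radius : exists2 r : R, 0 < r &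
  forall z, `|z - p| <= r -> A z /\ forall v, `|'D_v F z - v| <= `|v| / 4.
Proof.
have nA : \forall z \near p, A z by exact: open_nbhs_nbhs.
have q0 : 0 < 8^-1 :> R by rewrite invr_gt0.
have c1 := cvg_norm_eps (smooth_continuous (smooth_derive ((1, 0) : C) sF) Ap) q0.
have c2 := cvg_norm_eps (smooth_continuous (smooth_derive ((0, 1) : C) sF) Ap) q0.
have [r r0 Hr] : exists2 r : R, 0 < r & forall z, `|z - p| <= r ->
    [/\ A z, `|'D_(1, 0) F z - 'D_(1, 0) F p| < 8^-1 &
        `|'D_(0, 1) F z - 'D_(0, 1) F p| < 8^-1].
  apply: near_radius; move: nA c1 c2; apply: filterS3 => z Az h1 h2.
  exact: And3 Az h1 h2.
exists r => // z /Hr [Az h1 h2].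
split => // v.
rewrite derive_pairv; last exact: dF.
rewrite [X in _ - X](_ : v = v.1 *: ((1, 0) : C) + v.2 *: ((0, 1) : C)); last first.
  by rewrite -pairE -surjective_pairing.
rewrite lincombB.
rewrite !DFp in h1 h2.
rewrite (le_trans (ler_normD _ _)) // !normrZ.
have n1 := norm_fst_le v; have n2 := norm_snd_le v.
have -> : `|v| / 4 = `|v| * 8^-1 + `|v| * 8^-1 by field.
by apply: lerD; apply: ler_pM => //; exact: ltW.
Qed.

(** Mean value inequality for [F - id], one coordinate at a time. *)
Lemma near_id_expand (r : R) :
  (forall z, `|z - p| <= r -> A z /\ forall v, `|'D_v F z - v| <= `|v| / 4) ->
  forall z w, `|z - p| <= r -> `|w - p| <= r ->
  `|F z - F w - (z - w)| <= `|z - w| / 4.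
Proof.
move=> Hr z w zp wp.
have seg s : 0 <= s <= 1 -> `|w + s *: (z - w) - p| <= r.
  move=> /andP[s0 s1].
  have -> : w + s *: (z - w) - p = s *: (z - p) + (1 - s) *: (w - p).
    have -> : z - w = (z - p) - (w - p) by rewrite opprB addrA subrK.
    rewrite addrAC; move: (z - p) (w - p) => a b.
    by rewrite scalerBr scalerBl scale1r addrCA.
  rewrite (le_trans (ler_normD _ _)) // !normrZ ger0_norm // ger0_norm ?subr_ge0 //.
  have -> : r = s * r + (1 - s) * r by ring.
  by apply: lerD; apply: ler_wpM2l => //; rewrite subr_ge0.
rewrite norm_pair_le; apply/andP; split.
- have [s s01] := @mean_value R C (fun u => (F u).1) w z
    (fun s s01 => differentiable_comp (dF (Hr _ (seg s s01)).1) (differentiable_fst _)).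
  have [As Ds] := Hr _ (seg s s01); move: (Ds (z - w)).
  rewrite derive_fst; last exact: dF.
  rewrite norm_pair_le => /andP[h _] E.
  by rewrite /= E.
- have [s s01] := @mean_value R C (fun u => (F u).2) w z
    (fun s s01 => differentiable_comp (dF (Hr _ (seg s s01)).1) (differentiable_snd _)).
  have [As Ds] := Hr _ (seg s s01); move: (Ds (z - w)).
  rewrite derive_snd; last exact: dF.
  rewrite norm_pair_le => /andP[_ h] E.
  by rewrite /= E.
Qed.

Variable r : R.
Hypothesis r0 : 0 < r.
Hypothesis Hr : forall z, `|z - p| <= r -> A z /\ forall v, `|'D_v F z - v| <= `|v| / 4.

Let expand := near_id_expand Hr.

Lemma near_id_inj z w : `|z - p| <= r -> `|w - p| <= r ->
  `|z - w| <= 2 * `|F z - F w|.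
Proof.
move=> zp wp; have h := expand zp wp.
have : `|z - w| <= `|F z - F w - (z - w)| + `|F z - F w|.
  by rewrite [leRHS]addrC -{1}(subKr (F z - F w) (z - w)); exact: ler_normB.
move: h (normr_ge0 (F z - F w)); lra.
Qed.

(** The distance [`|b - F z|] attains its minimum on the closed ball.  The Newton
    step from the minimizer [z] to [z + (b - F z)] stays in the ball and shrinks
    this distance by a factor, so that the minimum has to be zero. *)
Lemma near_id_surj b : `|b - F p| < r / 2 ->
  exists2 z, `|z - p| < r & F z = b.
Proof.
move=> bp; pose K := [set z | `|z - p| <= r].
have Kp : K p by rewrite /K /= subrr normr0 ltW.
have cf z : K z -> {for z, continuous (fun z => `|b - F z|)}.
  move=> Kz; have cF : {for z, continuous F} by exact: smooth_continuous (Hr Kz).1.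
  by apply: cvg_norm; apply: cvgB => //; exact: cvg_cst.
have [z Kz zmin] := compact_min (compact_cball2 (p := p) (r := r)) (ex_intro _ p Kp) cf.
pose w := z + (b - F z).
have wp : `|w - p| < r.
  have h := expand Kz Kp.
  have -> : w - p = - (F z - F p - (z - p)) + (b - F p).
    by apply: pair_ext; rewrite /=; ring.
  rewrite (le_lt_trans (ler_normD _ _)) // normrN.
  have : `|z - p| <= r by [].
  by move: h bp (r0); lra.
have wz : `|b - F w| <= `|b - F z| / 4.
  have h := expand (ltW wp) Kz.
  have E1 : w - z = b - F z by rewrite /w addrAC subrr add0r.
  have E : F w - F z - (w - z) = F w - b by rewrite E1 opprB addrA subrK.
  by move: h; rewrite E E1 distrC.
have bz : b = F z.
  have := zmin w (ltW wp); have := normr_ge0 (b - F z) => g0 g1.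
  apply/eqP; rewrite -subr_eq0 -normr_eq0; apply/eqP; lra.
exists z => //.
by move: wp; rewrite /w bz subrr addr0.
Qed.

Let det z := ('D_(1, 0) F z).1 * ('D_(0, 1) F z).2 -
             ('D_(0, 1) F z).1 * ('D_(1, 0) F z).2.

Lemma near_id_det z : `|z - p| <= r -> 2^-1 <= det z.
Proof.
move=> zp; have [_ H] := Hr zp.
have := H ((1, 0) : C); have := H ((0, 1) : C).
rewrite /det; move: ('D_(1, 0) F z) ('D_(0, 1) F z) => [a c] [b d] /=.
have -> : `|(0, 1) : C| = 1 by rewrite prod_normE /= normr0 normr1 (max_r ler01).
have -> : `|(1, 0) : C| = 1 by rewrite prod_normE /= normr0 normr1 (max_l ler01).
rewrite !norm_pair_le /= !ler_norml => /andP[/andP[b1 b2] /andP[d1 d2]].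
move=> /andP[/andP[a1 a2] /andP[c1 c2]].
have : 9 / 16 <= a * d by nra.
have : b * c <= 1 / 16 by nra.
lra.
Qed.

Let B := [set b | `|b - F p| < r / 2].
Let U := [set z | `|z - p| < r] `&` F @^-1` B.

Variable G : C -> C.
Hypothesis HG : forall b, B b -> `|G b - p| < r /\ F (G b) = b.

Let Ginj z : U z -> G (F z) = z.
Proof.
move=> [zr Bz]; have [Gr FG] := HG Bz.
have := near_id_inj (ltW Gr) (ltW zr).
by rewrite FG subrr normr0 mulr0 normr_le0 subr_eq0 => /eqP.
Qed.

Let GU b : B b -> U (G b).
Proof. by move=> Bb; have [Gr FG] := HG Bb; split; rewrite //= /preimage /= FG. Qed.

Let oB : open B. Proof. exact: open_oball. Qed.

Let oU : open U.
Proof.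
rewrite openE => z [zr Bz]; apply: filterI.
  exact: (open_nbhs_nbhs (conj (@open_oball _ _ p r) zr)).
have cF : {for z, continuous F} by exact: smooth_continuous (Hr (ltW zr)).1.
exact: cF (open_nbhs_nbhs (conj oB Bz)).
Qed.

Let Ndet w z : C :=
  lin22 (('D_(0, 1) F z).2 / det z) (- ('D_(0, 1) F z).1 / det z)
        (- ('D_(1, 0) F z).2 / det z) (('D_(1, 0) F z).1 / det z) w.

(** The differential of the inverse is the inverse matrix of the differential of
    [F]; the estimate uses that the inverse is Lipschitz. *)
Lemma near_id_diff_inv b : B b ->
  is_diff b G (fun w => Ndet w (G b)).
Proof.
move=> Bb; have [Gr FG] := HG Bb; set z := G b.
have [Az Dz] := Hr (ltW Gr).
have dz : det z != 0.
  by rewrite gt_eqF // (lt_le_trans _ (near_id_det (ltW Gr))) // invr_gt0.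
have NL v : Ndet ('D_v F z) z = v.
  rewrite derive_pairv; last exact: dF.
  rewrite /Ndet; move: dz; rewrite /det.
  move: ('D_(1, 0) F z) ('D_(0, 1) F z) => [a c] [b' d] /= dz.
  by apply: pair_ext; rewrite /= /GRing.scale /=; field.
have LN w : 'D_(Ndet w z) F z = w.
  rewrite derive_pairv; last exact: dF.
  rewrite /Ndet; move: dz; rewrite /det.
  move: ('D_(1, 0) F z) ('D_(0, 1) F z) => [a c] [b' d] /= dz.
  by apply: pair_ext; rewrite /= /GRing.scale /=; field.
have Nle w : `|Ndet w z| <= 2 * `|w|.
  have := Dz (Ndet w z); rewrite LN => h.
  have : `|Ndet w z| <= `|w - Ndet w z| + `|w|.
    by rewrite [leRHS]addrC -{1}(subKr w (Ndet w z)); exact: ler_normB.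
  by move: h (normr_ge0 w); lra.
have H1 := @is_diff_eps R C C G b
  (lin22 (('D_(0, 1) F z).2 / det z) (- ('D_(0, 1) F z).1 / det z)
        (- ('D_(1, 0) F z).2 / det z) (('D_(1, 0) F z).1 / det z)).
apply: H1; first exact: lin22_continuous.
move=> e e0.
have e4 : 0 < e / 4 by rewrite divr_gt0.
have [d d0 Hd] := near_radius (diff_eps (dF Az) e4).
apply: (radius_near (r := Num.min (d / 2) (r / 2 - `|b - F p|))).
  by rewrite lt_min divr_gt0 //= subr_gt0.
move=> h; rewrite subr0 lt_min => /andP[hd hr].
have Bbh : B (h + b).
  rewrite /B /= -addrA (le_lt_trans (ler_normD _ _)) //.
  by move: hr; rewrite ltrBrDr.
have [Gr' FG'] := HG Bbh.
set k := G (h + b) - z.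
have Gk : G (h + b) = k + z by rewrite /k subrK.
have kh : `|k| <= 2 * `|h|.
  have := near_id_inj (ltW Gr') (ltW Gr).
  by rewrite FG' FG addrK.
have := Hd k; rewrite subr0 -Gk FG' FG addrK => Hk.
have kd : `|k| <= d by move: kh hd; lra.
have {}Hk := Hk kd.
rewrite -deriveE in Hk; last exact: dF.
have -> : k - Ndet h z = - Ndet (h - 'D_k F z) z.
  by rewrite -{1}(NL k) /Ndet linearB opprB.
rewrite normrN (le_trans (Nle _)) //.
have : e / 4 * `|k| <= e / 4 * (2 * `|h|) by rewrite ler_wpM2l // ltW.
move: Hk; lra.
Qed.

(** The entries of the differential of [G] are rational in the partial derivatives
    of [F], taken at [G b]: if [G] is of class [k], so is its differential, and
    [G] is of class [k.+1]. *)
Lemma near_id_smooth_inv : smooth_on B G.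
Proof.
have dG b : B b -> differentiable G b by move=> /near_id_diff_inv [].
have UA z : U z -> A z by move=> [/ltW zr _]; exact: (Hr zr).1.
have det0 z : U z -> det z != 0.
  move=> [/ltW zr _].
  by rewrite gt_eqF // (lt_le_trans _ (near_id_det zr)) // invr_gt0.
elim=> [|k IH]; first by move=> b /dG; exact: differentiable_continuous.
split=> // v.
have p1 w : Ck_on U k (fun z => ('D_w F z).1).
  exact: (Ck_fst oU (Ck_sub UA (smooth_derive w sF k))).
have p2 w : Ck_on U k (fun z => ('D_w F z).2).
  exact: (Ck_snd oU (Ck_sub UA (smooth_derive w sF k))).
have cdet : Ck_on U k (fun z => (det z)^-1).
  exact: (CkV oU det0 (CkB oU (CkM oU (p1 _) (p2 _)) (CkM oU (p1 _) (p2 _)))).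
have cc (f : C -> R) : Ck_on U k f -> Ck_on U k (fun z => f z / det z).
  by move=> cf; exact: (CkM oU cf cdet).
have cN : Ck_on U k (Ndet v).
  have cl (f g : C -> R) : Ck_on U k f -> Ck_on U k g ->
      Ck_on U k (fun z => f z / det z * v.1 + g z / det z * v.2).
    move=> cf cg.
    exact: (CkD oU (CkM oU (cc _ cf) (Ck_cst U k v.1))
                   (CkM oU (cc _ cg) (Ck_cst U k v.2))).
  exact: (Ck_pair oU (cl _ _ (p2 _) (CkN oU (p1 _))) (cl _ _ (CkN oU (p2 _)) (p1 _))).
have H := Ck_comp22 oB oU GU IH cN.
apply: Ck_ext oB _ H => b Bb /=.
by rewrite (is_diff_deriveE v (near_id_diff_inv Bb)).
Qed.

Lemma near_id_diffeo : diffeo U B F.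
Proof.
split=> //.
- move=> k; apply: Ck_sub (sF k) => z [/ltW zr _]; exact: (Hr zr).1.
- apply/seteqP; split => [_ [z [zr Bz] <-] //|b Bb].
  by exists (G b); [exact: GU|exact: (HG Bb).2].
- by exists G; [exact: near_id_smooth_inv|exact: Ginj].
Qed.

End InverseId.

Theorem ift_id {R : realType} (A : set (R * R)) (F : R * R -> R * R) (p : R * R) :
  open A -> A p -> smooth_on A F -> (forall v, 'D_v F p = v) ->
  local_diffeo F p (F p).
Proof.
move=> oA Ap sF DFp.
have [r r0 Hr] := near_id_radius oA Ap sF DFp.
pose B := [set b | `|b - F p| < r / 2].
have [G HG] : exists G : R * R -> R * R, forall b, B b -> `|G b - p| < r /\ F (G b) = b.
  have /choice [G HG] : forall b, exists z, B b -> `|z - p| < r /\ F z = b.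
    move=> b; have [Bb|nBb] := pselect (B b); last by exists p.
    by have [z zr Fz] := near_id_surj sF r0 Hr Bb; exists z.
  by exists G.
split=> //; exists ([set z | `|z - p| < r] `&` F @^-1` B), B; split.
  by split; rewrite /preimage /B /= subrr normr0 // divr_gt0.
by have := near_id_diffeo sF Hr HG.
Qed.

Section LocalDiffeo.
Context {R : realType}.
Notation C := (R * R)%type.

Lemma diffeo_inv (A B : set C) (f : C -> C) : diffeo A B f ->
  exists2 g : C -> C, diffeo B A g &
    (forall x, A x -> B (f x) /\ g (f x) = x) /\
    (forall y, B y -> A (g y) /\ f (g y) = y).
Proof.
move=> [oA oB sf fAB [g sg gf]].
have fB x : A x -> B (f x) by move=> Ax; rewrite -fAB; exists x.
have gA y : B y -> A (g y) /\ f (g y) = y.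
  by rewrite -{1}fAB => -[x Ax <-]; rewrite gf.
exists g; last by split=> // x Ax; split; [exact: fB|exact: gf].
split=> //; last by exists f => // y /gA [].
apply/seteqP; split => [_ [y By <-]|x Ax]; first by case: (gA y By).
by exists (f x); [exact: fB|exact: gf].
Qed.

Lemma local_diffeo_inv (f : C -> C) (p q : C) : local_diffeo f p q ->
  exists2 g : C -> C, local_diffeo g q p &
    (\forall y \near q, f (g y) = y) /\ (\forall x \near p, g (f x) = x).
Proof.
move=> [fpq [A [B [Ap dAB]]]]; have [g dg [h1 h2]] := diffeo_inv dAB.
have [Bq gq] : B q /\ g q = p by rewrite -fpq; exact: h1.
have [oB oA _ _ _] := dg.
exists g; first by split=> //; exists B, A.
split.
  by apply: filterS (open_nbhs_nbhs (conj oB Bq)) => y /h2 [].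
by apply: filterS (open_nbhs_nbhs (conj oA Ap)) => x /h1 [].
Qed.

Lemma open_preimage_on (A : set C) (D : set C) (f : C -> C) : open A -> open D ->
  (forall x, A x -> {for x, continuous f}) -> open (A `&` f @^-1` D).
Proof.
move=> oA oD cf; rewrite openE => x [Ax Dx]; apply: filterI.
  exact: (open_nbhs_nbhs (conj oA Ax)).
exact: cf Ax _ (open_nbhs_nbhs (conj oD Dx)).
Qed.

Lemma local_diffeo_comp (f g : C -> C) (p q r : C) :
  local_diffeo f p q -> local_diffeo g q r -> local_diffeo (g \o f) p r.
Proof.
move=> [fpq [A [B [Ap dAB]]]] [gqr [D [E [Dq dDE]]]].
have [f' df [f1 f2]] := diffeo_inv dAB; have [g' dg [g1 g2]] := diffeo_inv dDE.
have [oA oB sf _ _] := dAB; have [oD oE sg _ _] := dDE.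
have [_ _ sf' _ _] := df; have [_ _ sg' _ _] := dg.
have oA' : open (A `&` f @^-1` D).
  by apply: open_preimage_on => // x Ax; exact: (sf 0%N).
have oE' : open (E `&` g' @^-1` B).
  by apply: open_preimage_on => // x Ax; exact: (sg' 0%N).
split; first by rewrite /= fpq.
exists (A `&` f @^-1` D), (E `&` g' @^-1` B); split.
  by split=> //; rewrite /preimage /= fpq.
split=> //.
- move=> k; apply: (Ck_comp22 (B := D)) => //; first by move=> x [].
  by apply: Ck_sub (sf k) => x [].
- apply/seteqP; split => [_ [x [Ax Dx] <-]|y [Ey By]].
    have [Efx gfx] := g1 _ Dx; split => //=.
    by rewrite /preimage /= gfx; case: (f1 _ Ax).
  have [Af ff] := f2 _ By; have [Dg gg] := g2 _ Ey.
  exists (f' (g' y)) => /=; last by rewrite ff gg.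
  by split=> //; rewrite /preimage /= ff.
- exists (f' \o g') => [k|x [Ax Dx]] /=.
    apply: (Ck_comp22 (B := B)) => //; first by move=> y [].
    by apply: Ck_sub (sg' k) => y [].
  by have [_ ->] := g1 _ Dx; have [_ ->] := f1 _ Ax.
Qed.

Lemma local_diffeo_lin (a b c d : R) p : a * d - b * c != 0 ->
  local_diffeo (lin22 a b c d) p (lin22 a b c d p).
Proof.
move=> D0; split=> //; exists setT, setT; split=> //.
set D := a * d - b * c in D0.
have inv v : lin22 (d / D) (- b / D) (- c / D) (a / D) (lin22 a b c d v) = v.
  by apply: pair_ext; rewrite /= /D; field.
have inv' v : lin22 a b c d (lin22 (d / D) (- b / D) (- c / D) (a / D) v) = v.
  by apply: pair_ext; rewrite /= /D; field.
split=> //; try exact: openT.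
- by move=> k; apply: Ck_lin22; exact: openT.
- by apply/seteqP; split=> // y _; exists (lin22 (d / D) (- b / D) (- c / D) (a / D) y).
- exists (lin22 (d / D) (- b / D) (- c / D) (a / D)) => //.
  by move=> k; apply: Ck_lin22; exact: openT.
Qed.

Definition jacobian_det (F : C -> C) (z : C) : R :=
  ('D_(1, 0) F z).1 * ('D_(0, 1) F z).2 - ('D_(0, 1) F z).1 * ('D_(1, 0) F z).2.

(** Inverse function theorem in the plane: composing with the inverse of the
    differential at [p] reduces to a differential equal to the identity. *)
Theorem inverse_function (A : set C) (F : C -> C) (p : C) :
  open A -> A p -> smooth_on A F -> jacobian_det F p != 0 -> local_diffeo F p (F p).
Proof.
move=> oA Ap sF.
rewrite /jacobian_det.
case E1 : ('D_(1, 0) F p) => [a c]; case E2 : ('D_(0, 1) F p) => [b d] /= D0.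
set D := a * d - b * c in D0.
pose N := lin22 (d / D) (- b / D) (- c / D) (a / D).
pose M := lin22 a b c d.
have inv' v : M (N v) = v.
  by apply: pair_ext; rewrite /= /D; field.
have -> : F = M \o (N \o F) by apply/funext => z /=; rewrite inv'.
apply: (@local_diffeo_comp _ _ p ((N \o F) p)); last exact: local_diffeo_lin.
have dF : differentiable F p by exact: Ck_differentiable sF Ap.
have dN x : differentiable N x.
  by apply: linear_differentiable; exact: lin22_continuous.
apply: (ift_id (A := A)) => // [k|v].
  exact: (Ck_comp22 (B := setT) oA openT (fun _ _ => I) (sF k) (Ck_lin22 k _ _ _ _ openT)).
rewrite derive_chain // [LHS]deriveE // /N diff_lin; last exact: lin22_continuous.
rewrite derive_pairv // E1 E2.
by apply: pair_ext; rewrite /= /GRing.scale /= /D; field.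
Qed.

End LocalDiffeo.

(** * Hadamard's lemma *)

Section Mean.
Context {R : realType}.
Notation mu := (@lebesgue_measure R).

Definition cont01 (f : R -> R) := forall s : R, 0 <= s <= 1 -> {for s, continuous f}.

Definition mean01 (f : R -> R) : R := \int[mu]_(s in `[0, 1]) f s.

Let m01 : measurable (`[0, 1]%classic : set (measurableTypeR R)). Proof. exact: measurable_itv. Qed.

Lemma cont01_within f : cont01 f -> {within `[0, 1], continuous f}.
Proof.
move=> cf; apply: continuous_in_subspaceT => s /set_mem /=.
by rewrite in_itv /= => /cf.
Qed.

Lemma cont01_integrable f : cont01 f -> mu.-integrable `[0, 1]%classic (EFin \o f).
Proof.
move=> cf; apply: continuous_compact_integrable; first exact: segment_compact.
exact: cont01_within.
Qed.

Lemma mean01D f g : cont01 f -> cont01 g ->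
  mean01 (fun s => f s + g s) = mean01 f + mean01 g.
Proof. by move=> cf cg; apply: RintegralD => //; exact: cont01_integrable. Qed.

Lemma mean01B f g : cont01 f -> cont01 g ->
  mean01 (fun s => f s - g s) = mean01 f - mean01 g.
Proof. by move=> cf cg; apply: RintegralB => //; exact: cont01_integrable. Qed.

Lemma mean01Z a f : cont01 f -> mean01 (fun s => a * f s) = a * mean01 f.
Proof. by move=> cf; apply: RintegralZl => //; exact: cont01_integrable. Qed.

Lemma mean01_le f (e : R) : cont01 f -> (forall s, 0 <= s <= 1 -> `|f s| <= e) ->
  `|mean01 f| <= e.
Proof.
move=> cf fe; have intf := cont01_integrable cf.
apply: le_trans (le_normr_Rintegral m01 intf) _.
have cst_int : mu.-integrable `[0, 1]%classic (EFin \o (fun=> e)).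
  by apply: cont01_integrable => s _; exact: cvg_cst.
apply: (@le_trans _ _ (\int[mu]_(s in `[0, 1]) e)).
  apply: le_Rintegral => //.
  apply: (@cont01_integrable (fun s => `|f s|)) => s s01.
  exact: continuous_comp (cf s s01) (@norm_continuous _ _ _).
by rewrite Rintegral_cst //= lebesgue_measure_itv /= lte_fin ltr01 -EFinB subr0 /= mulr1.
Qed.

Lemma mean01_derive (f f' : R -> R) :
  (forall s : R, 0 <= s <= 1 -> is_derive s 1 f (f' s)) -> cont01 f' ->
  mean01 f' = f 1 - f 0.
Proof.
move=> df cf'; rewrite /mean01 /Rintegral.
have cf s : 0 <= s <= 1 -> {for s, continuous f}.
  move=> s01; apply: differentiable_continuous; apply/derivable1_diffP.
  by have [] := df s s01.
rewrite (@continuous_FTC2 R f' f 0 1) //.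
- exact: cont01_within.
- split.
  + move=> s; rewrite in_itv /= => /andP[/ltW s0 /ltW s1].
    by have [] // := df s; rewrite s0.
  + by apply: cvg_at_right_filter; apply: cf; rewrite lexx ler01.
  + by apply: cvg_at_left_filter; apply: cf; rewrite lexx ler01.
- move=> s; rewrite in_itv /= => /andP[/ltW s0 /ltW s1].
  by rewrite derive1E; have [] // := df s; rewrite s0.
Qed.

End Mean.

Section Lipschitz2.
Context {R : realType}.
Notation C := (R * R)%type.

(** The partial derivatives are bounded on the compact ball. *)
Lemma smooth_lipschitz2 (A : set C) (F : C -> R) (r : R) :
  smooth_on A F -> (forall z, `|z| <= r -> A z) ->
  exists2 L, 0 < L & forall z w : C, `|z| <= r -> `|w| <= r -> `|F z - F w| <= L * `|z - w|.
Proof.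
move=> sF rA.
have bnd v : exists2 M, 0 < M & forall z : C, `|z| <= r -> `|'D_v F z| <= M.
  have cK := @compact_cball2 R (0 : C) r.
  have [z Kz|M M0 HM] := @compact_ubound _ _ _ ('D_v F) cK.
    by apply: smooth_continuous (smooth_derive v sF) _; apply: rA; move: Kz; rewrite /= subr0.
  by exists M => // z zr; apply: HM; rewrite /= subr0.
have [M1 M10 H1] := bnd (1, 0); have [M2 M20 H2] := bnd (0, 1).
exists (M1 + M2) => [|z w zr wr]; first exact: addr_gt0.
have seg s : 0 <= s <= 1 -> `|w + s *: (z - w)| <= r.
  move=> /andP[s0 s1].
  have -> : w + s *: (z - w) = s *: z + (1 - s) *: w.
    by rewrite scalerBr scalerBl scale1r addrCA.
  rewrite (le_trans (ler_normD _ _)) // !normrZ ger0_norm // ger0_norm ?subr_ge0 //.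
  have -> : r = s * r + (1 - s) * r by ring.
  by apply: lerD; apply: ler_wpM2l => //; rewrite subr_ge0.
have dF s : 0 <= s <= 1 -> differentiable F (w + s *: (z - w)).
  by move=> /seg /rA; exact: Ck_differentiable.
have [s s01 ->] := mean_value dF.
rewrite derive_pairv; last exact: dF.
rewrite (le_trans (ler_normD _ _)) // !normrZ mulrDl [M1 * _]mulrC [M2 * _]mulrC.
have n1 := norm_fst_le (z - w); have n2 := norm_snd_le (z - w).
by apply: lerD; apply: ler_pM => //; [exact/H1/seg|exact/H2/seg].
Qed.

End Lipschitz2.

Section Hadamard.
Context {R : realType}.
Notation C := (R * R)%type.
Variable r : R.
Let A : set C := [set z | `|z| < r].

Let oA : open A.
Proof.
rewrite (_ : A = [set z | `|z - 0| < r]); first exact: open_oball.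
by apply/seteqP; split => z; rewrite /A /= subr0.
Qed.

(** The family indexed by [n] is stable under differentiation: the derivative in
    the first variable brings out one more factor [s]. *)
Definition xmean n (F : C -> R) (z : C) : R :=
  mean01 (fun s => s ^+ n * F (s * z.1, z.2)).

Lemma norm_contract (s : R) (z : C) : 0 <= s <= 1 -> `|(s * z.1, z.2) : C| <= `|z|.
Proof.
move=> /andP[s0 s1]; rewrite norm_pair_le /= norm_snd_le andbT normrM ger0_norm //.
by rewrite -[leRHS]mul1r; apply: ler_pM => //; exact: norm_fst_le.
Qed.

Let Acontr s z : 0 <= s <= 1 -> A z -> A (s * z.1, z.2).
Proof. by move=> s01 Az; apply: le_lt_trans (norm_contract z s01) Az. Qed.

Lemma cont01_xmean n F z : smooth_on A F -> A z ->
  cont01 (fun s => s ^+ n * F (s * z.1, z.2)).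
Proof.
move=> sF Az s s01; apply: cvgM; first exact: exprn_continuous.
apply: (@continuous_comp _ _ _ (fun s : R => ((s * z.1, z.2) : C)) F).
  have h1 : {for s, continuous (fun s : R => s * z.1)}.
    by apply: cvgM; [exact: cvg_id|exact: cvg_cst].
  have h2 : {for s, continuous (fun _ : R => z.2)} by exact: cvg_cst.
  exact: (cvg_pair h1 h2).
by apply: smooth_continuous sF _; exact: Acontr.
Qed.

(** Differentiation under the integral sign.  The mean value theorem bounds the
    error of the linear approximation of the integrand, uniformly in [s], by the
    Lipschitz constants of the partial derivatives of [F] times [`|h| ^+ 2]. *)
Lemma xmean_diff n F z : smooth_on A F -> A z ->
  is_diff z (xmean n F) (lin21 (xmean n.+1 ('D_(1, 0) F) z) (xmean n ('D_(0, 1) F) z)).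
Proof.
move=> sF Az; apply: is_diff_eps; first exact: lin21_continuous.
move=> e e0.
pose r' := (`|z| + r) / 2.
have zr : `|z| < r by [].
have zr' : `|z| < r' by rewrite /r'; lra.
have rA (w : C) : `|w| <= r' -> A w.
  by move=> h; apply: le_lt_trans h _; rewrite /r'; lra.
have s1 := smooth_derive ((1, 0) : C) sF; have s2 := smooth_derive ((0, 1) : C) sF.
have [L1 L10 H1] := smooth_lipschitz2 s1 rA.
have [L2 L20 H2] := smooth_lipschitz2 s2 rA.
apply: (radius_near (r := Num.min (r' - `|z|) (e / (L1 + L2)))).
  by rewrite lt_min subr_gt0 zr' divr_gt0 // addr_gt0.
move=> h; rewrite subr0 lt_min => /andP[hr he].
have Ahz : A (h + z).
  by apply: rA; rewrite (le_trans (ler_normD _ _)) //; move: hr; lra.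
have c0 := @cont01_xmean n _ _ sF Ahz; have c1 := @cont01_xmean n _ _ sF Az.
have c2 := @cont01_xmean n.+1 _ _ s1 Az; have c3 := @cont01_xmean n _ _ s2 Az.
have cZ (a : R) (f : R -> R) : cont01 f -> cont01 (fun s => a * f s).
  by move=> cf s s01; apply: cvgM; [exact: cvg_cst|exact: cf].
have cD (f g : R -> R) : cont01 f -> cont01 g -> cont01 (fun s => f s + g s).
  by move=> cf cg s s01; apply: cvgD; [exact: cf|exact: cg].
have cB (f g : R -> R) : cont01 f -> cont01 g -> cont01 (fun s => f s - g s).
  by move=> cf cg s s01; apply: cvgB; [exact: cf|exact: cg].
rewrite /= /lin21 /xmean.
rewrite -(mean01Z h.1 c2) -(mean01Z h.2 c3).
have cL := cD _ _ (cZ h.1 _ c2) (cZ h.2 _ c3).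
rewrite -mean01D; [|exact: cZ|exact: cZ].
rewrite -mean01B // -mean01B //; last exact: cB.
apply: mean01_le => [|s s01]; first by exact: (cB _ _ (cB _ _ c0 c1) cL).
pose w : C := (s * z.1, z.2); pose k : C := (s * h.1, h.2).
have kh : `|k| <= `|h| by exact: norm_contract.
have wz : `|w| <= `|z| by exact: norm_contract.
have E : (s * (h + z).1, (h + z).2) = k + w by rewrite /= mulrDr.
have seg t : 0 <= t <= 1 -> `|w + t *: (k + w - w)| <= r'.
  move=> /andP[t0 t1]; rewrite addrK (le_trans (ler_normD _ _)) // normrZ ger0_norm //.
  have : t * `|k| <= 1 * `|k| by rewrite ler_wpM2r.
  by move: hr kh wz; lra.
have dF t : 0 <= t <= 1 -> differentiable F (w + t *: (k + w - w)).
  by move=> /seg /rA; exact: Ck_differentiable.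
have [t t01 Ht] := mean_value dF.
rewrite E -/w exprS.
have -> : s ^+ n * F (k + w) - s ^+ n * F w -
   (h.1 * (s * s ^+ n * 'D_(1, 0) F w) + h.2 * (s ^+ n * 'D_(0, 1) F w)) =
   s ^+ n * (F (k + w) - F w - (k.1 * 'D_(1, 0) F w + k.2 * 'D_(0, 1) F w)).
  by rewrite /k /=; ring.
rewrite Ht derive_pairv; last exact: dF.
set x := w + _; rewrite addrK.
rewrite /GRing.scale /=.
have -> : s * h.1 * 'D_(1, 0) F x + h.2 * 'D_(0, 1) F x -
   (s * h.1 * 'D_(1, 0) F w + h.2 * 'D_(0, 1) F w) =
   s * h.1 * ('D_(1, 0) F x - 'D_(1, 0) F w) + h.2 * ('D_(0, 1) F x - 'D_(0, 1) F w).
  by ring.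
have xw : `|x - w| <= `|h|.
  rewrite /x [w + _]addrC addrK normrZ addrK.
  case/andP: t01 => t0 t1; rewrite ger0_norm //.
  have : t * `|k| <= 1 * `|k| by rewrite ler_wpM2r.
  by move: kh; lra.
have wr' : `|w| <= r' by exact: le_trans wz (ltW zr').
have B1 := H1 x w (seg t t01) wr'; have B2 := H2 x w (seg t t01) wr'.
rewrite normrM -[leRHS]mul1r; apply: ler_pM => //.
  case/andP: s01 => s0 s1'; rewrite normrX ger0_norm //.
  exact: exprn_ile1.
rewrite (le_trans (ler_normD _ _)) // !normrM.
have B1' : `|s * h.1| * `|'D_(1, 0) F x - 'D_(1, 0) F w| <= `|h| * (L1 * `|h|).
  apply: ler_pM => //; first exact: le_trans (norm_fst_le k) kh.
  by apply: le_trans B1 _; apply: ler_wpM2l => //; exact: ltW.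
have B2' : `|h.2| * `|'D_(0, 1) F x - 'D_(0, 1) F w| <= `|h| * (L2 * `|h|).
  apply: ler_pM => //; first exact: norm_snd_le.
  by apply: le_trans B2 _; apply: ler_wpM2l => //; exact: ltW.
rewrite normrM in B1'.
apply: (le_trans (lerD B1' B2')).
rewrite -mulrDr -mulrDl mulrC; apply: ler_wpM2r => //.
by rewrite mulrC -ler_pdivlMr ?addr_gt0 // ltW.
Qed.

Lemma xmean_smooth n F : smooth_on A F -> smooth_on A (xmean n F).
Proof.
move=> sF k; elim: k n F sF => [|k IH] n F sF.
  by move=> z Az; apply: differentiable_continuous; case: (xmean_diff n sF Az).
split=> [z Az|v]; first by case: (xmean_diff n sF Az).
have H := CkD oA (CkM oA (Ck_cst A k v.1) (IH n.+1 _ (smooth_derive ((1, 0) : C) sF)))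
                 (CkM oA (Ck_cst A k v.2) (IH n _ (smooth_derive ((0, 1) : C) sF))).
apply: Ck_ext oA _ H => z Az.
by rewrite (is_diff_deriveE v (xmean_diff n sF Az)).
Qed.

(** Hadamard's lemma: integrate the derivative of [F] along the horizontal segment
    from [(0, y)] to [(x, y)]; the average of the derivative is the smooth
    quotient. *)
Lemma hadamard (F : C -> R) : smooth_on A F ->
  exists2 Q : C -> R, smooth_on A Q &
    forall z : C, A z -> F z = F (0, z.2) + z.1 * Q z.
Proof.
move=> sF; have s1 := smooth_derive ((1, 0) : C) sF.
exists (xmean 0 ('D_(1, 0) F)); first exact: xmean_smooth.
move=> z Az.
have c := @cont01_xmean 0 _ _ s1 Az.
have cz : cont01 (fun s => z.1 * (s ^+ 0 * 'D_(1, 0) F (s * z.1, z.2))).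
  by move=> s s01; apply: cvgM; [exact: cvg_cst|exact: c].
suff D (s : R) : 0 <= s <= 1 -> is_derive s (1 : R) (fun s => F (s * z.1, z.2))
    (z.1 * (s ^+ 0 * 'D_(1, 0) F (s * z.1, z.2))).
  rewrite /xmean -mean01Z // (mean01_derive D cz).
  by rewrite mul1r mul0r addrC subrK -surjective_pairing.
move=> s01; rewrite expr0 mul1r.
have E u : (u * z.1, z.2) = ((0, z.2) : C) + u *: ((z.1, 0) : C).
  by apply: pair_ext; rewrite /= ?add0r // scaler0 addr0.
have -> : (fun u => F (u * z.1, z.2)) = (fun u => F (((0, z.2) : C) + u *: ((z.1, 0) : C))).
  by apply/funext => u; rewrite E.
have dF : differentiable F (((0, z.2) : C) + s *: ((z.1, 0) : C)).
  by rewrite -E; apply: Ck_differentiable sF _; exact: Acontr.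
have := derive_line dF.
rewrite [in 'D_(z.1, 0) F _]derive_pairv //= scale0r addr0 -E.
by [].
Qed.

Lemma derive_fst_mul (Q : C -> R) z : differentiable Q z ->
  'D_(1, 0) (fun w : C => w.1 * Q w) z = Q z + z.1 * 'D_(1, 0) Q z.
Proof.
move=> dQ; have df := differentiable_fst z.
rewrite (_ : (fun w : C => w.1 * Q w) = (fst : C -> R) * Q) //.
rewrite deriveM; try exact: diff_derivable.
rewrite [in 'D_(1, 0) fst z]deriveE // diff_lin /=; last exact: continuous_fst_lin.
by rewrite addrC /GRing.scale /= mulr1.
Qed.

Lemma derive_const_fst (F : C -> R) (z : C) : differentiable F (0, z.2) ->
  differentiable (fun w : C => F (0, w.2)) z /\
  'D_(1, 0) (fun w : C => F (0, w.2)) z = 0.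
Proof.
move=> dF.
have -> : (fun w : C => F (0, w.2)) = F \o lin22 0 0 0 1.
  by apply/funext => w; rewrite /lin22 /= !mul0r add0r mul1r add0r.
have dl : differentiable (lin22 0 0 0 1) z.
  exact/linear_differentiable/lin22_continuous.
have dF' : differentiable F (lin22 0 0 0 1 z).
  by rewrite /= /lin22 !mul0r add0r mul1r add0r.
split; first exact: differentiable_comp.
rewrite derive_chain // [X in 'D_X F _](_ : _ = 0) ?derive0 //.
rewrite deriveE // diff_lin /=; last exact: lin22_continuous.
by rewrite /lin22 /= !mul0r mulr0 !addr0.
Qed.

(** If the first horizontal derivative vanishes on the vertical axis, the Hadamard
    quotient vanishes there too and can be divided once more. *)
Lemma hadamard2 (F : C -> R) : 0 < r -> smooth_on A F ->
  (forall y, `|y| < r -> 'D_(1, 0) F (0, y) = 0) ->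
  exists Q : C -> R, [/\ smooth_on A Q,
    forall z : C, A z -> F z = F (0, z.2) + z.1 ^+ 2 * Q z &
    'D_(1, 0) ('D_(1, 0) F) 0 = 2 * Q 0].
Proof.
move=> r0 sF F0; have [Q1 sQ1 E1] := hadamard sF; have [Q2 sQ2 E2] := hadamard sQ1.
have near_A z : A z -> \forall w \near z, A w.
  by move=> Az; exact: open_nbhs_nbhs.
have A02 z : A z -> A (0, z.2).
  by move=> Az; rewrite /A /= norm_pair_lt /= normr0 r0 (le_lt_trans (norm_snd_le z)).
have A0 : A 0 by rewrite /A /= normr0.
have D1 z : A z -> 'D_(1, 0) F z = Q1 z + z.1 * 'D_(1, 0) Q1 z.
  move=> Az.
  have [dE DE] := derive_const_fst (Ck_differentiable sF (A02 _ Az)).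
  have dQ := Ck_differentiable sQ1 Az.
  have nE : \forall w \near z, F w = ((fun w : C => F (0, w.2)) + (fun w : C => w.1 * Q1 w)) w.
    by apply: filterS (near_A z Az) => w /E1.
  rewrite (near_eq_derive _ nE) deriveD; try exact: diff_derivable.
    by rewrite DE add0r derive_fst_mul.
  apply: diff_derivable; apply: (differentiableM (f := fst)) => //.
  exact: differentiable_fst.
have Q10 z : A z -> Q1 (0, z.2) = 0.
  move=> Az; have := D1 _ (A02 _ Az); rewrite F0 ?mul0r ?addr0 //=.
  exact: le_lt_trans (norm_snd_le z) Az.
have E2' z : A z -> Q1 z = z.1 * Q2 z.
  by move=> Az; rewrite E2 // Q10 // add0r.
exists Q2; split=> // [z Az|].
  by rewrite E1 // E2' // expr2 mulrA.
have sD := smooth_derive ((1, 0) : C) sQ1.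
have nD : \forall w \near (0 : C),
    'D_(1, 0) F w = (Q1 + (fun w : C => w.1 * 'D_(1, 0) Q1 w)) w.
  by apply: filterS (near_A 0 A0) => w /D1.
have dQ1 := Ck_differentiable sQ1 A0; have dD := Ck_differentiable sD A0.
have nQ : \forall w \near (0 : C), Q1 w = w.1 * Q2 w.
  by apply: filterS (near_A 0 A0) => w /E2'.
have DQ : 'D_(1, 0) Q1 0 = Q2 0.
  rewrite (near_eq_derive _ nQ) derive_fst_mul; last exact: Ck_differentiable sQ2 A0.
  by rewrite mul0r addr0.
rewrite (near_eq_derive _ nD) deriveD; try exact: diff_derivable.
  by rewrite derive_fst_mul // mul0r addr0 DQ; ring.
apply: diff_derivable; apply: (differentiableM (f := fst)) => //.
exact: differentiable_fst.
Qed.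

End Hadamard.

(** * Radial maps *)

Section RadialMaps.
Context {R : realType}.
Notation C := (R * R)%type.

Lemma polar_form (z : C) : z != 0 -> exists theta r : R,
  0 < r /\ z = (r * cos theta, r * sin theta).
Proof.
case: z => x y z0; pose r := Num.sqrt (x ^+ 2 + y ^+ 2).
have s0 : 0 < x ^+ 2 + y ^+ 2.
  rewrite lt_neqAle addr_ge0 ?sqr_ge0 // andbT eq_sym.
  by rewrite paddr_eq0 ?sqr_ge0 // !sqrf_eq0; move: z0; rewrite -pair_eqE.
have r0 : 0 < r by rewrite sqrtr_gt0.
have rn : r != 0 by rewrite gt_eqF.
have r2 : r ^+ 2 = x ^+ 2 + y ^+ 2 by rewrite sqr_sqrtr // ltW.
have c1 : -1 <= x / r <= 1.
  rewrite ler_pdivlMr // ler_pdivrMr // mulN1r mul1r -ler_norml.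
  by rewrite -sqrtr_sqr ler_wsqrtr // lerDl sqr_ge0.
have sq : 1 - (x / r) ^+ 2 = (y / r) ^+ 2.
  by rewrite -(mulfV (expf_neq0 2 rn)) {1}r2; field.
have S : sin (acos (x / r)) = `|y / r|.
  by rewrite sin_acos // sq sqrtr_sqr.
have [y0|y0] := leP 0 y.
  exists (acos (x / r)), r; split=> //; rewrite S acosK // ger0_norm; last first.
    by rewrite divr_ge0 // ltW.
  by congr (_, _); rewrite mulrC divfK.
exists (- acos (x / r)), r; split=> //; rewrite cosN sinN S acosK // ltr0_norm; last first.
  by rewrite pmulr_llt0 // invr_gt0.
by rewrite opprK; congr (_, _); rewrite mulrC divfK.
Qed.

Lemma diffeo_restrict (A B A' : set C) (f : C -> C) : diffeo A B f ->
  open A' -> A' `<=` A -> diffeo A' (f @` A') f.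
Proof.
move=> dAB oA' A'A; have [g dg [h1 h2]] := diffeo_inv dAB.
have [oB oA sg _ _] := dg; have [_ _ sf _ _] := dAB.
have E : f @` A' = B `&` g @^-1` A'.
  apply/seteqP; split => [_ [x Ax <-]|y [By Agy]].
    have [Bf gf] := h1 _ (A'A _ Ax); split => //.
    by rewrite /preimage /= gf.
  by exists (g y) => //; case: (h2 y By).
split=> //.
- by rewrite E; apply: open_preimage_on => // x Bx; exact: (sg 0%N).
- by move=> k; apply: Ck_sub (sf k).
- exists g => [k|x /A'A /h1 [] //].
  by apply: Ck_sub (sg k) => y; rewrite E => -[].
Qed.

(** The algebraic form of a radial map: a positive function times a linear
    isomorphism.  Unlike the condition on rays it composes well with linear maps. *)
Definition radially_factored (tau : C -> C) : Prop :=
  exists a b c d (rho : C -> R), a * d - b * c != 0 /\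
    \forall z \near (0 : C), 0 < rho z /\ tau z = rho z *: lin22 a b c d z.

Lemma lin22Z (a b c d s : R) (v : C) : lin22 a b c d (s *: v) = s *: lin22 a b c d v.
Proof. exact: linearZ. Qed.

Lemma lin22_inj (a b c d : R) : a * d - b * c != 0 -> injective (lin22 a b c d).
Proof.
move=> D0 u v; set D := a * d - b * c in D0.
have inv w : lin22 (d / D) (- b / D) (- c / D) (a / D) (lin22 a b c d w) = w.
  by apply: pair_ext; rewrite /= /D; field.
by move=> E; rewrite -(inv u) E inv.
Qed.

(** A positive factor moves points along their ray and a linear isomorphism permutes
    the rays, so any neighbourhood where the factorization holds, together with its
    image, witnesses the condition on rays. *)
Lemma radially_factored_transformation (tau : C -> C) :
  local_diffeo tau 0 0 -> radially_factored tau -> radial_transformation tau.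
Proof.
move=> [t0 [A [B [A0 dAB]]]] [a [b [c [d [rho [D0 nt]]]]]].
split; first exact: t0.
have [oA oB _ _ _] := dAB.
have [e e0 He] := near_radius (filterI (open_nbhs_nbhs (conj oA A0)) nt).
pose A' := [set z : C | `|z - 0| < e].
have A'A : A' `<=` A by move=> z /ltW /He [].
have tE z : A' z -> 0 < rho z /\ tau z = rho z *: lin22 a b c d z.
  by move=> /ltW /He [].
have oA' : open A' by exact: open_oball.
exists A', (tau @` A'); split.
- by rewrite /A' /= subrr normr0.
- exact: diffeo_restrict dAB oA' A'A.
move=> theta; pose u : C := (cos theta, sin theta).
have u0 : u != 0.
  apply/eqP => /pair_equal_spec [c0 s0].
  by have := cos2Dsin2 theta; rewrite c0 s0 expr0n addr0 => /esym/eqP; rewrite oner_eq0.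
have Mu0 : lin22 a b c d u != 0.
  apply: contra u0 => /eqP E; apply/eqP/(lin22_inj D0).
  by rewrite E linear0.
have [theta' [r [r0 Mu]]] := polar_form Mu0.
exists theta'; apply/seteqP; split => [_ [z [Az [s s0 zE]] <-]|_ [[z Az <-] [s s0 tz]]].
  split; first by exists z.
  have [rz ->] := tE z Az.
  have {}zE : z = s *: u by rewrite zE.
  exists (rho z * s * r).
    by rewrite !mulr_ge0 // ltW.
  rewrite {2}zE lin22Z Mu.
  by apply: pair_ext; rewrite /= /GRing.scale /=; ring.
exists z => //; split=> //.
have [rz E] := tE z Az.
have rn : rho z != 0 by rewrite gt_eqF.
have rn' : r != 0 by rewrite gt_eqF.
have {}E : z = (s / r / rho z) *: u.
  apply: (lin22_inj D0); rewrite lin22Z Mu.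
  apply: (@scalerI _ _ (rho z)) => //; rewrite -E tz.
  by apply: pair_ext; rewrite /= /GRing.scale /=; field; rewrite rn rn'.
exists (s / r / rho z); last exact: E.
by rewrite !mulr_ge0 // invr_ge0 ltW.
Qed.

(** Radial equivalence in which the target map is radial in the algebraic sense. *)
Definition factored_equiv (f : C -> C) (q0 : C) (psi : C -> C) : Prop :=
  exists sigma tau : C -> C,
    [/\ local_diffeo sigma 0 q0, local_diffeo tau 0 0, radially_factored tau &
        \forall z \near (0 : C), f (sigma z) = tau (psi z)].

Lemma factored_equiv_radially f q0 psi : factored_equiv f q0 psi ->
  radially_equivalent f q0 psi.
Proof.
move=> [sigma [tau [ls lt ct H]]]; exists sigma, tau; split=> //.
exact: radially_factored_transformation.
Qed.

Lemma factored_equiv_source f (s : C -> C) p q psi : local_diffeo s p q ->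
  factored_equiv (f \o s) p psi -> factored_equiv f q psi.
Proof.
move=> ls [sigma [tau [lsig lt ct H]]]; exists (s \o sigma), tau; split=> //.
exact: local_diffeo_comp lsig ls.
Qed.

Lemma local_diffeo_continuous (f : C -> C) p q : local_diffeo f p q ->
  {for p, continuous f}.
Proof. by move=> [_ [A [B [Ap [oA _ sf _ _]]]]]; exact: (sf 0%N). Qed.

Lemma factored_equiv_target f q0 psi (a b c d : R) : a * d - b * c != 0 ->
  factored_equiv (lin22 a b c d \o f) q0 psi -> factored_equiv f q0 psi.
Proof.
move=> D0 [sigma [tau [ls lt [a' [b' [c' [d' [rho [D0' nt]]]]]] H]]].
set D := a * d - b * c in D0.
have inv v : lin22 (d / D) (- b / D) (- c / D) (a / D) (lin22 a b c d v) = v.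
  by apply: pair_ext; rewrite /= /D; field.
have DV : (d / D) * (a / D) - (- b / D) * (- c / D) = D^-1.
  by rewrite /D; field.
have D0V : (d / D) * (a / D) - (- b / D) * (- c / D) != 0 by rewrite DV invr_eq0.
set N := lin22 (d / D) (- b / D) (- c / D) (a / D) in inv *.
have N0 : N 0 = 0 by rewrite /N linear0.
exists sigma, (N \o tau); split=> //.
- have := local_diffeo_comp lt (local_diffeo_lin 0 D0V).
  by rewrite -/N N0.
- exists ((d / D) * a' + (- b / D) * c'), ((d / D) * b' + (- b / D) * d'),
    ((- c / D) * a' + (a / D) * c'), ((- c / D) * b' + (a / D) * d'), rho; split.
    set X := (X in X != 0).
    have -> : X = (a' * d' - b' * c') * D^-1 by rewrite -DV /X; ring.
    by rewrite mulf_neq0 // invr_eq0.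
  apply: filterS nt => z [rz tz]; split=> //.
  rewrite /= tz /N lin22Z; congr (_ *: _).
  by apply: pair_ext; rewrite /=; ring.
- apply: filterS H => z /= <-; by rewrite inv.
Qed.

End RadialMaps.

Section Sqrt.
Context {R : realType}.

Lemma open_gt0 : open [set x : R | 0 < x].
Proof. exact: open_gt. Qed.

Lemma Ck_sqrt k : Ck_on [set x : R | 0 < x] k (fun x : R => Num.sqrt x).
Proof.
elim: k => [|k IH]; first by move=> x _; exact: sqrt_continuous.
have dS (x : R) : 0 < x -> differentiable (fun x : R => Num.sqrt x) x.
  move=> x0; apply/derivable1_diffP.
  by have [] := is_derive1_sqrt x0.
split=> // v.
have c2 := CkM open_gt0 (Ck_cst _ k (2 : R)) IH.
have := CkV open_gt0 _ c2 => /(_ _) H.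
have {}H : Ck_on [set x : R | 0 < x] k (fun x : R => (2 * Num.sqrt x)^-1).
  by apply: H => x x0; rewrite mulf_neq0 // gt_eqF // sqrtr_gt0.
have H1 := CkM open_gt0 (Ck_cst _ k (v : R)) H.
apply: Ck_ext open_gt0 _ H1 => x x0.
have E : v = v *: (1 : R) by exact: esym (mulr1 _).
rewrite [in RHS]E (deriveZv _ _ (dS x x0)).
by have [_ ->] := is_derive1_sqrt x0.
Qed.

End Sqrt.

(** * The fold germ *)

Section Rules.
Context {R : realType} {V : normedModType R}.

Lemma derive_mul (f g : V -> R) z v : differentiable f z -> differentiable g z ->
  'D_v (fun w => f w * g w) z = 'D_v f z * g z + f z * 'D_v g z.
Proof.
move=> df dg; rewrite (_ : (fun w => f w * g w) = f * g) //.
rewrite deriveM; try exact: diff_derivable.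
by rewrite addrC /GRing.scale /= [g z * _]mulrC.
Qed.

Lemma derive_sub (f g : V -> R) z v : differentiable f z -> differentiable g z ->
  'D_v (fun w => f w - g w) z = 'D_v f z - 'D_v g z.
Proof.
by move=> df dg; apply: deriveB; exact: diff_derivable.
Qed.

Lemma derive_add (f g : V -> R) z v : differentiable f z -> differentiable g z ->
  'D_v (fun w => f w + g w) z = 'D_v f z + 'D_v g z.
Proof.
by move=> df dg; apply: deriveD; exact: diff_derivable.
Qed.

End Rules.

Section NormalForm.
Context {R : realType}.
Notation C := (R * R)%type.
Notation e1 := ((1, 0) : C).
Notation e2 := ((0, 1) : C).

Lemma derive_fst_vec (z v : C) : 'D_v (fst : C -> R) z = v.1.
Proof.
rewrite deriveE; last exact: differentiable_fst.
by rewrite diff_lin //; exact: continuous_fst_lin.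
Qed.

Lemma derive_snd_vec (z v : C) : 'D_v (snd : C -> R) z = v.2.
Proof.
rewrite deriveE; last exact: differentiable_snd.
by rewrite diff_lin //; exact: continuous_snd_lin.
Qed.

Variables h k : C -> R.
Hypotheses (sh : smooth_on setT h) (sk : smooth_on setT k).
Hypotheses (h_0 : h 0 = 0) (k_0 : k 0 = 0).
Variables h1 h2 k1 k2 : C -> R.
Hypotheses (h1E : h1 = 'D_e1 h) (h2E : h2 = 'D_e2 h).
Hypotheses (k1E : k1 = 'D_e1 k) (k2E : k2 = 'D_e2 k).
Hypotheses (h1_0 : h1 0 = 0) (h2_0 : h2 0 = 0) (k1_0 : k1 0 = 0) (k2_0 : k2 0 != 0).
Hypothesis h11_0 : 'D_e1 h1 0 != 0.
Hypothesis hess_0 : 'D_e1 h1 0 * 'D_e2 h2 0 - 'D_e1 h2 0 * 'D_e2 h1 0 != 0.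

Let sh1 : smooth_on setT h1. Proof. by rewrite h1E; exact: smooth_derive. Qed.
Let sh2 : smooth_on setT h2. Proof. by rewrite h2E; exact: smooth_derive. Qed.
Let sk1 : smooth_on setT k1. Proof. by rewrite k1E; exact: smooth_derive. Qed.
Let sk2 : smooth_on setT k2. Proof. by rewrite k2E; exact: smooth_derive. Qed.

Let dT (W : normedModType R) (f : C -> W) z : smooth_on setT f -> differentiable f z.
Proof. by move=> sf; exact: Ck_differentiable sf I. Qed.

Variables J J1 J2 : C -> R.
Hypothesis JE : J = fun z => h1 z * k2 z - h2 z * k1 z.
Hypotheses (J1E : J1 = 'D_e1 J) (J2E : J2 = 'D_e2 J).

Let sJ : smooth_on setT J.
Proof.
move=> n; rewrite JE.
exact: (CkB openT (CkM openT (sh1 n) (sk2 n)) (CkM openT (sh2 n) (sk1 n))).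
Qed.

Let sJ1 : smooth_on setT J1. Proof. by rewrite J1E; exact: smooth_derive. Qed.
Let sJ2 : smooth_on setT J2. Proof. by rewrite J2E; exact: smooth_derive. Qed.

Let Phi z := (J z, k z).

Let sPhi : smooth_on setT Phi.
Proof. by move=> n; exact: (Ck_pair openT (sJ n) (sk n)). Qed.

Let DJ0 v : 'D_v J 0 = 'D_v h1 0 * k2 0.
Proof.
have m (f g : C -> R) : smooth_on setT f -> smooth_on setT g ->
  differentiable (fun w => f w * g w) 0.
  by move=> sf sg; apply: differentiableM; exact: dT.
rewrite JE derive_sub; [|by apply: m..].
rewrite !derive_mul; try exact: dT.
by rewrite h1_0 h2_0 k1_0 !mul0r mulr0 !addr0 subr0.
Qed.

Let J1_0 : J1 0 = 'D_e1 h1 0 * k2 0. Proof. by rewrite J1E DJ0. Qed.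
Let J2_0 : J2 0 = 'D_e2 h1 0 * k2 0. Proof. by rewrite J2E DJ0. Qed.

Variable Dt : C -> R.
Hypothesis DtE : Dt = fun z => J1 z * k2 z - J2 z * k1 z.

Let sDt : smooth_on setT Dt.
Proof.
move=> n; rewrite DtE.
exact: (CkB openT (CkM openT (sJ1 n) (sk2 n)) (CkM openT (sJ2 n) (sk1 n))).
Qed.

Let jacPhi z : jacobian_det Phi z = Dt z.
Proof.
rewrite /jacobian_det /Phi !derive_pair; try exact: dT.
by rewrite DtE J1E J2E k1E k2E.
Qed.

Let Dt0 : Dt 0 != 0.
Proof. by rewrite DtE J1_0 k1_0 mulr0 subr0 !mulf_neq0. Qed.

Let Phi0 : Phi 0 = 0.
Proof. by rewrite /Phi k_0 JE h1_0 h2_0 !mul0r subrr. Qed.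

(** At [0] the differential of the Jacobian determinant [J] of [(h, k)] is not
    proportional to that of [k], so [(J, k)] is a local coordinate system: the
    critical curve of the map becomes the axis [J = 0], while [k] remains the
    second component of the map. *)
Lemma fold_coordinates : exists (phi : C -> C) (r : R),
  [/\ 0 < r, local_diffeo phi 0 0, smooth_on [set z | `|z| < r] phi &
      forall z : C, `|z| < r -> [/\ J (phi z) = z.1, k (phi z) = z.2 & Dt (phi z) != 0]].
Proof.
have lPhi : local_diffeo Phi 0 0.
  rewrite -{2}Phi0; apply: inverse_function openT I sPhi _.
  by rewrite jacPhi.
have [phi lphi [H1 _]] := local_diffeo_inv lPhi.
have [phi0 [A [B [A0 [oA oB sphi _ _]]]]] := lphi.
have cphi := local_diffeo_continuous lphi.
have nDt : \forall z \near (0 : C), Dt (phi z) != 0.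
  have c : {for 0 : C, continuous (Dt \o phi)}.
    apply: continuous_comp => //.
    by apply: smooth_continuous sDt _.
  have := c _ (open_nbhs_nbhs (conj (open_neq0 (R := R)) _)).
  by apply; rewrite /= phi0.
have [r r0 Hr] := near_radius (filterI (open_nbhs_nbhs (conj oA A0)) (filterI H1 nDt)).
exists phi, r; split=> //.
  by move=> n; apply: Ck_sub (sphi n) => z /= /ltW zr; case: (Hr z); rewrite ?subr0.
move=> z /ltW zr; have [|_ [E D]] := Hr z; first by rewrite subr0.
by have := congr1 fst E; have := congr1 snd E; rewrite /Phi /= => -> ->.
Qed.

Variables (phi : C -> C) (r : R).
Hypotheses (r0 : 0 < r) (phi0 : phi 0 = 0).
Let A : set C := [set z | `|z| < r].
Hypothesis sphi : smooth_on A phi.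
Hypothesis Jphi : forall z, A z -> J (phi z) = z.1.
Hypothesis kphi : forall z, A z -> k (phi z) = z.2.
Hypothesis Dtphi : forall z, A z -> Dt (phi z) != 0.

Let ball_open (e : R) : open [set z : C | `|z| < e].
Proof.
rewrite (_ : [set _ | _] = [set z : C | `|z - 0| < e]); first exact: open_oball.
by apply/seteqP; split => z; rewrite /= subr0.
Qed.

Let oA : open A. Proof. exact: ball_open. Qed.
Let A0 : A 0. Proof. by rewrite /A /= normr0. Qed.
Let near_A z : A z -> \forall w \near z, A w.
Proof. by move=> Az; exact: open_nbhs_nbhs. Qed.

Let chain (f : C -> R) z v : smooth_on setT f -> A z ->
  'D_v (f \o phi) z = ('D_v phi z).1 * 'D_e1 f (phi z) + ('D_v phi z).2 * 'D_e2 f (phi z).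
Proof.
move=> sf Az; have df := dT (phi z) sf.
by rewrite (derive_chain v (Ck_differentiable sphi Az) df) (derive_pairv _ df).
Qed.

Let DJphi z v : A z ->
  ('D_v phi z).1 * J1 (phi z) + ('D_v phi z).2 * J2 (phi z) = v.1.
Proof.
move=> Az; rewrite J1E J2E -chain // -(derive_fst_vec z); apply: near_eq_derive.
by apply: filterS (near_A Az) => w /Jphi.
Qed.

Let Dkphi z v : A z ->
  ('D_v phi z).1 * k1 (phi z) + ('D_v phi z).2 * k2 (phi z) = v.2.
Proof.
move=> Az; rewrite k1E k2E -chain // -(derive_snd_vec z); apply: near_eq_derive.
by apply: filterS (near_A Az) => w /kphi.
Qed.

Let ht z := h (phi z).

Let scomp (f : C -> R) : smooth_on setT f -> smooth_on A (f \o phi).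
Proof. by move=> sf n; apply: (Ck_comp2 (B := setT)) (sphi n) (sf n). Qed.

Let sht : smooth_on A ht. Proof. exact: scomp. Qed.

Let m z := (Dt (phi z))^-1.

Let sm : smooth_on A m.
Proof. by move=> n; apply: CkV oA Dtphi _; exact: scomp. Qed.

Let Dht z v : A z ->
  'D_v ht z = ('D_v phi z).1 * h1 (phi z) + ('D_v phi z).2 * h2 (phi z).
Proof. by move=> Az; rewrite h1E h2E -chain. Qed.

(** In the coordinates [(J, k)] the map is [(ht, z.2)], so its Jacobian
    determinant is the first derivative of [ht]; dividing [J = z.1] by the
    determinant [Dt] of the change of coordinates gives the formula. *)
Let D1ht z : A z -> 'D_e1 ht z = z.1 * m z.
Proof.
move=> Az; rewrite Dht // -(Jphi Az) JE /m.
have := DJphi e1 Az; have := Dkphi e1 Az; have := Dtphi Az; rewrite DtE /=.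
move: ('D_e1 phi z).1 ('D_e1 phi z).2 => p1 p2.
move: (J1 (phi z)) (J2 (phi z)) (k1 (phi z)) (k2 (phi z)) (h1 (phi z)) (h2 (phi z)).
move=> a b c d x y D0 E2 E1.
have P1 : p1 * (a * d - b * c) = d.
  have -> : p1 * (a * d - b * c) = (p1 * a + p2 * b) * d - b * (p1 * c + p2 * d) by ring.
  by rewrite E1 E2 mul1r mulr0 subr0.
have P2 : p2 * (a * d - b * c) = - c.
  have -> : p2 * (a * d - b * c) = a * (p1 * c + p2 * d) - (p1 * a + p2 * b) * c by ring.
  by rewrite E1 E2 mulr0 mul1r sub0r.
apply: (mulIf D0); rewrite mulfVK //.
have -> : (p1 * x + p2 * y) * (a * d - b * c) =
  x * (p1 * (a * d - b * c)) + y * (p2 * (a * d - b * c)) by ring.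
by rewrite P1 P2; ring.
Qed.

Let D11ht : 'D_e1 ('D_e1 ht) 0 = (Dt 0)^-1.
Proof.
have E : \forall w \near (0 : C), 'D_e1 ht w = w.1 * m w.
  by apply: filterS (near_A A0) => w /D1ht.
rewrite (near_eq_derive _ E) derive_fst_mul; last exact: Ck_differentiable sm A0.
by rewrite mul0r addr0 /m phi0.
Qed.

Let D2ht0 : 'D_e2 ht 0 = 0.
Proof. by rewrite Dht // phi0 h1_0 h2_0 !mulr0 addr0. Qed.

(** Along the critical curve the second derivative of [ht] is the Hessian of [h]
    on the tangent of the curve, a nonzero multiple of the Hessian determinant
    divided by the second derivative of [h] along the kernel. *)
Let D22ht : 'D_e2 ('D_e2 ht) 0 != 0.
Proof.
have sp := smooth_derive e2 sphi.
have sp1 : smooth_on A (fun w => ('D_e2 phi w).1) by move=> n; exact: (Ck_fst oA (sp n)).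
have sp2 : smooth_on A (fun w => ('D_e2 phi w).2) by move=> n; exact: (Ck_snd oA (sp n)).
have E : \forall w \near (0 : C), 'D_e2 ht w =
    ('D_e2 phi w).1 * (h1 \o phi) w + ('D_e2 phi w).2 * (h2 \o phi) w.
  by apply: filterS (near_A A0) => w /Dht ->.
have d (f : C -> R) : smooth_on A f -> differentiable f 0.
  by move=> sf; exact: Ck_differentiable sf A0.
rewrite (near_eq_derive _ E) derive_add; last first.
- by apply: differentiableM; apply: d => //; exact: scomp.
- by apply: differentiableM; apply: d => //; exact: scomp.
rewrite derive_mul; [|exact: d|by apply: d; exact: scomp].
rewrite derive_mul; [|exact: d|by apply: d; exact: scomp].
rewrite !chain // /= phi0 h1_0 h2_0 !mulr0 !add0r.
have := DJphi e2 A0; have := Dkphi e2 A0; rewrite phi0 J1_0 J2_0 k1_0 /=.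
move: h11_0 hess_0 k2_0.
move: ('D_e2 phi 0).1 ('D_e2 phi 0).2 => q1 q2.
move: ('D_e1 h1 0) ('D_e2 h1 0) ('D_e1 h2 0) ('D_e2 h2 0) (k2 0) => a b c d' kk.
move=> a0 D0 kk0; rewrite mulr0 add0r => E2 E1.
have {}E1 : q1 * a = - q2 * b.
  apply: (mulIf kk0); apply/eqP; rewrite -subr_eq0; apply/eqP.
  by rewrite -[RHS]E1; ring.
have q20 : q2 != 0.
  by apply/eqP => q0; move: E2; rewrite q0 mul0r => /esym/eqP; rewrite oner_eq0.
have -> : q1 * (q1 * a + q2 * b) + q2 * (q1 * c + q2 * d') =
    q2 * (q1 * c + q2 * d') by rewrite E1; ring.
apply/negP => /eqP Z.
have : q2 * (q1 * c + q2 * d') * a = 0 by rewrite Z mul0r.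
have -> : q2 * (q1 * c + q2 * d') * a = q2 * (q1 * a * c + q2 * d' * a) by ring.
rewrite E1.
have -> : q2 * (- q2 * b * c + q2 * d' * a) = q2 * q2 * (a * d' - c * b) by ring.
by apply/eqP; rewrite !mulf_neq0.
Qed.

Hypothesis lphi : local_diffeo phi 0 0.

(** Two applications of Hadamard's lemma give
    [ht z = z.2 ^+ 2 * cc (z.2, 0) + z.1 ^+ 2 * Q z] with [cc] and [Q] nonzero at
    [0].  With [a = `|cc|], multiplication of the target by the positive function
    [a], which depends on the second coordinate only, turns the critical values
    into a parabola: after the target map [T] and in the source coordinates [S]
    the map is [(S.1 ^+ 2 +- S.2 ^+ 2, S.2)].  The sign is that of [cc * Q], and
    the reflection by the sign of [Q] is absorbed in [T]. *)
Lemma fold_normal_form :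
  factored_equiv (fun z => (h z, k z)) 0 psi_hyperbolic \/
  factored_equiv (fun z => (h z, k z)) 0 psi_elliptic.
Proof.
have [|Q [sQ EQ DQ]] := hadamard2 r0 sht.
  by move=> y yr; rewrite D1ht ?mul0r // /A /= norm_pair_lt /= normr0 r0.
pose E (w : C) := ht (0, w.1).
have Aswap (w : C) : A w -> A (0, w.1).
  by move=> Aw; rewrite /A /= norm_pair_lt /= normr0 r0 (le_lt_trans (norm_fst_le w)).
have EE : E = ht \o lin22 0 0 1 0.
  by apply/funext => w; rewrite /E /lin22 /= !mul0r mul1r !addr0.
have swapE (w : C) : lin22 0 0 1 0 w = (0, w.1).
  by rewrite /lin22 !mul0r mul1r !addr0.
have sE : smooth_on A E.
  move=> n; rewrite EE; apply: (Ck_comp2 (B := A)) (Ck_lin22 n _ _ _ _ oA) (sht n) => //.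
  by move=> w Aw; rewrite swapE; exact: Aswap.
have DE (w : C) : A w -> 'D_e1 E w = 'D_e2 ht (0, w.1).
  move=> Aw; rewrite EE.
  have dl : differentiable (lin22 0 0 1 0) w by exact/linear_differentiable/lin22_continuous.
  have dh : differentiable ht (lin22 0 0 1 0 w).
    by rewrite swapE; apply: Ck_differentiable sht _; exact: Aswap.
  rewrite (derive_chain e1 dl dh) swapE; congr ('D_ _ ht _).
  rewrite deriveE // diff_lin /=; last exact: lin22_continuous.
  by rewrite /lin22 /= !mul0r !mulr1 !addr0.
have D2ht_smooth := smooth_derive e2 sht.
have [|cc [scc Ec Dc]] := hadamard2 r0 sE.
  by move=> y yr; rewrite DE /= ?D2ht0 // /A /= norm_pair_lt /= normr0 r0.
have E0 y : E (0, y) = 0 by rewrite /E /ht /= phi0 h_0.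
have Q0 : Q 0 != 0.
  apply/eqP => Z; have : (Dt 0)^-1 == 0 by rewrite -D11ht DQ Z mulr0.
  by rewrite invr_eq0 (negPf Dt0).
have c0 : cc 0 != 0.
  apply/eqP => Z; move: D22ht; apply/negP; rewrite negbK.
  have <- : 'D_e1 ('D_e1 E) 0 = 'D_e2 ('D_e2 ht) 0.
    have nE : \forall w \near (0 : C), 'D_e1 E w = 'D_e2 ht (0, w.1).
      by apply: filterS (near_A A0) => w /DE.
    rewrite (near_eq_derive _ nE).
    have -> : (fun w : C => 'D_e2 ht (0, w.1)) = 'D_e2 ht \o lin22 0 0 1 0.
      by apply/funext => w; rewrite /= swapE.
    have dl : differentiable (lin22 0 0 1 0) (0 : C).
      exact/linear_differentiable/lin22_continuous.
    have dh : differentiable ('D_e2 ht) (lin22 0 0 1 0 (0 : C)).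
      by rewrite swapE; apply: Ck_differentiable D2ht_smooth _; exact: Aswap.
    rewrite (derive_chain e1 dl dh) swapE; congr ('D_ _ _ _).
    rewrite deriveE // diff_lin /=; last exact: lin22_continuous.
    by rewrite /lin22 /= !mul0r !mulr1 !addr0.
  by rewrite Dc Z mulr0.
have sgn x : x != 0 -> exists2 s : R, s * s = 1 & 0 < s * x.
  move=> x0; have [xp|xn|x00] := ltrgtP x 0.
  - by exists (-1); rewrite ?mulrNN ?mulr1 // mulN1r oppr_gt0.
  - by exists 1; rewrite ?mulr1 // mul1r.
  - by rewrite x00 eqxx in x0.
(* [sq] and [sc] are the signs of [Q 0] and [cc 0]. *)
have [sq sq2 sqp] := sgn _ Q0; have [sc sc2 scp] := sgn _ c0.
have npos (f : C -> R) s : smooth_on A f -> 0 < s * f 0 ->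
    \forall z \near (0 : C), 0 < s * f z.
  move=> sf fp.
  have c : {for 0 : C, continuous ((fun=> s) * f)}.
    by apply: cvgM; [exact: cvg_cst|exact: smooth_continuous sf A0].
  exact: c _ (open_nbhs_nbhs (conj (open_gt0 (R := R)) fp)).
have [r' r'0 Hr'] := near_radius (filterI (near_A A0) (filterI (npos _ _ sQ sqp) (npos _ _ scc scp))).
pose A' := [set z : C | `|z| < r'].
have oA' : open A' by exact: ball_open.
have A'0 : A' 0 by rewrite /A' /= normr0.
have {}Hr' z : A' z -> [/\ A z, 0 < sq * Q z & 0 < sc * cc z].
  by move=> /ltW zr; have [|? []] := Hr' z; first by rewrite subr0.
have A'A z : A' z -> A z by case/Hr'.
have A'swap (z : C) : A' z -> A' (z.2, 0).
  by move=> Az; rewrite /A' /= norm_pair_lt /= normr0 r'0 andbT (le_lt_trans (norm_snd_le z)).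
pose a (z : C) := sc * cc (z.2, 0).
have ap z : A' z -> 0 < a z by move=> /A'swap /Hr' [].
have swapE' (w : C) : lin22 0 1 0 0 w = (w.2, 0).
  by rewrite /lin22 !mul0r mul1r !add0r.
have sa : smooth_on A' a.
  move=> n; have H : Ck_on A' n (cc \o lin22 0 1 0 0).
    apply: (Ck_comp2 (B := A)) (Ck_lin22 n _ _ _ _ oA') (scc n) => //.
    by move=> w Aw; rewrite swapE'; apply: A'A; exact: A'swap.
  apply: Ck_ext oA' _ (CkM oA' (Ck_cst A' n sc) H) => w _.
  by rewrite /a -swapE'.
have sQ' : smooth_on A' (fun z => sq * Q z).
  by move=> n; apply: CkM oA' (Ck_cst A' n sq) (Ck_sub _ (sQ n)) => z /A'A.
pose s z := Num.sqrt (a z * (sq * Q z)).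
have pp z : A' z -> 0 < a z * (sq * Q z).
  by move=> Az; apply: mulr_gt0; [exact: ap|case: (Hr' _ Az)].
have ss : smooth_on A' s.
  move=> n; apply: (Ck_comp1 (B := [set x : R | 0 < x]) oA' pp _ (Ck_sqrt n)).
  exact: (CkM oA' (sa n) (sQ' n)).
have s1 : smooth_on A' (fst : C -> R).
  by move=> n; apply: Ck_lin => //; exact: continuous_fst_lin.
have s2 : smooth_on A' (snd : C -> R).
  by move=> n; apply: Ck_lin => //; exact: continuous_snd_lin.
pose S (z : C) : C := (z.1 * s z, z.2 * a z).
pose T (z : C) : C := (sq * (z.1 * a z), z.2 * a z).
have sM (f g : C -> R) : smooth_on A' f -> smooth_on A' g ->
    smooth_on A' (fun z => f z * g z).
  by move=> sf sg n; exact: (CkM oA' (sf n) (sg n)).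
have sS : smooth_on A' S.
  by move=> n; exact: (Ck_pair oA' (sM _ _ s1 ss n) (sM _ _ s2 sa n)).
have sT : smooth_on A' T.
  by move=> n; exact: (Ck_pair oA' (sM _ _ (fun n => Ck_cst A' n sq) (sM _ _ s1 sa) n)
     (sM _ _ s2 sa n)).
have d0 (W : normedModType R) (f : C -> W) : smooth_on A' f -> differentiable f 0.
  by move=> sf; exact: Ck_differentiable sf A'0.
have Dm1 (f : C -> R) v : smooth_on A' f -> 'D_v (fun z : C => z.1 * f z) 0 = v.1 * f 0.
  move=> sf; rewrite derive_mul ?derive_fst_vec ?mul0r ?addr0 //; first exact: (d0 _ _ s1).
  exact: d0.
have Dm2 (f : C -> R) v : smooth_on A' f -> 'D_v (fun z : C => z.2 * f z) 0 = v.2 * f 0.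
  move=> sf; rewrite derive_mul ?derive_snd_vec ?mul0r ?addr0 //; first exact: (d0 _ _ s2).
  exact: d0.
have DS v : 'D_v S 0 = (v.1 * s 0, v.2 * a 0).
  rewrite /S derive_pair; first by rewrite Dm1 // Dm2.
    exact: (d0 _ _ (sM _ _ s1 ss)).
  exact: (d0 _ _ (sM _ _ s2 sa)).
have DT v : 'D_v T 0 = (sq * (v.1 * a 0), v.2 * a 0).
  have dsa := d0 _ _ (sM _ _ s1 sa).
  rewrite /T derive_pair.
  - rewrite Dm2 // (derive_mul v (@differentiable_cst R C R sq 0) dsa).
    by rewrite derive_cst mul0r add0r Dm1.
  - by apply: differentiableM => //; exact: differentiable_cst.
  - exact: (d0 _ _ (sM _ _ s2 sa)).
have a0 : 0 < a 0 by exact: ap.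
have s0 : 0 < s 0 by rewrite sqrtr_gt0 pp.
have sq0 : sq != 0 by apply/eqP => Z; move/eqP: sq2; rewrite Z mul0r eq_sym oner_eq0.
have S0 : S 0 = 0 by rewrite /S !mul0r.
have T0 : T 0 = 0 by rewrite /T !mul0r mulr0.
have lS : local_diffeo S 0 0.
  rewrite -{2}S0; apply: inverse_function oA' A'0 sS _.
  by rewrite /jacobian_det !DS /= !mul0r !mul1r subr0 mulf_neq0 // gt_eqF.
have lT : local_diffeo T 0 0.
  rewrite -{2}T0; apply: inverse_function oA' A'0 sT _.
  have an : a 0 != 0 by rewrite gt_eqF.
  rewrite /jacobian_det !DT /= !mul0r !mul1r !mulr0 subr0.
  by apply: mulf_neq0 => //; exact: mulf_neq0.
have [Si lSi [HS _]] := local_diffeo_inv lS.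
have [tau ltau [HT1 HT2]] := local_diffeo_inv lT.
have cSi := local_diffeo_continuous lSi; have ctau := local_diffeo_continuous ltau.
have Si0 : Si 0 = 0 by case: lSi.
have tau0 : tau 0 = 0 by case: ltau.
have nA' : \forall z \near (0 : C), A' z by exact: open_nbhs_nbhs.
have tau_factored : radially_factored tau.
  exists sq, 0, 0, 1, (fun b => (a (tau b))^-1); split.
    by rewrite mulr1 mulr0 subr0.
  have nt : \forall b \near (0 : C), A' (tau b) by apply: ctau; rewrite tau0.
  move: nt HT1; apply: filterS2 => b At Tb.
  have ab := ap _ At; split; first by rewrite invr_gt0.
  have an : a (tau b) != 0 by rewrite gt_eqF.
  have E1 := congr1 fst Tb; have E2 := congr1 snd Tb; rewrite /= in E1 E2.
  apply: pair_ext; rewrite /= /GRing.scale /=.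
    by rewrite mul0r addr0 -E1 [sq * (sq * _)]mulrA sq2 mul1r mulrC mulfK.
  by rewrite mul0r add0r mul1r -E2 mulrC mulfK.
pose F z := (h z, k z).
(* [T] only rescales by a function of the second component, and the second
   component of [F (phi z)] is [z.2]. *)
have key z : A' z -> T (F (phi z)) =
    ((S z).1 ^+ 2 + sq * sc * (S z).2 ^+ 2, (S z).2).
  move=> A'z; have Az := A'A _ A'z.
  have A'zs := A'A _ (A'swap _ A'z).
  have F1 : ht z = z.2 ^+ 2 * cc (z.2, 0) + z.1 ^+ 2 * Q z.
    rewrite EQ //; congr (_ + _).
    have -> : ht (0, z.2) = E (z.2, 0) by [].
    by rewrite Ec // E0 add0r.
  have aE : a (F (phi z)) = a z by rewrite /a /F /= kphi.
  rewrite /T aE /F /= -/(ht z) kphi // F1.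
  congr (_, _).
  rewrite [in RHS]exprMn sqr_sqrtr; last exact/ltW/pp.
  have -> : cc (z.2, 0) = sc * a z by rewrite /a mulrA sc2 mul1r.
  by ring.
have sigma_equiv psi : (forall z, A' z -> T (F (phi z)) = psi (S z)) ->
    factored_equiv F 0 psi.
  move=> Hpsi; exists (phi \o Si), tau; split=> //.
    exact: local_diffeo_comp lSi lphi.
  have cF : {for 0 : C, continuous (F \o phi)}.
    apply: continuous_comp; first exact: local_diffeo_continuous lphi.
    rewrite phi0; apply: differentiable_continuous.
    by apply: differentiable_pair; exact: dT.
  have nF : \forall z \near (0 : C), tau (T (F (phi (Si z)))) = F (phi (Si z)).
    have H2 : nbhs ((F \o phi) 0) [set w | tau (T w) = w].
      by rewrite /= phi0 /F h_0 k_0; exact: HT2.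
    have nG : nbhs (Si 0) [set y | tau (T (F (phi y))) = F (phi y)].
      by rewrite Si0; exact: (cF _ H2).
    exact: (cSi _ nG).
  have nSi : \forall z \near (0 : C), A' (Si z) by apply: cSi; rewrite Si0.
  move: nF nSi HS; apply: filterS3 => z E1 ASi SSi.
  by rewrite /= -E1 Hpsi // SSi.
have [scE|scE] : sq * sc = 1 \/ sq * sc = -1.
  have : (sq * sc) ^+ 2 == 1 by rewrite expr2 mulrACA sq2 sc2 mulr1.
  by rewrite sqrf_eq1 => /orP[/eqP|/eqP]; [left|right].
- right; apply: sigma_equiv => z Az; rewrite key //.
  by rewrite scE mul1r.
- left; apply: sigma_equiv => z Az; rewrite key //.
  by rewrite scE mulN1r.
Qed.

End NormalForm.

Section FoldGerm.
Context {R : realType}.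
Notation C := (R * R)%type.
Variables h k h1 h2 k1 k2 : C -> R.

(** The first derivatives are parameters so that the statement applies verbatim to
    directional derivatives in other linear coordinates. *)
Theorem fold_germ :
  smooth_on setT h -> smooth_on setT k -> h 0 = 0 -> k 0 = 0 ->
  h1 = 'D_(1, 0) h -> h2 = 'D_(0, 1) h -> k1 = 'D_(1, 0) k -> k2 = 'D_(0, 1) k ->
  h1 0 = 0 -> h2 0 = 0 -> k1 0 = 0 -> k2 0 != 0 ->
  'D_(1, 0) h1 0 != 0 ->
  'D_(1, 0) h1 0 * 'D_(0, 1) h2 0 - 'D_(1, 0) h2 0 * 'D_(0, 1) h1 0 != 0 ->
  factored_equiv (fun z => (h z, k z)) 0 psi_hyperbolic \/
  factored_equiv (fun z => (h z, k z)) 0 psi_elliptic.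
Proof.
move=> sh sk h0 k0 h1E h2E k1E k2E h10 h20 k10 k20 h11 hess.
have [phi [r [r0 lphi sphi H]]] := fold_coordinates sh sk k0 h1E h2E k1E k2E
  h10 h20 k10 k20 h11 erefl erefl erefl erefl.
apply: (fold_normal_form sh sk h0 k0 h1E h2E k1E k2E h10 h20 k10 k20 h11 hess
  erefl erefl erefl erefl r0 _ sphi _ _ _ lphi) => [|z /H []|z /H []|z /H []] //.
by case: lphi.
Qed.

End FoldGerm.

(** * Normal forms at regular and singular points *)

Section LocalForms.
Context {R : realType}.
Notation C := (R * R)%type.
Variables (f : C -> C) (z0 : C).
Hypotheses (sf : smooth_on setT f) (f0 : f z0 = 0).

Lemma regular_normal_form : jacobian_det f z0 != 0 -> radially_equivalent f z0 psi_regular.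
Proof.
move=> J0; have lf : local_diffeo f z0 0.
  by rewrite -f0; apply: inverse_function openT I sf J0.
have [s ls [H _]] := local_diffeo_inv lf.
apply: factored_equiv_radially; exists s, id; split=> //.
- split=> //; exists setT, setT; split=> //.
  have sid : smooth_on setT (id : C -> C).
    by move=> k; apply: (Ck_lin k (f := idfun) openT) => x; exact: cvg_id.
  split=> //; try exact: openT; first by rewrite image_id.
  by exists id.
- exists 1, 0, 0, 1, (fun=> 1); split; first by rewrite mulr1 mulr0 subr0 oner_neq0.
  by apply: filterS H => z _; split=> //; apply: pair_ext; rewrite /= /GRing.scale /=; ring.
- by apply: filterS H => z ->; rewrite /psi_regular -surjective_pairing.
Qed.

Variables (a b c d : R) (v w : C).
Hypothesis D0 : a * d - b * c != 0.
Hypothesis vw0 : v.1 * w.2 - w.1 * v.2 != 0.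

Variables h k : C -> R.
Hypotheses (hE : h = fun z => a * (f z).1 + b * (f z).2).
Hypotheses (kE : k = fun z => c * (f z).1 + d * (f z).2).
Let l (z : C) : C := z0 + lin22 v.1 w.1 v.2 w.2 z.

Let sl : smooth_on setT l.
Proof. by move=> n; exact: (CkD openT (Ck_cst _ n z0) (Ck_lin22 n _ _ _ _ openT)). Qed.

Let Dl z u : 'D_u l z = lin22 v.1 w.1 v.2 w.2 u.
Proof.
have dl : differentiable (lin22 v.1 w.1 v.2 w.2) z.
  exact/linear_differentiable/lin22_continuous.
rewrite /l (_ : (fun z => _) = cst z0 + lin22 v.1 w.1 v.2 w.2) //.
rewrite deriveD; [|exact: derivable_cst|exact: diff_derivable].
by rewrite derive_cst add0r deriveE // diff_lin //; exact: lin22_continuous.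
Qed.

Let ll : local_diffeo l 0 z0.
Proof.
have <- : l 0 = z0 by rewrite /l linear0 addr0.
apply: inverse_function openT I sl _; rewrite /jacobian_det !Dl /=.
by rewrite !mulr1 !mulr0 !addr0 !add0r.
Qed.

Let D1l (g : C -> R) : smooth_on setT g -> (fun z => 'D_v g (l z)) = 'D_(1, 0) (g \o l).
Proof.
move=> sg; apply/funext => z.
rewrite (derive_chain ((1, 0) : C) (Ck_differentiable (x := z) sl I) (Ck_differentiable sg I)) Dl.
congr ('D_ _ g _); apply: pair_ext; rewrite /= mulr1 mulr0 addr0 //.
Qed.

Let D2l (g : C -> R) : smooth_on setT g -> (fun z => 'D_w g (l z)) = 'D_(0, 1) (g \o l).
Proof.
move=> sg; apply/funext => z.
rewrite (derive_chain ((0, 1) : C) (Ck_differentiable (x := z) sl I) (Ck_differentiable sg I)) Dl.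
congr ('D_ _ g _); apply: pair_ext; rewrite /= mulr1 mulr0 add0r //.
Qed.

Let slin (p q : R) : smooth_on setT (fun z => p * (f z).1 + q * (f z).2).
Proof.
move=> n; exact: (CkD openT (CkM openT (Ck_cst _ n p) (Ck_fst openT (sf n)))
                            (CkM openT (Ck_cst _ n q) (Ck_snd openT (sf n)))).
Qed.

Hypotheses (hv : 'D_v h z0 = 0) (hw : 'D_w h z0 = 0).
Hypotheses (kv : 'D_v k z0 = 0) (kw : 'D_w k z0 != 0).
Hypothesis hvv : 'D_v ('D_v h) z0 != 0.
Hypothesis hess : 'D_v ('D_v h) z0 * 'D_w ('D_w h) z0 -
                  'D_v ('D_w h) z0 * 'D_w ('D_v h) z0 != 0.

(** The affine source coordinates [l] send the kernel [v] and a complement [w] to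
    the axes, and the linear target coordinates [(h, k)] make the first component
    critical; the germ is then that of [fold_germ]. *)
Lemma singular_normal_form :
  radially_equivalent f z0 psi_hyperbolic \/ radially_equivalent f z0 psi_elliptic.
Proof.
have sh : smooth_on setT h by rewrite hE; exact: slin.
have sk : smooth_on setT k by rewrite kE; exact: slin.
have l0 : l 0 = z0 by case: ll.
have sc (g : C -> R) : smooth_on setT g -> smooth_on setT (g \o l).
  by move=> sg n; exact: (Ck_comp2 (B := setT) openT (fun _ _ => I) (sl n) (sg n)).
have E1 (g : C -> R) : smooth_on setT g -> 'D_(1, 0) (fun z => g (l z)) 0 = 'D_v g z0.
  by move=> sg; rewrite -[X in _ = 'D_v g X]l0 -[RHS]/((fun z => 'D_v g (l z)) 0) D1l.
have E2 (g : C -> R) : smooth_on setT g -> 'D_(0, 1) (fun z => g (l z)) 0 = 'D_w g z0.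
  by move=> sg; rewrite -[X in _ = 'D_w g X]l0 -[RHS]/((fun z => 'D_w g (l z)) 0) D2l.
have dv := smooth_derive v sh; have dw := smooth_derive w sh.
have kl : k (l 0) = 0 by rewrite l0 kE f0 /= !mulr0 addr0.
have hl : h (l 0) = 0 by rewrite l0 hE f0 /= !mulr0 addr0.
have H := fold_germ (sc _ sh) (sc _ sk) hl kl (D1l sh) (D2l sh) (D1l sk) (D2l sk).
have EF : (fun z => ((h \o l) z, (k \o l) z)) = lin22 a b c d \o (f \o l).
  by rewrite hE kE.
have fin psi : factored_equiv (fun z => ((h \o l) z, (k \o l) z)) 0 psi ->
    radially_equivalent f z0 psi.
  rewrite EF => /(factored_equiv_target D0) /(factored_equiv_source ll).
  exact: factored_equiv_radially.
have [||||||/fin|/fin] := H; [..|by left|by right].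
- by rewrite l0.
- by rewrite l0.
- by rewrite l0.
- by rewrite l0.
- by move: hvv; rewrite -(E1 _ dv).
- apply: contra hess => /eqP E; apply/eqP; rewrite -[RHS]E.
  exact: (congr2 (fun x y => x - y)
    (congr2 *%R (esym (E1 _ dv)) (esym (E2 _ dw)))
    (congr2 *%R (esym (E1 _ dw)) (esym (E2 _ dv)))).
Qed.

End LocalForms.

(** * Lipschitz images of cubes *)

Section Pigeonhole.
Context {R : realType}.

(** A Lipschitz image of an [n]-dimensional cube cannot contain a small
    [n.+1]-dimensional cube.  Otherwise choose preimages of the [N.+1 ^ n.+1] points
    of a grid of mesh [e / N]: they are pairwise at distance at least a constant
    over [N], hence lie in distinct cells of a partition of the [n]-dimensional cube
    into [(C * N) ^ n] cells, which is impossible for [N = C ^ n]. *)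
Lemma lipschitz_cube_not_onto (n : nat) (Phi : (nat -> R) -> nat -> R) (r L e : R) :
  0 < r -> 0 < L -> 0 < e ->
  (forall c c' : nat -> R, (forall i, (i < n)%N -> `|c i| <= r) ->
     (forall i, (i < n)%N -> `|c' i| <= r) ->
     forall d, 0 <= d -> (forall i, (i < n)%N -> `|c i - c' i| <= d) ->
     forall i, (i < n.+1)%N -> `|Phi c i - Phi c' i| <= L * d) ->
  exists2 a : nat -> R, (forall i, `|a i| <= e) &
    forall c, (forall i, (i < n)%N -> `|c i| <= r) ->
      ~ (forall i, (i < n.+1)%N -> Phi c i = a i).
Proof.
move=> r0 L0 e0 HL; apply: contrapT => Hno.
have Hall (a : nat -> R) : (forall i, `|a i| <= e) ->
    exists c : nat -> R, (forall i, (i < n)%N -> `|c i| <= r) /\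
      forall i, (i < n.+1)%N -> Phi c i = a i.
  move=> ae; apply: contrapT => Hc; apply: Hno; exists a => // c cr Hi.
  by apply: Hc; exists c.
pose C0 := Num.truncn (4 * r * L / e).
pose C := C0.+2.
pose N := (C ^ n)%N.
have N0 : (0 < N)%N by rewrite expn_gt0.
have NR : 0 < N%:R :> R by rewrite ltr0n.
(* Points of one cell have images closer than the mesh of the grid. *)
pose d : R := e / (2 * L * N%:R).
have d0 : 0 < d by rewrite divr_gt0 // !mulr_gt0.
pose a (g : {ffun 'I_n.+1 -> 'I_N.+1}) (i : nat) : R := e * (g (inord i))%:R / N%:R.
have ae g i : `|a g i| <= e.
  rewrite ger0_norm; last by rewrite divr_ge0 ?mulr_ge0 // ltW.
  rewrite ler_pdivrMr // ler_pM2l // ler_nat -ltnS; exact: ltn_ord.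
have /choice [c Hc] g := Hall _ (ae g).
pose cell (g : {ffun 'I_n.+1 -> 'I_N.+1}) : {ffun 'I_n -> 'I_(C * N)} :=
  [ffun i : 'I_n => insubd (Ordinal (ltn_mul (ltn0Sn C0.+1) N0)) (Num.truncn ((c g i + r) / d))].
have cellE g (i : 'I_n) : 0 <= (c g i + r) / d /\
    val (cell g i) = Num.truncn ((c g i + r) / d).
  have := (Hc g).1 i (ltn_ord i); rewrite ler_norml => /andP[c1 c2].
  have p0 : 0 <= (c g i + r) / d by apply: divr_ge0; [lra|exact: ltW].
  split=> //; rewrite /cell ffunE val_insubd ifT //.
  rewrite truncn_lt_nat //.
  rewrite ltr_pdivrMr //.
  have h1 : 4 * r * L / e < C0.+1%:R by apply: (truncnS_gt).
  have : C%:R * N%:R * d = C%:R * (e / (2 * L)).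
    rewrite /d; field; rewrite (gt_eqF L0) gt_eqF //.
  rewrite natrM => ->.
  have h2 : 2 * r < C%:R * (e / (2 * L)).
    rewrite mulrA ltr_pdivlMr ?mulr_gt0 //.
    rewrite ltr_pdivrMr // in h1.
    have : C0.+1%:R * e < C%:R * e by rewrite ltr_pM2r // ltr_nat.
    by move: h1; lra.
  lra.
have cell_inj : injective cell.
  move=> g g' E; apply/ffunP => i; apply/val_inj.
  have close (j : nat) : (j < n)%N -> `|c g j - c g' j| <= d.
    move=> jn; pose j' := Ordinal jn.
    have [p1 q1] := cellE g j'; have [p2 q2] := cellE g' j'.
    have t1 := truncn_itv p1; have t2 := truncn_itv p2.
    rewrite -q1 in t1; rewrite -q2 in t2; rewrite E /= in t1; rewrite /= in t2.
    case/andP: t1 => t1 t1'; case/andP: t2 => t2 t2'.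
    rewrite ler_pdivlMr // in t1; rewrite ltr_pdivrMr // in t1'.
    rewrite ler_pdivlMr // in t2; rewrite ltr_pdivrMr // in t2'.
    rewrite -natr1 mulrDl mul1r in t1'; rewrite -natr1 mulrDl mul1r in t2'.
    by rewrite ler_distlC; apply/andP; split; lra.
  have := HL _ _ (Hc g).1 (Hc g').1 _ (ltW d0) close i (ltn_ord i).
  rewrite (Hc g).2 // (Hc g').2 // /a inord_val.
  have -> : L * d = e / N%:R / 2.
    by rewrite /d; field; rewrite (gt_eqF L0) gt_eqF.
  have -> : e * (g i)%:R / N%:R - e * (g' i)%:R / N%:R = e / N%:R * ((g i)%:R - (g' i)%:R).
    by field; rewrite gt_eqF.
  have eN : 0 < e / N%:R by rewrite divr_gt0.
  rewrite normrM (gtr0_norm eN) ler_pM2l // ler_norml => /andP[h1 h2].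
  apply/eqP; rewrite eqn_leq.
  rewrite -[X in X && _]ltnS -[X in _ && X]ltnS; apply/andP; split.
    by rewrite -(ltr_nat R) -natr1; move: h2; lra.
  by rewrite -(ltr_nat R) -natr1; move: h1; lra.
have := leq_card cell cell_inj.
rewrite !card_ffun !card_ord expnMn -/N -expnS.
by rewrite leqNgt ltn_exp2r // ltnSn.
Qed.

End Pigeonhole.

Section BoundedLipschitz.
Context {R : realType} (n : nat) (r : R).
Implicit Types (f g : (nat -> R) -> R).

Definition in_cube (c : nat -> R) := forall i, (i < n)%N -> `|c i| <= r.

(** Boundedness is included because it is what makes products Lipschitz. *)
Definition bounded_lipschitz f := exists2 L : R, 0 < L &
  (forall c, in_cube c -> `|f c| <= L) /\
  (forall c c', in_cube c -> in_cube c' -> forall d : R, 0 <= d ->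
     (forall i, (i < n)%N -> `|c i - c' i| <= d) -> `|f c - f c'| <= L * d).

Lemma bl_cst (x : R) : bounded_lipschitz (fun=> x).
Proof.
exists (`|x| + 1); first by rewrite ltr_wpDl.
split=> [c _|c c' _ _ d d0 _]; first by rewrite lerDl.
by rewrite subrr normr0 mulr_ge0 // addr_ge0.
Qed.

Lemma bl_coord i : (i < n)%N -> bounded_lipschitz (fun c => c i).
Proof.
move=> ltin; exists (`|r| + 1); first by rewrite ltr_wpDl.
split=> [c cr|c c' cr cr' d d0 cd].
  by rewrite (le_trans (cr i ltin)) // (le_trans (ler_norm r)) // lerDl.
by rewrite (le_trans (cd i ltin)) // mulrDl mul1r lerDr mulr_ge0.
Qed.

Lemma bl_add f g : bounded_lipschitz f -> bounded_lipschitz g ->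
  bounded_lipschitz (fun c => f c + g c).
Proof.
move=> [L L0 [b l]] [M M0 [b' l']]; exists (L + M); first exact: addr_gt0.
split=> [c cr|c c' cr cr' d d0 cd].
  by rewrite (le_trans (ler_normD _ _)) // lerD ?b ?b'.
rewrite opprD addrACA mulrDl (le_trans (ler_normD _ _)) // lerD //.
  exact: l.
exact: l'.
Qed.

Lemma bl_mul f g : bounded_lipschitz f -> bounded_lipschitz g ->
  bounded_lipschitz (fun c => f c * g c).
Proof.
move=> [L L0 [b l]] [M M0 [b' l']]; exists (L * M + L * M); first by rewrite addr_gt0 // mulr_gt0.
split=> [c cr|c c' cr cr' d d0 cd].
  rewrite normrM; apply: (@le_trans _ _ (L * M)).
    by apply: ler_pM => //; [exact: b|exact: b'].
  by rewrite lerDl; apply: mulr_ge0; exact: ltW.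
have -> : f c * g c - f c' * g c' = f c * (g c - g c') + (f c - f c') * g c' by ring.
apply: (le_trans (ler_normD _ _)); rewrite !normrM [leRHS]mulrDl; apply: lerD.
  by rewrite -mulrA; apply: ler_pM => //; [exact: b|exact: l'].
rewrite mulrAC; apply: ler_pM => //; [exact: l|exact: b'].
Qed.

Lemma bl_opp f : bounded_lipschitz f -> bounded_lipschitz (fun c => - f c).
Proof.
move=> [L L0 [b l]]; exists L => //; split=> [c cr|c c' cr cr' d d0 cd].
  by rewrite normrN b.
by rewrite -opprD normrN l.
Qed.

End BoundedLipschitz.

Section Lipschitz3.
Context {R : realType}.
Notation T3 := (R * R * R)%type.

Lemma derive_triple (F : T3 -> R) p (v : T3) : differentiable F p ->
  'D_v F p = v.1.1 * 'D_(1, 0, 0) F p + v.1.2 * 'D_(0, 1, 0) F p +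
             v.2 * 'D_(0, 0, 1) F p.
Proof.
move=> dF; case: v => [[a b] c] /=.
have E : ((a, b, c) : T3) =
    a *: ((1, 0, 0) : T3) + b *: ((0, 1, 0) : T3) + c *: ((0, 0, 1) : T3).
  by apply: pair_ext; [apply: pair_ext|]; rewrite /= /GRing.scale /=; ring.
by rewrite [in LHS]E !deriveDv // !deriveZv.
Qed.

Lemma smooth_lipschitz3 (F : T3 -> R) (r : R) : smooth_on setT F ->
  exists2 L, 0 < L & (forall z : T3, `|z| <= r -> `|F z| <= L) /\
    forall z w : T3, `|z| <= r -> `|w| <= r -> `|F z - F w| <= L * `|z - w|.
Proof.
move=> sF.
have bnd (G : T3 -> R) : smooth_on setT G ->
    exists2 M, 0 < M & forall z : T3, `|z| <= r -> `|G z| <= M.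
  move=> sG; have cK := @compact_cball3 R (0 : T3) r.
  have [z Kz|M M0 HM] := @compact_ubound _ _ _ G cK.
    exact: smooth_continuous sG I.
  by exists M => // z zr; apply: HM; rewrite /= subr0.
have [M0 M00 H0] := bnd _ sF.
have [M1 M10 H1] := bnd _ (smooth_derive ((1, 0, 0) : T3) sF).
have [M2 M20 H2] := bnd _ (smooth_derive ((0, 1, 0) : T3) sF).
have [M3 M30 H3] := bnd _ (smooth_derive ((0, 0, 1) : T3) sF).
exists (M0 + (M1 + M2 + M3)); first by rewrite !addr_gt0.
split=> [z zr|z w zr wr].
  by rewrite (le_trans (H0 z zr)) // lerDl !addr_ge0 // ltW.
have seg s : 0 <= s <= 1 -> `|w + s *: (z - w)| <= r.
  move=> /andP[s0 s1].
  have -> : w + s *: (z - w) = s *: z + (1 - s) *: w.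
    by rewrite scalerBr scalerBl scale1r addrCA.
  rewrite (le_trans (ler_normD _ _)) // !normrZ ger0_norm // ger0_norm ?subr_ge0 //.
  have -> : r = s * r + (1 - s) * r by ring.
  by apply: lerD; apply: ler_wpM2l => //; rewrite subr_ge0.
have dF q : differentiable F q by exact: Ck_differentiable sF I.
have [s s01 ->] := mean_value (fun s _ => dF (w + s *: (z - w))).
rewrite derive_triple //.
have n1 : `|(z - w).1.1| <= `|z - w|.
  exact: le_trans (norm_fst_le (z - w).1) (norm_fst_le (z - w)).
have n2 : `|(z - w).1.2| <= `|z - w|.
  exact: le_trans (norm_snd_le (z - w).1) (norm_fst_le (z - w)).
have n3 := norm_snd_le (z - w).
rewrite (@le_trans _ _ ((M1 + M2 + M3) * `|z - w|)) //; last first.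
  by rewrite ler_wpM2r // lerDr ltW.
have bd (x M : R) (G : T3 -> R) : `|x| <= `|z - w| ->
    (forall z : T3, `|z| <= r -> `|G z| <= M) ->
    `|x * G (w + s *: (z - w))| <= M * `|z - w|.
  move=> hx hG; rewrite normrM [leRHS]mulrC; apply: ler_pM => //.
  exact/hG/seg.
rewrite [leRHS]mulrDl [in leRHS]mulrDl.
apply: (le_trans (ler_normD _ _)); apply: lerD; last exact: (bd _ _ ('D_((0, 0, 1) : T3) F) n3 H3).
apply: (le_trans (ler_normD _ _)); apply: lerD.
  exact: (bd _ _ ('D_((1, 0, 0) : T3) F) n1 H1).
exact: (bd _ _ ('D_((0, 1, 0) : T3) F) n2 H2).
Qed.

Lemma bl_smooth (n : nat) (r : R) (F : T3 -> R) : (2 < n)%N -> smooth_on setT F ->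
  bounded_lipschitz n r (fun c => F (c 0%N, c 1%N, c 2%N)).
Proof.
move=> n2 sF; have n1 := ltnW n2; have n0 := ltnW n1.
have [L L0 [B H]] := smooth_lipschitz3 r sF.
have nle (c : nat -> R) (d : R) : (forall i, (i < n)%N -> `|c i| <= d) ->
    `|((c 0%N, c 1%N, c 2%N) : T3)| <= d.
  by move=> cd; rewrite !norm_pair_le /= !cd.
exists L => //; split=> [c cr|c c' cr cr' d d0 cd]; first by apply: B; exact: nle.
apply: (le_trans (H _ _ (nle _ _ cr) (nle _ _ cr'))).
rewrite ler_pM2l //.
exact: (nle (fun i => c i - c' i) d cd).
Qed.

End Lipschitz3.

(** * Bump functions and iterated derivatives *)

Section Flat.
Context {R : realType}.

(** The function [exp (- 1 / x)] extended by zero, multiplied by powers of [1 / x]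
    so that the family is stable under differentiation. *)
Definition flat (n : nat) (x : R) : R :=
  if 0 < x then x^-1 ^+ n * expR (- x^-1) else 0.

(** Comparison of [expR y] with [y ^+ n.+1], for [y] the inverse of [x]. *)
Lemma flat_le n (x : R) : `|flat n x| <= n.+1%:R ^+ n.+1 * `|x|.
Proof.
rewrite /flat; case: ifPn => [x0|_]; last by rewrite normr0 mulr_ge0 // exprn_ge0.
have y0 : 0 < x^-1 by rewrite invr_gt0.
rewrite !ger0_norm ?mulr_ge0 ?exprn_ge0 ?expR_ge0 ?(ltW x0) ?(ltW y0) //.
set y := x^-1 in y0 *.
have N0 : 0 < n.+1%:R :> R by rewrite ltr0n.
have H : (y / n.+1%:R) ^+ n.+1 <= expR y.
  have -> : expR y = expR (y / n.+1%:R) ^+ n.+1.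
    by rewrite -expRM_natl; congr expR; rewrite mulrC divfK // gt_eqF.
  apply: lerXn2r; rewrite ?nnegrE ?expR_ge0 ?divr_ge0 ?ltW //.
  by apply: lt_le_trans (expR_ge1Dx _); rewrite ltrDr ltr01.
have -> : x = y^-1 by rewrite /y invrK.
rewrite expRN ler_pdivrMr ?expR_gt0 //.
apply: (@le_trans _ _ (n.+1%:R ^+ n.+1 * y^-1 * (y / n.+1%:R) ^+ n.+1)).
  have P0 : n.+1%:R ^+ n.+1 != 0 :> R by rewrite expf_neq0 // gt_eqF.
  rewrite expr_div_n [y ^+ n.+1]exprS; move: P0; set P := n.+1%:R ^+ n.+1 => P0.
  set q := y ^+ n; have -> : P / y * (y * q / P) = q; last by [].
  by field; rewrite P0 gt_eqF.
by rewrite ler_wpM2l // mulr_ge0 ?exprn_ge0 // invr_ge0 ltW.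
Qed.

Lemma flatS n (x : R) : flat n x = x * flat n.+1 x.
Proof.
rewrite /flat; case: ifPn => [x0|_]; last by rewrite mulr0.
by rewrite exprS !mulrA divff ?mul1r // gt_eqF.
Qed.

(** At the origin [flat n x] is [x * flat n.+1 x], which is of second order by
    [flat_le]. *)
Lemma flat_is_derive n (x : R) :
  differentiable (flat n) x /\
  'D_1 (flat n) x = - n%:R * flat n.+1 x + flat n.+2 x.
Proof.
have [x0|x0|<-] := ltgtP 0 x.
- have nE : \forall z \near x, x^-1 ^+ 0 = 1 -> (z^-1 ^+ n * expR (- z^-1)) = flat n z.
    have : \forall z \near x, 0 < z by apply: (open_nbhs_nbhs (conj (@open_gt R 0) x0)).
    by apply: filterS => z z0 _; rewrite /flat z0.
  have {}nE : \forall z \near x, (z^-1 ^+ n * expR (- z^-1)) = flat n z.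
    by apply: filterS nE => z; apply.
  have xn : x != 0 by rewrite gt_eqF.
  have D : is_derive x 1 (fun z : R => z^-1 ^+ n * expR (- z^-1))
      (- n%:R * flat n.+1 x + flat n.+2 x).
    have Di : is_derive x (1 : R) (fun z : R => z^-1) (- x ^- 2).
      have dI : differentiable (fun z : R => z^-1) x by exact: differentiable_Rinv.
      apply: DeriveDef; first exact: diff_derivable.
      by rewrite deriveE // diff_Rinv // /= scaler1.
    have De : is_derive x (1 : R) (fun z : R => expR (- z^-1)) (expR (- x^-1) * x ^- 2).
      have H1 : is_derive x (1 : R) (fun z : R => - z^-1) (- (- x ^- 2)).
        exact: is_deriveN.
      have := @is_derive1_comp R expR (fun z : R => - z^-1) x _ _ (is_derive_expR (- x^-1)) H1.
      by rewrite opprK.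
    have EF : (fun z : R => z^-1 ^+ n * expR (- z^-1)) =
        (fun z : R => z^-1) ^+ n * (fun z : R => expR (- z^-1)).
      by apply/funext => z; rewrite mulrfctE exprfctE.
    rewrite EF.
    have M := is_deriveM (is_deriveX n Di) De.
    apply: (is_derive_eq M); rewrite /flat x0 /GRing.scale /= exprfctE.
    set E := expR _; clearbody E; clear EF M De Di nE.
    case: n => [|m]; first by rewrite !mul0r mulr0 addr0 oppr0 mul0r add0r expr0 mul1r mulrC -exprVn.
    rewrite -exprVn; set y := x^-1; rewrite /= !exprS expr0; ring.
  split.
    apply: near_differentiable nE _; apply/derivable1_diffP; by case: D.
  by rewrite -(near_eq_derive _ nE); case: D.
- have nE : \forall z \near x, (0 : R) = flat n z.
    have : \forall z \near x, z < 0 by apply: (open_nbhs_nbhs (conj (@open_lt R 0) x0)).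
    by apply: filterS => z z0; rewrite /flat ltNge ltW.
  split; first by apply: near_differentiable nE _; exact: differentiable_cst.
  rewrite -(near_eq_derive _ nE) derive_cst /flat ltNge (ltW x0) /=.
  by rewrite mulr0 addr0.
- have F0 m : flat m 0 = 0 by rewrite /flat ltxx.
  have H : is_diff (0 : R) (flat n) (cst 0 : R -> R).
    have H1 := @is_diff_eps R R R (flat n) 0 \0.
    apply: H1 => [|e e0]; first exact: cst_continuous.
    pose c : R := n.+2%:R ^+ n.+2.
    have c0 : 0 < c by rewrite exprn_gt0.
    apply: (radius_near (r := e / c)); first by rewrite divr_gt0.
    move=> h; rewrite subr0 addr0 F0 !subr0 => he.
    rewrite flatS normrM mulrC; apply: ler_wpM2r => //.
    apply: (le_trans (flat_le _ _)).
    by rewrite mulrC -ler_pdivlMr // ltW.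
  split; first by case: H.
  by rewrite (is_diff_deriveE (1 : R) H) !F0 mulr0 addr0.
Qed.

Lemma Ck_flat k n : Ck_on setT k (flat n).
Proof.
elim: k n => [|k IH] n.
  by move=> x _; apply: differentiable_continuous; case: (flat_is_derive n x).
split=> [x _|v]; first by case: (flat_is_derive n x).
have H := CkM openT (Ck_cst _ k (v : R))
  (CkD openT (CkM openT (Ck_cst _ k (- n%:R : R)) (IH n.+1)) (IH n.+2)).
apply: Ck_ext openT _ H => x _.
have E : v = v *: (1 : R) by exact: esym (mulr1 _).
have [dx Dx] := flat_is_derive n x.
by rewrite [in RHS]E (deriveZv _ _ dx) Dx.
Qed.

Definition step (x : R) : R := flat 0 x / (flat 0 x + flat 0 (1 - x)).

Lemma flat_ge0 n x : 0 <= flat n x.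
Proof.
rewrite /flat; case: ifP => // x0.
by rewrite mulr_ge0 ?exprn_ge0 ?expR_ge0 // invr_ge0 ltW.
Qed.

Lemma flat_gt0 n x : 0 < x -> 0 < flat n x.
Proof. by move=> x0; rewrite /flat x0 mulr_gt0 ?exprn_gt0 ?expR_gt0 ?invr_gt0. Qed.

Lemma step_denom (x : R) : 0 < flat 0 x + flat 0 (1 - x).
Proof.
have [x0|x0] := ltP 0 x; first by rewrite ltr_pwDl ?flat_gt0 ?flat_ge0.
by rewrite ltr_wpDl ?flat_ge0 // flat_gt0 //; lra.
Qed.

Lemma Ck_step k : Ck_on setT k step.
Proof.
have c1 : Ck_on setT k (fun x : R => 1 - x).
  apply: (CkB openT (Ck_cst _ k (1 : R))).
  by apply: (Ck_lin k (f := idfun) openT) => x; exact: cvg_id.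
have c2 := Ck_comp1 (A := setT) (B := setT) openT (fun _ _ => I) c1 (Ck_flat k 0).
have c3 := CkD openT (Ck_flat k 0) c2.
apply: (CkM openT (Ck_flat k 0)).
by apply: CkV openT _ c3 => x _; rewrite gt_eqF // step_denom.
Qed.

Lemma step_le0 x : x <= 0 -> step x = 0.
Proof. by move=> x0; rewrite /step {1}/flat ltNge x0 mul0r. Qed.

Lemma step_ge1 x : 1 <= x -> step x = 1.
Proof.
move=> x1; have x0 : 0 < x by apply: lt_le_trans x1.
rewrite /step [flat 0 (1 - x)](_ : _ = 0) ?addr0 ?divff //.
  by rewrite gt_eqF // flat_gt0.
by rewrite /flat ltNge subr_le0 x1.
Qed.

End Flat.

Section Bump.
Context {R : realType}.
Notation T3 := (R * R * R)%type.

Lemma Ck_x (A : set T3) k : open A -> Ck_on A k (fun p : T3 => p.1.1).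
Proof.
move=> oA; apply: (Ck_fst oA (f := fun p : T3 => p.1)).
by apply: Ck_lin => //; exact: continuous_fst_lin.
Qed.

Lemma Ck_y (A : set T3) k : open A -> Ck_on A k (fun p : T3 => p.1.2).
Proof.
move=> oA; apply: (Ck_snd oA (f := fun p : T3 => p.1)).
by apply: Ck_lin => //; exact: continuous_fst_lin.
Qed.

Lemma Ck_t (A : set T3) k : open A -> Ck_on A k (fun p : T3 => p.2).
Proof. by move=> oA; apply: Ck_lin => //; exact: continuous_snd_lin. Qed.

(** The step function of a quadratic polynomial in the coordinates. *)
Lemma bump_function (r : R) : 0 < r -> exists2 chi : T3 -> R,
  smooth_on setT chi & exists2 rho : R, 0 < rho &
  (forall p, `|p| < r -> chi p = 1) /\ (forall p, rho < `|p| -> chi p = 0).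
Proof.
move=> r0; pose c := 3 * r ^+ 2 + 1.
have c1 : 1 < c by rewrite /c ltrDr mulr_gt0 // exprn_gt0.
pose q (p : T3) := c - (p.1.1 * p.1.1 + p.1.2 * p.1.2 + p.2 * p.2).
exists (step \o q).
  move=> k; apply: (Ck_comp1 (B := setT) openT (fun _ _ => I) _ (Ck_step k)).
  have m (f : T3 -> R) : Ck_on setT k f -> Ck_on setT k (fun p => f p * f p).
    by move=> h; exact: (CkM openT h h).
  apply: (CkB openT (Ck_cst _ k (c : R))).
  exact: (CkD openT (CkD openT (m _ (Ck_x k openT)) (m _ (Ck_y k openT)))
     (m _ (Ck_t k openT))).
have sqn (x : R) : x * x = `|x| ^+ 2 by rewrite real_normK ?num_real // expr2.
have sqlt (x : R) : `|x| < r -> x * x < r ^+ 2.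
  by move=> h; rewrite sqn ltrXn2r.
exists c; first exact: lt_trans c1.
split=> p.
  rewrite !norm_pair_lt => /andP[/andP[/sqlt h1 /sqlt h2] /sqlt h3].
  by apply: step_ge1; rewrite /q /c; lra.
move=> cp; apply: step_le0.
have sq0 (x : R) : 0 <= x * x by rewrite -expr2 sqr_ge0.
have sqgt (x : R) : c < `|x| -> c < x * x.
  move=> h; rewrite sqn expr2.
  by have := lt_trans c1 h => h1; nra.
have := sq0 p.1.1; have := sq0 p.1.2; have := sq0 p.2 => a1 a2 a3.
have : [\/ c < `|p.1.1|, c < `|p.1.2| | c < `|p.2|].
  have [h1|h1] := ltP c `|p.1.1|; first exact: Or31.
  have [h2|h2] := ltP c `|p.1.2|; first exact: Or32.
  apply: Or33; rewrite ltNge; apply/negP => h3.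
  by move: cp; rewrite ltNge !norm_pair_le h1 h2 h3.
by rewrite /q; case=> /sqgt; lra.
Qed.

End Bump.

Section IterDerive.
Context {R : realType} {V W : normedModType R}.
Implicit Types (f g : V -> W) (s : seq V).

Lemma smooth_iter s f : smooth_on setT f -> smooth_on setT (iter_derive s f).
Proof. by elim: s => //= v s IH /IH; exact: smooth_derive. Qed.

Lemma iter_derive_local (O : set V) s f g : open O -> (forall x, O x -> f x = g x) ->
  forall x, O x -> iter_derive s f x = iter_derive s g x.
Proof.
move=> oO fg; elim: s => //= v s IH x Ox; apply: near_eq_derive.
by apply: filterS (open_nbhs_nbhs (conj oO Ox)) => z /IH.
Qed.

Lemma smoothZ (c : R) f : smooth_on setT f -> smooth_on setT (fun x => c *: f x).
Proof.
move=> sf k; elim: k f sf => [|k IH] f sf.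
  move=> x _; apply: cvgZr; exact: (sf 0%N x).
split=> [x _|v].
  by apply: differentiableZ; exact: Ck_differentiable sf I.
apply: Ck_ext openT _ (IH _ (smooth_derive v sf)) => x _.
by rewrite deriveZ //; apply: diff_derivable; exact: Ck_differentiable sf I.
Qed.

Lemma smoothD f g : smooth_on setT f -> smooth_on setT g ->
  smooth_on setT (fun x => f x + g x).
Proof. by move=> sf sg k; exact: (CkD openT (sf k) (sg k)). Qed.

Lemma iter_derive_lin s (c : R) f g : smooth_on setT f -> smooth_on setT g ->
  forall x, iter_derive s (fun x => f x + c *: g x) x =
            iter_derive s f x + c *: iter_derive s g x.
Proof.
move=> sf sg; elim: s => //= v s IH x.
have -> : iter_derive s (fun x => f x + c *: g x) =
   iter_derive s f + c *: iter_derive s g by apply/funext => y; rewrite IH.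
have df := Ck_differentiable (x := x) (smooth_iter s sf) I.
have dg := Ck_differentiable (x := x) (smooth_iter s sg) I.
rewrite deriveD; [|exact: diff_derivable|exact/diff_derivable/differentiableZ].
by rewrite deriveZ //; exact: diff_derivable.
Qed.

End IterDerive.

(** * Degenerate zeros *)

Section Degeneracy.
Context {R : realType}.
Notation C := (R * R)%type.
Notation T3 := (R * R * R)%type.

Definition part (i : bool) (z : C) : R := if i then z.2 else z.1.
(** The two spatial directions; the third coordinate of a point is time. *)
Definition dir (j : bool) : T3 := if j then (0, 1, 0) else (1, 0, 0).

Definition jet (g : T3 -> C) (p : T3) (i : bool) (s : seq bool) : R :=
  part i (iter_derive (map dir s) g p).

(** Write [Psi] in components; [i] selects the component written first, [j] the
    first spatial direction.  With [h] the first component plus [m] times the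
    second and [v] the direction [j] plus [n] times the other one, the equations
    0 to 3 say that the momentary function vanishes and that [h] is critical.  If
    [b] is false, equations 4 and 5 say that [v] is in the kernel of the
    differential and that the second derivative of [h] along [v] vanishes; if [b]
    is true, they say that [v] is in the kernel of the Hessian of [h].  With [m] and
    [n] in [-1, 1] and all choices of [i] and [j], these charts cover all directions
    in the source and in the target.  Together these are six equations on the
    five-dimensional space of the space-time point and [m], [n]. *)
Definition degeneracy (b i j : bool) (D : bool -> seq bool -> R) (m n : R) (r : nat) : R :=
  let L s := D i s + m * D (~~ i) s in
  match r with
  | 0 => D i [::]
  | 1 => D (~~ i) [::]
  | 2 => L [:: j]
  | 3 => L [:: ~~ j]
  | 4 => if b then L [:: j; j] + n * L [:: j; ~~ j]
         else D (~~ i) [:: j] + n * D (~~ i) [:: ~~ j]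
  | _ => if b then L [:: ~~ j; j] + n * L [:: ~~ j; ~~ j]
         else L [:: j; j] + n * L [:: j; ~~ j] +
              (n * L [:: ~~ j; j] + n * (n * L [:: ~~ j; ~~ j]))
  end.

Definition nondegenerate_on (N : nat) (b i j : bool) : set (smooth_fun R) :=
  [set Psi | forall (p : T3) (m n : R), `|p| <= N%:R -> `|m| <= 1 -> `|n| <= 1 ->
     ~ forall r, (r < 6)%N -> degeneracy b i j (jet Psi p) m n r = 0].

Lemma degeneracyD b i j (D D' : bool -> seq bool -> R) m n r :
  degeneracy b i j (fun i s => D i s + D' i s) m n r =
  degeneracy b i j D m n r + degeneracy b i j D' m n r.
Proof.
case: r => [|[|[|[|[|r]]]]] //=; [ring|ring| |]; case: b; ring.
Qed.

Lemma degeneracyB b i j (D D' : bool -> seq bool -> R) m n r :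
  degeneracy b i j (fun i s => D i s - D' i s) m n r =
  degeneracy b i j D m n r - degeneracy b i j D' m n r.
Proof.
case: r => [|[|[|[|[|r]]]]] //=; [ring|ring| |]; case: b; ring.
Qed.

Lemma degeneracy_le b i j (D : bool -> seq bool -> R) m n r (e : R) :
  `|m| <= 1 -> `|n| <= 1 -> (forall i s, (size s <= 2)%N -> `|D i s| <= e) ->
  `|degeneracy b i j D m n r| <= 8 * e.
Proof.
move=> m1 n1 De.
have e0 : 0 <= e by apply: le_trans (De true [::] isT).
have cb (c x y : R) : `|c| <= 1 -> `|x| <= y -> `|c * x| <= y.
  by move=> hc hx; rewrite normrM -[leRHS]mul1r; apply: ler_pM.
have db (x x' y y' : R) : `|x| <= y -> `|x'| <= y' -> `|x + x'| <= y + y'.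
  by move=> h h'; apply: (le_trans (ler_normD _ _)); exact: lerD.
have Lb s : (size s <= 2)%N -> `|D i s + m * D (~~ i) s| <= e + e.
  by move=> s2; apply: db; [exact: De|apply: cb => //; exact: De].
case: r => [|[|[|[|[|r]]]]] /=.
- by apply: (le_trans (De _ [::] isT)); lra.
- by apply: (le_trans (De _ [::] isT)); lra.
- by apply: (le_trans (Lb [:: j] isT)); lra.
- by apply: (le_trans (Lb [:: ~~ j] isT)); lra.
- case: b.
    apply: (le_trans (db _ _ _ _ (Lb [:: j; j] isT) (cb _ _ _ n1 (Lb [:: j; ~~ j] isT)))).
    lra.
  apply: (le_trans (db _ _ _ _ (De _ [:: j] isT) (cb _ _ _ n1 (De _ [:: ~~ j] isT)))).
  lra.
- case: b.
    apply: (le_trans (db _ _ _ _ (Lb [:: ~~ j; j] isT) (cb _ _ _ n1 (Lb [:: ~~ j; ~~ j] isT)))).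
    lra.
  have h1 := db _ _ _ _ (Lb [:: j; j] isT) (cb _ _ _ n1 (Lb [:: j; ~~ j] isT)).
  have h2 := db _ _ _ _ (cb _ _ _ n1 (Lb [:: ~~ j; j] isT))
     (cb _ _ _ n1 (cb _ _ _ n1 (Lb [:: ~~ j; ~~ j] isT))).
  by apply: (le_trans (db _ _ _ _ h1 h2)); lra.
Qed.

Lemma part_smooth i (g : T3 -> C) : smooth_on setT g ->
  smooth_on setT (fun p => part i (g p)).
Proof.
by move=> sg k; case: i; [exact: (Ck_snd openT (sg k))|exact: (Ck_fst openT (sg k))].
Qed.

Lemma jet_smooth i s (g : T3 -> C) : smooth_on setT g ->
  smooth_on setT (fun p => jet g p i s).
Proof. by move=> sg; apply: part_smooth; exact: smooth_iter. Qed.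

Lemma part_iter i (s : seq T3) (g : T3 -> C) p : smooth_on setT g ->
  part i (iter_derive s g p) = iter_derive s (fun p => part i (g p)) p.
Proof.
move=> sg; elim: s p => //= v s IH p.
have -> : iter_derive s (fun p => part i (g p)) = (fun p => part i (iter_derive s g p)).
  by apply/funext => q; rewrite IH.
have d : differentiable (iter_derive s g) p.
  exact: Ck_differentiable (smooth_iter s sg) I.
by case: (i); rewrite /part; [rewrite derive_snd|rewrite derive_fst].
Qed.

Lemma normB_part i (z w : C) : `|part i z - part i w| <= `|z - w|.
Proof.
by case: i; [exact: (norm_snd_le (z - w))|exact: (norm_fst_le (z - w))].
Qed.

Lemma dir_basis s : {subset map dir s <= @basis3 R}.
Proof.
by move=> v /mapP [[] _ ->]; rewrite !inE eqxx ?orbT.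
Qed.

Lemma degeneracy_continuous b i j (g : T3 -> C) r : smooth_on setT g ->
  forall x : T3 * R * R,
  {for x, continuous (fun x : T3 * R * R => degeneracy b i j (jet g x.1.1) x.1.2 x.2 r)}.
Proof.
move=> sg x.
pose cont (f : T3 * R * R -> R) := {for x, continuous f}.
have cD f f' : cont f -> cont f' -> cont (fun x => f x + f' x) by exact: cvgD.
have cM f f' : cont f -> cont f' -> cont (fun x => f x * f' x) by exact: cvgM.
have cJ i' s : cont (fun x => jet g x.1.1 i' s).
  have c11 : {for x, continuous (fun x : T3 * R * R => x.1.1)}.
    apply: (@continuous_comp _ _ _ fst fst); exact: cvg_fst.
  have cj : {for x.1.1, continuous (fun p => jet g p i' s)}.
    exact: smooth_continuous (jet_smooth i' s sg) I.
  exact: (continuous_comp c11 cj).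
have cm : cont (fun x => x.1.2).
  by apply: (@continuous_comp _ _ _ fst snd); [exact: cvg_fst|exact: cvg_snd].
have cn : cont (fun x => x.2) by exact: cvg_snd.
have cL s : cont (fun x => jet g x.1.1 i s + x.1.2 * jet g x.1.1 (~~ i) s).
  by apply: (cD _ _ (cJ _ _)); exact: (cM _ _ cm (cJ _ _)).
case: r => [|[|[|[|[|r]]]]] /=.
- exact: cJ.
- exact: cJ.
- exact: cL.
- exact: cL.
- case: (b); first exact: (cD _ _ (cL _) (cM _ _ cn (cL _))).
  exact: (cD _ _ (cJ _ _) (cM _ _ cn (cJ _ _))).
- case: (b); first exact: (cD _ _ (cL _) (cM _ _ cn (cL _))).
  exact: (cD _ _ (cD _ _ (cL _) (cM _ _ cn (cL _)))
    (cD _ _ (cM _ _ cn (cL _)) (cM _ _ cn (cM _ _ cn (cL _))))).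
Qed.

Lemma sum6_eq0 (e : nat -> R) : (forall r, 0 <= e r) ->
  e 0%N + e 1%N + e 2%N + e 3%N + e 4%N + e 5%N = 0 -> forall r, (r < 6)%N -> e r = 0.
Proof.
move=> e0 S; move: (e0 0%N) (e0 1%N) (e0 2%N) (e0 3%N) (e0 4%N) (e0 5%N).
by move=> h0 h1 h2 h3 h4 h5 [|[|[|[|[|[|]]]]]] // _; lra.
Qed.

Lemma sum6_le (e : nat -> R) (y : R) : (forall r, (r < 6)%N -> e r <= y) ->
  e 0%N + e 1%N + e 2%N + e 3%N + e 4%N + e 5%N <= 6 * y.
Proof.
move=> ey; have := (ey 0%N isT, ey 1%N isT, ey 2%N isT, (ey 3%N isT, ey 4%N isT, ey 5%N isT)).
move: (e 0%N) (e 1%N) (e 2%N) (e 3%N) (e 4%N) (e 5%N) => x0 x1 x2 x3 x4 x5.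
by move=> [[[h0 h1] h2] [[h3 h4] h5]]; lra.
Qed.

(** On the compact set of data the six equations have no common zero, so the sum of
    their absolute values has a positive minimum; it stays positive when the
    derivatives of order at most two are moved slightly. *)
Lemma nondegenerate_open N b i j : open (nondegenerate_on N b i j).
Proof.
suff : whitney_open (nondegenerate_on N b i j) by [].
move=> Psi HPsi; have sP := smooth_valP Psi.
pose K : set (T3 * R * R) := ([set p | `|p - 0| <= N%:R] `*` [set m | `|m - 0| <= 1])
  `*` [set n | `|n - 0| <= 1].
have cK : compact K.
  apply: compact_setX; first apply: compact_setX.
  - exact: compact_cball3.
  - exact: compact_cball1.
  - exact: compact_cball1.
have K0 : K (0, 0, 0) by rewrite /K /= !subrr !normr0.
pose E r (x : T3 * R * R) := degeneracy b i j (jet Psi x.1.1) x.1.2 x.2 r.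
pose beta x := `|E 0%N x| + `|E 1%N x| + `|E 2%N x| + `|E 3%N x| + `|E 4%N x| + `|E 5%N x|.
have cE r x : {for x, continuous (fun x => `|E r x|)}.
  by apply: cvg_norm; exact: degeneracy_continuous sP _.
have cbeta x : K x -> {for x, continuous beta}.
  by move=> _; do 5! (apply: cvgD; last exact: cE); exact: cE.
have [x Kx Hx] := compact_min cK (ex_intro _ _ K0) cbeta.
have b0 : 0 < beta x.
  have nn r : 0 <= `|E r x| by [].
  rewrite lt_neqAle !addr_ge0 // andbT eq_sym; apply/negP => /eqP bx.
  case: Kx => [[/= k1 k2] k3]; rewrite subr0 in k1; rewrite subr0 in k2; rewrite subr0 in k3.
  apply: (HPsi x.1.1 x.1.2 x.2 k1 k2 k3) => r r6; apply/eqP; rewrite -normr_eq0.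
  by apply/eqP; exact: (sum6_eq0 nn bx).
exists 2%N, (fun=> beta x / 96); split.
- by move=> p; exact: cvg_cst.
- by move=> p; rewrite divr_gt0.
move=> g Hg p m n pN m1 n1 Hdeg.
have Kp : K (p, m, n) by rewrite /K /= !subr0.
have jd i' s : (size s <= 2)%N -> `|jet Psi p i' s - jet g p i' s| <= beta x / 96.
  move=> s2; apply: (le_trans (normB_part _ _ _)); rewrite distrC; apply: ltW.
  by apply: Hg; [rewrite size_map|exact: dir_basis].
have Er r : (r < 6)%N -> `|E r (p, m, n)| <= 8 * (beta x / 96).
  move=> r6; have := degeneracy_le b i j r m1 n1 jd.
  by rewrite degeneracyB Hdeg // subr0.
have h1 := Hx _ Kp; have h2 := sum6_le (e := fun r => `|E r (p, m, n)|) Er.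
have h3 : beta x <= 6 * (8 * (beta x / 96)) := le_trans h1 h2.
have : 0 < beta x by [].
clear -h3; move: (beta x) h3 => y h3 y0; lra.
Qed.

End Degeneracy.

(** * Quadratic perturbations *)

Section Quadratic.
Context {R : realType}.
Notation C := (R * R)%type.
Notation T3 := (R * R * R)%type.

Definition co (j : bool) (p : T3) : R := if j then p.1.2 else p.1.1.

(** Quadratic polynomials in the spatial coordinates, without the square of the
    second one: enough to move the equations of [degeneracy] independently. *)
Definition quad (j : bool) (b0 b1 b2 b3 b4 : R) (p : T3) : R :=
  b0 + b1 * co j p + b2 * co (~~ j) p +
  (b3 / 2 * (co j p * co j p) + b4 * (co j p * co (~~ j) p)).

Lemma co_smooth j : smooth_on setT (co j).
Proof. by case: j => k; [exact: Ck_y openT|exact: Ck_x openT]. Qed.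

Lemma co_dir j j' : co j (dir j') = (j == j')%:R.
Proof. by case: j; case: j'. Qed.

Lemma derive_co j p v : 'D_v (co j) p = co j v.
Proof.
have d1 : differentiable (fun p : T3 => p.1) p by exact: differentiable_fst.
have D1 : 'D_v (fun p : T3 => p.1) p = v.1.
  rewrite deriveE // (_ : (fun p : T3 => p.1) = fst) //.
  by rewrite diff_lin //; exact: continuous_fst_lin.
case: j.
- by rewrite /co (derive_snd v d1) D1.
- by rewrite /co (derive_fst v d1) D1.
Qed.

Lemma quad_smooth j b0 b1 b2 b3 b4 : smooth_on setT (quad j b0 b1 b2 b3 b4).
Proof.
move=> k; have cc (b : R) := Ck_cst (V := T3) setT k b.
have c1 := co_smooth j k; have c2 := co_smooth (~~ j) k.
have M (f g : T3 -> R) : Ck_on setT k f -> Ck_on setT k g ->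
  Ck_on setT k (fun p => f p * g p) by move=> h h'; exact: (CkM openT h h').
exact: (CkD openT (CkD openT (CkD openT (cc b0) (M _ _ (cc b1) c1)) (M _ _ (cc b2) c2))
  (CkD openT (M _ _ (cc (b3 / 2)) (M _ _ c1 c1)) (M _ _ (cc b4) (M _ _ c1 c2)))).
Qed.

Lemma derive_quad j b0 b1 b2 b3 b4 v :
  'D_v (quad j b0 b1 b2 b3 b4) =
  quad j (b1 * co j v + b2 * co (~~ j) v) (b3 * co j v + b4 * co (~~ j) v) (b4 * co j v) 0 0.
Proof.
apply/funext => p.
have dc i : differentiable (co i) p by exact: Ck_differentiable (co_smooth i) I.
have dM (f g : T3 -> R) : differentiable f p -> differentiable g p ->
  differentiable (fun p => f p * g p) p by exact: differentiableM.
have dD (f g : T3 -> R) : differentiable f p -> differentiable g p ->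
  differentiable (fun p => f p + g p) p by exact: differentiableD.
have dk (b : R) : differentiable (fun _ : T3 => b) p by exact: differentiable_cst.
have DD (f g : T3 -> R) : differentiable f p -> differentiable g p ->
    'D_v (fun p => f p + g p) p = 'D_v f p + 'D_v g p.
  by move=> df dg; apply: deriveD; exact: diff_derivable.
have DM (f g : T3 -> R) : differentiable f p -> differentiable g p ->
    'D_v (fun p => f p * g p) p = 'D_v f p * g p + f p * 'D_v g p.
  move=> df dg; rewrite (_ : (fun p => f p * g p) = f * g) //.
  rewrite deriveM; try exact: diff_derivable.
  by rewrite addrC /GRing.scale /= [g p * _]mulrC.
have Dk (b : R) : 'D_v (fun _ : T3 => b) p = 0 by exact: derive_cst.
have DZ (b : R) (f : T3 -> R) : differentiable f p ->
    'D_v (fun p => b * f p) p = b * 'D_v f p.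
  by move=> df; rewrite DM // Dk mul0r add0r.
have dZ (b : R) (f : T3 -> R) : differentiable f p ->
    differentiable (fun p => b * f p) p by move=> df; exact: dM.
have d1 := dZ b1 _ (dc j); have d2 := dZ b2 _ (dc (~~ j)).
have d3 := dZ (b3 / 2) _ (dM _ _ (dc j) (dc j)).
have d4 := dZ b4 _ (dM _ _ (dc j) (dc (~~ j))).
rewrite /quad (DD _ _ (dD _ _ (dD _ _ (dk b0) d1) d2) (dD _ _ d3 d4)).
rewrite (DD _ _ (dD _ _ (dk b0) d1) d2) (DD _ _ (dk b0) d1) (DD _ _ d3 d4).
rewrite (DZ _ _ (dc j)) (DZ _ _ (dc (~~ j))) (DZ _ _ (dM _ _ (dc j) (dc j))).
rewrite (DZ _ _ (dM _ _ (dc j) (dc (~~ j)))).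
rewrite (DM _ _ (dc j) (dc j)) (DM _ _ (dc j) (dc (~~ j))) Dk !derive_co.
move: (co j p) (co (~~ j) p) (co j v) (co (~~ j) v) => x y s t.
by field.
Qed.

Lemma iter_quad1 j b0 b1 b2 b3 b4 v p :
  iter_derive (map dir [:: v]) (quad j b0 b1 b2 b3 b4) p =
  quad j (b1 * (j == v)%:R + b2 * (~~ j == v)%:R)
    (b3 * (j == v)%:R + b4 * (~~ j == v)%:R) (b4 * (j == v)%:R) 0 0 p.
Proof.
have := congr1 (fun f => f p) (derive_quad j b0 b1 b2 b3 b4 (dir v)).
by rewrite !co_dir.
Qed.

Lemma iter_quad2 j b0 b1 b2 b3 b4 w v p :
  iter_derive (map dir [:: w; v]) (quad j b0 b1 b2 b3 b4) p =
  (b3 * (j == v)%:R + b4 * (~~ j == v)%:R) * (j == w)%:R +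
  b4 * (j == v)%:R * (~~ j == w)%:R.
Proof.
have E : iter_derive (map dir [:: v]) (quad j b0 b1 b2 b3 b4) =
  quad j (b1 * (j == v)%:R + b2 * (~~ j == v)%:R)
    (b3 * (j == v)%:R + b4 * (~~ j == v)%:R) (b4 * (j == v)%:R) 0 0.
  by apply/funext => q; exact: iter_quad1.
rewrite -[LHS]/(iter_derive (map dir [:: w])
  (iter_derive (map dir [:: v]) (quad j b0 b1 b2 b3 b4)) p) E iter_quad1 /quad.
by rewrite !(mul0r, addr0).
Qed.

Definition pair_at (i : bool) (u w : R) : C := if i then (w, u) else (u, w).

Lemma part_pair_at i u w : part i (pair_at i u w) = u /\ part (~~ i) (pair_at i u w) = w.
Proof. by case: i. Qed.

Definition quad_map (i j : bool) (b : nat -> R) (p : T3) : C :=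
  pair_at i (quad j (b 0%N) (b 1%N) (b 2%N) (b 3%N) (b 4%N) p)
         (quad j (b 5%N) (b 6%N) 0 0 0 p).

Lemma quad_map_smooth i j b : smooth_on setT (quad_map i j b).
Proof.
move=> k; case: i; apply: (Ck_pair openT); exact: quad_smooth.
Qed.

Lemma quad_map_sum i j b p : quad_map i j b p =
  \sum_(q < 7) b q *: quad_map i j (fun q' => (q' == q)%:R) p.
Proof.
rewrite !big_ord_recl big_ord0 /=.
apply: pair_ext; case: i; rewrite /quad_map /pair_at /quad /= /GRing.scale /=;
  by field.
Qed.

Lemma jet_quad_map i j b p s :
  jet (quad_map i j b) p i s =
    iter_derive (map dir s) (quad j (b 0%N) (b 1%N) (b 2%N) (b 3%N) (b 4%N)) p /\
  jet (quad_map i j b) p (~~ i) s =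
    iter_derive (map dir s) (quad j (b 5%N) (b 6%N) 0 0 0) p.
Proof.
rewrite /jet !part_iter; try exact: quad_map_smooth.
split; congr (iter_derive _ _ p); apply/funext => q; rewrite /quad_map;
  by case: (part_pair_at i (quad j (b 0%N) (b 1%N) (b 2%N) (b 3%N) (b 4%N) q)
         (quad j (b 5%N) (b 6%N) 0 0 0 q)).
Qed.

(** The parameter [a r] is attached to the coefficient that equation [r] of
    [degeneracy] contains with the factor one. *)
Definition coeffs (b : bool) (a : nat -> R) (q : nat) : R :=
  match q with
  | 0 => a 0%N | 1 => a 2%N | 2 => a 3%N
  | 3 => if b then a 4%N else a 5%N
  | 4 => if b then a 5%N else 0
  | 5 => a 1%N
  | _ => if b then 0 else a 4%N
  end.

(** Equation [r] is [a r] plus terms in parameters that are determined by other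
    equations: the system is triangular and can be solved for [a]. *)
Lemma degeneracy_quad (b i j : bool) (a : nat -> R) p m n :
  let X := co j p in let Y := co (~~ j) p in
  let E := degeneracy b i j (jet (quad_map i j (coeffs b a)) p) m n in
  if b then
    [/\ E 5%N = a 5%N, E 4%N = a 4%N + n * a 5%N, E 3%N = a 3%N + a 5%N * X &
        [/\ E 2%N = a 2%N + (a 4%N * X + a 5%N * Y), E 1%N = a 1%N &
            E 0%N = a 0%N + (a 2%N * X + a 3%N * Y + (a 4%N / 2 * (X * X) + a 5%N * (X * Y)))]]
  else
    [/\ E 5%N = a 5%N, E 4%N = a 4%N, E 3%N = a 3%N &
        [/\ E 2%N = a 2%N + (a 5%N * X + m * a 4%N), E 1%N = a 1%N + a 4%N * X &
            E 0%N = a 0%N + (a 2%N * X + a 3%N * Y + a 5%N / 2 * (X * X))]].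
Proof.
move=> X Y E.
have J s := jet_quad_map i j (coeffs b a) p s.
have Ji s : jet (quad_map i j (coeffs b a)) p i s = _ := (J s).1.
have Jn s : jet (quad_map i j (coeffs b a)) p (~~ i) s = _ := (J s).2.
have jn : (j == ~~ j) = false by case: (j).
have nj : (~~ j == j) = false by case: (j).
rewrite /E /degeneracy !Ji !Jn !iter_quad2 !iter_quad1 !eqxx jn nj /=.
rewrite /quad -/X -/Y /coeffs; clearbody X Y.
by case: (b) => /=; do 2! (split; try by field).
Qed.

End Quadratic.

(** * Small perturbations in the Whitney topology *)

Section SmallPerturbation.
Context {R : realType}.
Notation C := (R * R)%type.
Notation T3 := (R * R * R)%type.

Lemma open_outside (rho : R) : open [set p : T3 | rho < `|p|].
Proof.
rewrite openE => p /= rp; apply: (@radius_near R T3 p [set q | rho < `|q|] (`|p| - rho)).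
  by rewrite subr_gt0.
move=> z zp /=; have : `|p| <= `|z| + `|z - p|.
  by rewrite -{1}(subKr z p) ler_normB.
by move: zp; lra.
Qed.

Lemma derive_outside (H : T3 -> C) (rho : R) v : (forall p, rho < `|p| -> H p = 0) ->
  forall p, rho < `|p| -> 'D_v H p = 0.
Proof.
move=> H0 p rp.
have nE : \forall z \near p, H z = cst 0 z.
  have np : \forall z \near p, rho < `|z|.
    have op : open_nbhs p [set q : T3 | rho < `|q|] by split; [exact: open_outside|].
    by have := open_nbhs_nbhs op.
  by apply: filterS np => z /H0.
by rewrite (near_eq_derive v nE) derive_cst.
Qed.

Lemma iter_outside (H : T3 -> C) (rho : R) s : (forall p, rho < `|p| -> H p = 0) ->
  forall p, rho < `|p| -> iter_derive s H p = 0.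
Proof. by move=> H0; elim: s => //= v s; exact: derive_outside. Qed.

Lemma bound_outside (H : T3 -> C) (rho : R) : smooth_on setT H ->
  (forall p, rho < `|p| -> H p = 0) -> exists2 M : R, 0 < M & forall p, `|H p| <= M.
Proof.
move=> sH H0.
have [p _|M M0 HM] := @compact_ubound _ _ _ (fun p => `|H p|) (@compact_cball3 R 0 rho).
  by apply: cvg_norm; exact: smooth_continuous sH I.
exists M => // p; have [rp|rp] := ltP rho `|p|; first by rewrite H0 // normr0 ltW.
by have := HM p; rewrite /= subr0 normr_id; exact.
Qed.

Lemma iter_bound (k : nat) (H : T3 -> C) (rho : R) : smooth_on setT H ->
  (forall p, rho < `|p| -> H p = 0) ->
  exists2 M : R, 0 < M & forall p s, (size s <= k)%N -> {subset s <= @basis3 R} ->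
    `|iter_derive s H p| <= M.
Proof.
elim: k H => [|k IH] H sH H0; have [M M0 HM] := bound_outside sH H0.
  by exists M => // p [].
have HD v := IH _ (smooth_derive v sH) (derive_outside v H0).
have [M1 M10 H1] := HD (1, 0, 0); have [M2 M20 H2] := HD (0, 1, 0).
have [M3 M30 H3] := HD (0, 0, 1).
exists (M + M1 + M2 + M3); first by rewrite !addr_gt0.
move=> p; case/lastP => [_ _|s v].
  by apply: (le_trans (HM p)); rewrite -!addrA lerDl !addr_ge0 // ltW.
rewrite size_rcons ltnS => sk sb.
have ss : {subset s <= @basis3 R} by move=> w ws; apply: sb; rewrite mem_rcons inE ws orbT.
have vb : v \in @basis3 R by apply: sb; rewrite mem_rcons inE eqxx.
have -> : iter_derive (rcons s v) H p = iter_derive s ('D_v H) p.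
  by rewrite /iter_derive -cats1 foldr_cat.
move: vb; rewrite !inE => /or3P[/eqP ->|/eqP ->|/eqP ->].
- by apply: (le_trans (H1 p s sk ss)); lra.
- by apply: (le_trans (H2 p s sk ss)); lra.
- by apply: (le_trans (H3 p s sk ss)); lra.
Qed.

Variables (f : T3 -> C) (H : nat -> T3 -> C).
Hypotheses (sf : smooth_on setT f) (sH : forall q, smooth_on setT (H q)).

Definition perturb (n : nat) (b : nat -> R) (p : T3) : C :=
  f p + \sum_(q < n) b q *: H q p.

Lemma perturb0 b : perturb 0 b = f.
Proof. by apply/funext => p; rewrite /perturb big_ord0 addr0. Qed.

Lemma perturbS n b : perturb n.+1 b = (fun p => perturb n b p + b n *: H n p).
Proof. by apply/funext => p; rewrite /perturb big_ord_recr /= addrA. Qed.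

Lemma perturb_smooth n b : smooth_on setT (perturb n b).
Proof.
elim: n => [|n IH]; first by rewrite perturb0.
by rewrite perturbS; apply: smoothD => //; exact: smoothZ.
Qed.

Lemma iter_perturb n b s p :
  iter_derive s (perturb n b) p = iter_derive s f p + \sum_(q < n) b q *: iter_derive s (H q) p.
Proof.
elim: n => [|n IH]; first by rewrite perturb0 big_ord0 addr0.
rewrite perturbS iter_derive_lin //; last exact: perturb_smooth.
by rewrite IH big_ord_recr /= addrA.
Qed.

(** A function [eps] that decays at infinity is harmless: the perturbation vanishes
    outside a ball, where [eps] has a positive minimum. *)
Lemma perturb_small n (rho : R) (k : nat) (eps : T3 -> R) :
  0 < rho -> (forall q p, rho < `|p| -> H q p = 0) ->
  continuous eps -> (forall p, 0 < eps p) ->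
  exists2 d : R, 0 < d & forall b, (forall q, `|b q| <= d) ->
    forall p s, (size s <= k)%N -> {subset s <= @basis3 R} ->
    `|iter_derive s (perturb n b) p - iter_derive s f p| < eps p.
Proof.
move=> rho0 H0 ceps eps0.
have /choice [M HM] : forall q, exists M : R, 0 < M /\ forall p s,
    (size s <= k)%N -> {subset s <= @basis3 R} -> `|iter_derive s (H q) p| <= M.
  by move=> q; have [M M0 HM] := iter_bound k (sH q) (H0 q); exists M.
have [|c _ Hc] := compact_min (@compact_cball3 R 0 rho) (f := eps) _ (fun p _ => ceps p).
  by exists 0; rewrite /= subrr normr0 ltW.
pose S := \sum_(q < n) M q.
have S0 : 0 <= S by apply: sumr_ge0 => q _; apply: ltW; exact: (HM q).1.
exists (eps c / (S + 1)); first by rewrite divr_gt0 // ltr_wpDl.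
move=> b bd p s sk sb; rewrite iter_perturb addrAC subrr add0r.
have [rp|rp] := ltP rho `|p|.
  rewrite big1 ?normr0 // => q _.
  by rewrite (iter_outside s (H0 q) rp) scaler0.
apply: (@lt_le_trans _ _ (eps c)); last by apply: Hc; rewrite /= subr0.
apply: (@le_lt_trans _ _ (eps c / (S + 1) * S)).
  rewrite /S mulr_sumr; apply: (le_trans (ler_norm_sum _ _ _)); apply: ler_sum => q _.
  by rewrite normrZ; apply: ler_pM => //; exact: (HM q).2.
rewrite mulrAC ltr_pdivrMr ?ltr_wpDl // ltr_pM2l // ltrDl.
exact: ltr01.
Qed.

End SmallPerturbation.

(** * Density of nondegenerate functions *)

Section Density.
Context {R : realType}.
Notation C := (R * R)%type.
Notation T3 := (R * R * R)%type.
Variables (b i j : bool) (f : T3 -> C).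
Hypothesis sf : smooth_on setT f.

Definition point3 (c : nat -> R) : T3 := (c 0%N, c 1%N, c 2%N).

Let E r (c : nat -> R) := degeneracy b i j (jet f (point3 c)) (c 3%N) (c 4%N) r.
Let X c := co j (point3 c).
Let Y c := co (~~ j) (point3 c).

Let s5 c := - E 5%N c.
Let s4 c := if b then - (E 4%N c + c 4%N * s5 c) else - E 4%N c.
Let s3 c := if b then - (E 3%N c + s5 c * X c) else - E 3%N c.
Let s2 c := if b then - (E 2%N c + (s4 c * X c + s5 c * Y c))
            else - (E 2%N c + (s5 c * X c + c 3%N * s4 c)).
Let s1 c := if b then - E 1%N c else - (E 1%N c + s4 c * X c).
Let s0 c := if b then
    - (E 0%N c + (s2 c * X c + s3 c * Y c +
        (s4 c * 2^-1 * (X c * X c) + s5 c * (X c * Y c))))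
  else - (E 0%N c + (s2 c * X c + s3 c * Y c + s5 c * 2^-1 * (X c * X c))).

(** The parameters [a] for which the perturbed map is degenerate at the point with
    coordinates [c 0], [c 1], [c 2] and at the chart values [c 3], [c 4]; solved from
    the last equation to the first. *)
Definition solution (c : nat -> R) (r : nat) : R :=
  match r with
  | 0 => s0 c | 1 => s1 c | 2 => s2 c | 3 => s3 c | 4 => s4 c | _ => s5 c
  end.

Lemma solutionP (a c : nat -> R) :
  (forall r, (r < 6)%N ->
     E r c + degeneracy b i j (jet (quad_map i j (coeffs b a)) (point3 c)) (c 3%N) (c 4%N) r = 0) ->
  forall r, (r < 6)%N -> solution c r = a r.
Proof.
move=> H; have := degeneracy_quad b i j a (point3 c) (c 3%N) (c 4%N); cbv zeta.
rewrite -/(X c) -/(Y c); move: H.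
set G : nat -> R := degeneracy b i j (jet (quad_map i j (coeffs b a)) (point3 c)) (c 3%N) (c 4%N).
move=> H.
have e r q : (r < 6)%N -> G r = q -> - E r c = q.
  by move=> r6 <-; apply/eqP; rewrite eq_sym -addr_eq0 addrC H.
clearbody G.
case bE : b => -[/(e 5%N _ isT) v5 /(e 4%N _ isT) e4 /(e 3%N _ isT) e3
    [/(e 2%N _ isT) e2 /(e 1%N _ isT) e1 /(e 0%N _ isT) e0]].
- have {}v5 : s5 c = a 5%N by [].
  have v4 : s4 c = a 4%N by rewrite /s4 bE v5 opprD e4 addrK.
  have v3 : s3 c = a 3%N by rewrite /s3 bE v5 opprD e3 addrK.
  have v2 : s2 c = a 2%N by rewrite /s2 bE v4 v5 opprD e2 addrK.
  have v1 : s1 c = a 1%N by rewrite /s1 bE.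
  have v0 : s0 c = a 0%N by rewrite /s0 bE v2 v3 v4 v5 opprD e0 addrK.
  by move=> [|[|[|[|[|[|]]]]]].
- have {}v5 : s5 c = a 5%N by [].
  have v4 : s4 c = a 4%N by rewrite /s4 bE.
  have v3 : s3 c = a 3%N by rewrite /s3 bE.
  have v2 : s2 c = a 2%N by rewrite /s2 bE v4 v5 opprD e2 addrK.
  have v1 : s1 c = a 1%N by rewrite /s1 bE v4 opprD e1 addrK.
  have v0 : s0 c = a 0%N by rewrite /s0 bE v2 v3 v5 opprD e0 addrK.
  by move=> [|[|[|[|[|[|]]]]]].
Qed.

Variable r : R.
Notation BL := (bounded_lipschitz 5 r).

Let bl_jet i' s : BL (fun c => jet f (point3 c) i' s).
Proof. exact: (bl_smooth (n := 5) r isT (jet_smooth i' s sf)). Qed.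

Let bl_E q : BL (E q).
Proof.
have b3 := bl_coord (n := 5) r (i := 3) isT; have b4 := bl_coord (n := 5) r (i := 4) isT.
have L s : BL (fun c => jet f (point3 c) i s + c 3%N * jet f (point3 c) (~~ i) s).
  exact: bl_add (bl_jet _ _) (bl_mul b3 (bl_jet _ _)).
rewrite /E; case: q => [|[|[|[|[|q]]]]] /=.
- exact: bl_jet.
- exact: bl_jet.
- exact: L.
- exact: L.
- case: (b); first exact: bl_add (L _) (bl_mul b4 (L _)).
  exact: bl_add (bl_jet _ _) (bl_mul b4 (bl_jet _ _)).
- case: (b); first exact: bl_add (L _) (bl_mul b4 (L _)).
  exact: bl_add (bl_add (L _) (bl_mul b4 (L _)))
    (bl_add (bl_mul b4 (L _)) (bl_mul b4 (bl_mul b4 (L _)))).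
Qed.

Lemma bl_solution q : BL (solution ^~ q).
Proof.
have b3 := bl_coord (n := 5) r (i := 3) isT; have b4 := bl_coord (n := 5) r (i := 4) isT.
have bX : BL X by exact: (bl_smooth (n := 5) r isT (co_smooth j)).
have bY : BL Y by exact: (bl_smooth (n := 5) r isT (co_smooth (~~ j))).
have b5 : BL s5 by exact: bl_opp (bl_E 5).
have bs4 : BL s4.
  rewrite /s4; case: (b); last exact: bl_opp (bl_E 4).
  exact: bl_opp (bl_add (bl_E 4) (bl_mul b4 b5)).
have bs3 : BL s3.
  rewrite /s3; case: (b); last exact: bl_opp (bl_E 3).
  exact: bl_opp (bl_add (bl_E 3) (bl_mul b5 bX)).
have bs2 : BL s2.
  rewrite /s2; case: (b).
    exact: bl_opp (bl_add (bl_E 2) (bl_add (bl_mul bs4 bX) (bl_mul b5 bY))).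
  exact: bl_opp (bl_add (bl_E 2) (bl_add (bl_mul b5 bX) (bl_mul b3 bs4))).
have bs1 : BL s1.
  rewrite /s1; case: (b); first exact: bl_opp (bl_E 1).
  exact: bl_opp (bl_add (bl_E 1) (bl_mul bs4 bX)).
have bh := bl_cst 5 r 2^-1.
case: q => [|[|[|[|[|q]]]]] //=.
rewrite /s0; case: (b).
  exact: bl_opp (bl_add (bl_E 0) (bl_add (bl_add (bl_mul bs2 bX) (bl_mul bs3 bY))
    (bl_add (bl_mul (bl_mul bs4 bh) (bl_mul bX bX)) (bl_mul b5 (bl_mul bX bY))))).
exact: bl_opp (bl_add (bl_E 0) (bl_add (bl_add (bl_mul bs2 bX) (bl_mul bs3 bY))
    (bl_mul (bl_mul b5 bh) (bl_mul bX bX)))).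
Qed.

Lemma generic_coefficients (e : R) : 0 < r -> 0 < e ->
  exists2 a : nat -> R, (forall q, `|a q| <= e) &
    forall c, (forall k, (k < 5)%N -> `|c k| <= r) ->
      ~ (forall q, (q < 6)%N -> solution c q = a q).
Proof.
move=> r0 e0.
have /choice [L' HL'] : forall q, exists M : R, 0 < M /\
  forall c c', in_cube 5 r c -> in_cube 5 r c' -> forall d : R, 0 <= d ->
     (forall k, (k < 5)%N -> `|c k - c' k| <= d) -> `|solution c q - solution c' q| <= M * d.
  by move=> q; have [M M0 [_ HM]] := bl_solution q; exists M.
pose S := \sum_(q < 6) L' q.
have LS q : (q < 6)%N -> L' q <= S.
  move=> q6; rewrite /S (bigD1 (Ordinal q6)) //= lerDl sumr_ge0 // => k _.
  exact/ltW/(HL' k).1.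
have S0 : 0 < S by exact: lt_le_trans (HL' 0%N).1 (LS 0%N isT).
apply: (lipschitz_cube_not_onto r0 S0 e0) => c c' cr cr' d d0 cd q q6.
apply: (le_trans ((HL' q).2 c c' cr cr' d d0 cd)).
by apply: ler_wpM2r => //; exact: LS.
Qed.

End Density.

Section Generic.
Context {R : realType}.
Notation C := (R * R)%type.
Notation T3 := (R * R * R)%type.

(** The perturbation by [chi] times a quadratic polynomial is degenerate somewhere
    in the ball only if its parameters are in the image of [solution], a Lipschitz
    map from five to six dimensions; arbitrarily small parameters avoid this image. *)
Lemma nondegenerate_dense N b i j : dense (nondegenerate_on (R := R) N b i j).
Proof.
move=> O [f Of] oO.
have wO : whitney_open O by [].
have [k [eps [ceps eps0 HO]]] := wO f Of.
have sf := smooth_valP f.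
have r0 : 0 < N%:R + 1 :> R by rewrite ltr_wpDl.
have [chi schi [rho rho0 [chi1 chi0]]] := bump_function r0.
pose H (q : nat) (p : T3) : C := chi p *: quad_map i j (fun q' => (q' == q)%:R) p.
have sH q : smooth_on setT (H q).
  have sQ := quad_map_smooth i j (fun q' => (q' == q)%:R : R).
  move=> n.
  have h1 := CkM openT (schi n) (Ck_fst openT (sQ n)).
  have h2 := CkM openT (schi n) (Ck_snd openT (sQ n)).
  exact: (Ck_pair openT h1 h2).
have H0 q p : rho < `|p| -> H q p = 0 by move=> /chi0 cp; rewrite /H cp scale0r.
have [d d0 Hd] := perturb_small sf sH 7 k rho0 H0 ceps eps0.
have [a ad Ha] := generic_coefficients b i j sf r0 d0.
pose g := perturb f H 7 (coeffs b a).
have sg : smooth_on setT g by exact: perturb_smooth.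
exists (SmoothFun sg); split.
  apply: HO => p s sk sb; apply: Hd => // q.
  have ed : `|0 : R| <= d by rewrite normr0 ltW.
  by case: q => [|[|[|[|[|[|q]]]]]] //=; case: (b).
move=> p m n pN m1 n1 Hdeg.
pose c (k : nat) : R := nth 0 [:: p.1.1; p.1.2; p.2; m; n] k.
have pc : point3 c = p by rewrite /point3 /c /= -!surjective_pairing.
have cr k' : (k' < 5)%N -> `|c k'| <= N%:R + 1.
  have N1 (x : R) : `|x| <= N%:R -> `|x| <= N%:R + 1.
    by move=> h; apply: (le_trans h); rewrite lerDl.
  have I1 (x : R) : `|x| <= 1 -> `|x| <= N%:R + 1.
    by move=> h; apply: (le_trans h); rewrite lerDr.
  move: pN; rewrite !norm_pair_le => /andP[/andP[h1 h2] h3].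
  by case: k' => [|[|[|[|[|]]]]] //= _; [exact: N1|exact: N1|exact: N1|exact: I1|exact: I1].
apply: (Ha c cr); apply: solutionP => q q6.
rewrite pc -[X in X + _]/(degeneracy b i j (jet f p) m n q).
rewrite -[X in _ + X]/(degeneracy b i j (jet (quad_map i j (coeffs b a)) p) m n q).
rewrite -degeneracyD -[RHS](Hdeg q q6); congr (degeneracy b i j _ m n q).
apply/funext => i'; apply/funext => s.
have pin : `|p| < N%:R + 1 by rewrite (le_lt_trans pN) // ltrDl.
pose O1 := [set p : T3 | `|p| < N%:R + 1].
have oO1 : open O1.
  rewrite (_ : O1 = [set z : T3 | `|z - 0| < N%:R + 1]); first exact: open_oball.
  by apply/seteqP; split => z; rewrite /O1 /= subr0.
have gE z : O1 z -> g z = f z + 1 *: quad_map i j (coeffs b a) z.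
  move=> /chi1 c1; rewrite /g /perturb scale1r (quad_map_sum i j (coeffs b a)).
  by congr (_ + _); apply: eq_bigr => q' _; rewrite /H c1 scale1r.
rewrite /jet /= (iter_derive_local (map dir s) oO1 gE pin).
rewrite iter_derive_lin //; last exact: quad_map_smooth.
by rewrite scale1r; case: (i').
Qed.

End Generic.

(** * Classification of generic phase singularities *)

Section Charts.
Context {R : realType}.

(** A kernel vector of a linear form, scaled so that its coordinate of larger
    absolute value is one. *)
Lemma kernel_chart (al : bool -> R) :
  exists j n, `|n| <= 1 /\ al j + n * al (~~ j) = 0.
Proof.
have key j : `|al j| <= `|al (~~ j)| -> exists n, `|n| <= 1 /\ al j + n * al (~~ j) = 0.
  move=> le; have [z|nz] := eqVneq (al (~~ j)) 0.
    exists 0; rewrite normr0 ler01 mul0r addr0; split=> //.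
    by move: le; rewrite z normr0 normr_le0 => /eqP.
  exists (- al j / al (~~ j)); split; last by rewrite divfK // subrr.
  by rewrite normrM normfV normrN ler_pdivrMr ?normr_gt0 // mul1r.
have [le|/ltW le] := leP `|al true| `|al false|.
  by have [n] := key true le; exists true, n.
by have [n] := key false le; exists false, n.
Qed.

(** A linear relation between the rows of a singular matrix, scaled likewise: if
    column [c] is nonzero the relation is determined by that column. *)
Lemma singular_chart (M : bool -> bool -> R) :
  M false false * M true true - M false true * M true false = 0 ->
  exists i m, `|m| <= 1 /\ forall j, M i j + m * M (~~ i) j = 0.
Proof.
move=> D0.
have key c : (exists i, M i c != 0) ->
    exists i m, `|m| <= 1 /\ forall j, M i j + m * M (~~ i) j = 0.
  move=> [i0 nz]; have [i [m [m1 E]]] := kernel_chart (fun i => M i c).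
  have nz' : M (~~ i) c != 0.
    apply: contra nz => /eqP Z; move: E; rewrite Z mulr0 addr0 => Z'.
    by have [->|->] : i0 = i \/ i0 = ~~ i; [case: (i0); case: (i); by [left|right]|rewrite Z'|rewrite Z].
  exists i, m; split=> // j.
  have [-> //|->] : j = c \/ j = ~~ c by case: (j); case: (c); by [left|right].
  apply: (mulIf nz'); rewrite mul0r.
  have E' : M i c = - (m * M (~~ i) c) by apply/eqP; rewrite -addr_eq0 E.
  have D' : M i c * M (~~ i) (~~ c) - M i (~~ c) * M (~~ i) c = 0.
    by move: D0; case: (i); case: (c) => /=; lra.
  rewrite E' in D'; rewrite mulrDl; apply/eqP; rewrite -oppr_eq0; apply/eqP.
  by rewrite -[RHS]D'; ring.
have [nz|z] := pselect (exists i, M i false != 0); first exact: key nz.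
have [nz'|z'] := pselect (exists i, M i true != 0); first exact: key nz'.
exists false, 0; rewrite normr0 ler01; split=> // j; rewrite mul0r addr0.
apply/eqP/negPn/negP => h; case: j h => h; [apply: z'|apply: z]; by exists false.
Qed.

End Charts.

Lemma derive_lin1 {R : realType} {V W : normedModType R} (g g' : V -> W) (c : R) u z :
  differentiable g z -> differentiable g' z ->
  'D_u (fun z => g z + c *: g' z) z = 'D_u g z + c *: 'D_u g' z.
Proof.
move=> dg dg'; rewrite (_ : (fun z => g z + c *: g' z) = g + c *: g') //.
rewrite deriveD; [|exact: diff_derivable|exact/diff_derivable/differentiableZ].
by rewrite deriveZ //; exact: diff_derivable.
Qed.

Section Linearity.
Context {R : realType} {V : lmodType R} (n : R) (P : V -> R).
Hypothesis Plin : forall x y, P (x + n *: y) = P x + n * P y.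

Lemma linear_eq0 z x y : z = x + n *: y -> P x = 0 -> P y = 0 -> P z = 0.
Proof. by move=> -> Px Py; rewrite Plin Px Py mulr0 addr0. Qed.

Lemma linear_expand2 x xj xn xjj xjn xnj xnn :
  x = xj + n *: xn -> xj = xjj + n *: xnj -> xn = xjn + n *: xnn ->
  P x = P xjj + n * P xjn + (n * P xnj + n * (n * P xnn)).
Proof. by move=> -> -> ->; rewrite !Plin; ring. Qed.

End Linearity.

Section Momentary.
Context {R : realType}.
Notation C := (R * R)%type.
Notation T3 := (R * R * R)%type.
Variables (Psi : T3 -> C) (t0 : R).
Hypothesis sPsi : smooth_on setT Psi.

Definition dir2 (j : bool) : C := if j then (0, 1) else (1, 0).

Lemma dirE j : dir j = (dir2 j, 0) :> T3.
Proof. by case: j. Qed.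

Let d_slice (z : C) : differentiable (fun z : C => (z, t0)) z.
Proof. by apply: differentiable_pair => //; exact: differentiable_cst. Qed.

Lemma derive_slice (W : normedModType R) (g : T3 -> W) (z v : C) : differentiable g (z, t0) ->
  'D_v (fun z : C => g (z, t0)) z = 'D_(v, 0) g (z, t0).
Proof.
move=> dg; rewrite (derive_chain v (d_slice z) dg); congr ('D_ _ g _).
by rewrite derive_pair // derive_id derive_cst.
Qed.

Lemma smooth_slice : smooth_on setT (fun z : C => Psi (z, t0)).
Proof.
move=> k; elim: k Psi sPsi => [|k IH] g sg.
  move=> z _; apply: differentiable_continuous.
  apply: (differentiable_comp (d_slice z)).
  exact: Ck_differentiable sg I.
split=> [z _|v].
  apply: (differentiable_comp (d_slice z)).
  exact: Ck_differentiable sg I.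
have := IH _ (smooth_derive ((v, 0) : T3) sg).
apply: Ck_ext openT _ => z _.
by rewrite derive_slice //; exact: Ck_differentiable sg I.
Qed.

Lemma iter_slice s z :
  iter_derive (map dir2 s) (fun z : C => Psi (z, t0)) z = iter_derive (map dir s) Psi (z, t0).
Proof.
elim: s z => [//|j s IH z].
rewrite [LHS]/= [RHS]/=.
have -> : iter_derive (map dir2 s) (fun z : C => Psi (z, t0)) =
    (fun z => iter_derive (map dir s) Psi (z, t0)) by apply/funext => y; rewrite IH.
rewrite derive_slice ?dirE //.
exact: Ck_differentiable (smooth_iter _ sPsi) I.
Qed.

End Momentary.

Section Classification.
Context {R : realType}.
Notation C := (R * R)%type.
Variables (f : C -> C) (z0 : C).
Hypotheses (sf : smooth_on setT f) (f0 : f z0 = 0).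

Variable F : bool -> seq bool -> R.
Hypothesis FE : forall i s, F i s = part i (iter_derive (map dir2 s) f z0).

Hypothesis nondeg : forall b i j m n, `|m| <= 1 -> `|n| <= 1 ->
  ~ forall r, (r < 6)%N -> degeneracy b i j F m n r = 0.

Let F0 i : F i [::] = 0.
Proof. by rewrite FE /= f0; case: i. Qed.

Let combine (g : C -> C) i m u z : smooth_on setT g ->
  'D_u (fun z => part i (g z) + m * part (~~ i) (g z)) z =
  part i ('D_u g z) + m * part (~~ i) ('D_u g z).
Proof.
move=> sg; have dg : differentiable g z by exact: Ck_differentiable sg I.
have dp i' : differentiable (fun z => part i' (g z)) z.
  case: i'; first exact: (differentiable_comp dg (differentiable_snd _)).
  exact: (differentiable_comp dg (differentiable_fst _)).
have Dp i' : 'D_u (fun z => part i' (g z)) z = part i' ('D_u g z).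
  by case: i'; [exact: derive_snd|exact: derive_fst].
have dm : differentiable (fun z => m * part (~~ i) (g z)) z.
  by apply: differentiableM => //; exact: differentiable_cst.
rewrite (_ : (fun z => _) = (fun z => part i (g z)) + (fun z => m * part (~~ i) (g z))) //.
rewrite deriveD; [|exact: diff_derivable|exact: diff_derivable].
rewrite Dp; congr (_ + _).
rewrite (_ : (fun z => _) = (m \*: (fun z => part (~~ i) (g z)))) //.
by rewrite deriveZ; [rewrite Dp|exact: diff_derivable].
Qed.

(** If the differential is singular, some combination [h] of the components is
    critical and some direction [v] is in the kernel of the other component [k].
    The differential cannot vanish: then one could choose [m] so that the second
    derivative of [h] in the first direction vanishes.  Hence [k] is a submersion,
    and the remaining conditions say that [h] has a nondegenerate Hessian, nonzero
    along [v]. *)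
Lemma classification :
  [\/ radially_equivalent f z0 psi_regular,
      radially_equivalent f z0 psi_hyperbolic |
      radially_equivalent f z0 psi_elliptic].
Proof.
have [J0|J0] := eqVneq (jacobian_det f z0) 0; last first.
  exact/Or31/regular_normal_form.
suff : radially_equivalent f z0 psi_hyperbolic \/ radially_equivalent f z0 psi_elliptic.
  by case; [apply: Or32|apply: Or33].
have J0' : F false [:: false] * F true [:: true] - F false [:: true] * F true [:: false] = 0.
  by rewrite !FE.
have [i [m [m1 L0]]] := @singular_chart R (fun i j => F i [:: j]) J0'.
have [j [n [n1 k0]]] := kernel_chart (fun j => F (~~ i) [:: j]).
(* The differential has rank one. *)
have kw : F (~~ i) [:: ~~ j] != 0.
  apply/eqP => Z; move: k0; rewrite Z mulr0 addr0 => Z'.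
  have Zn j' : F (~~ i) [:: j'] = 0 by move: Z Z'; case: (j); case: (j').
  have Zi j' : F i [:: j'] = 0 by have := L0 j'; rewrite Zn mulr0 addr0.
  have Za i' j' : F i' [:: j'] = 0 by move: (Zn j') (Zi j'); case: (i); case: i'.
  have [i' [m' [m1' E]]] := kernel_chart (fun i => F i [:: false; false]).
  have n0 : `|0 : R| <= 1 by rewrite normr0 ler01.
  apply: (@nondeg false i' false m' 0 m1' n0) => r _.
  case: r => [|[|[|[|[|r]]]]] /=; rewrite ?F0 ?Za ?mulr0 ?addr0 ?mul0r ?addr0 //.
pose L a c := F i [:: a; c] + m * F (~~ i) [:: a; c].
have hvv : L j j + n * L j (~~ j) + (n * L (~~ j) j + n * (n * L (~~ j) (~~ j))) != 0.
  apply/eqP => Z; apply: (@nondeg false i j m n m1 n1) => r _.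
  by case: r => [|[|[|[|[|r]]]]] /=; rewrite ?F0 ?L0 ?k0.
have hess : L j j * L (~~ j) (~~ j) - L j (~~ j) * L (~~ j) j != 0.
  apply/eqP => Z.
  have [|j' [n' [n1' E]]] := @singular_chart R (fun c a => L a c).
    by rewrite -[RHS]Z; case: (j) => /=; ring.
  apply: (@nondeg true i j' m n' m1 n1') => r _.
  case: r => [|[|[|[|[|r]]]]] /=; rewrite ?F0 ?L0 //; exact: E.
pose v : C := dir2 j + n *: dir2 (~~ j); pose w : C := dir2 (~~ j).
pose a : R := if i then m else 1; pose b : R := if i then 1 else m.
pose c : R := if i then 1 else 0; pose d : R := if i then 0 else 1.
have D0 : a * d - b * c != 0.
  rewrite /a /b /c /d; case: (i); first by rewrite mulr0 mulr1 sub0r oppr_eq0 oner_neq0.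
  by rewrite mulr0 mulr1 subr0 oner_neq0.
have vw0 : v.1 * w.2 - w.1 * v.2 != 0.
  rewrite /v /w /dir2 /GRing.scale; case: (j) => /=.
    by rewrite /GRing.scale /= !(mulr0, mulr1, add0r, addr0, sub0r, mul0r, mul1r) oppr_eq0 oner_neq0.
  by rewrite /GRing.scale /= !(mulr0, mulr1, add0r, addr0, sub0r, mul0r, mul1r, subr0) oner_neq0.
have hE : (fun z => a * (f z).1 + b * (f z).2) =
    (fun z => part i (f z) + m * part (~~ i) (f z)).
  by apply/funext => z; rewrite /a /b; case: (i) => /=; rewrite mul1r // addrC.
have kE : (fun z => c * (f z).1 + d * (f z).2) = (fun z => part (~~ i) (f z)).
  by apply/funext => z; rewrite /c /d; case: (i) => /=; rewrite mul1r mul0r ?addr0 ?add0r.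
have sD u := smooth_derive u sf.
have dk u : differentiable ('D_u f) z0 by exact: Ck_differentiable (sD u) I.
have df z : differentiable f z by exact: Ck_differentiable sf I.
have Dv (g : C -> C) z : differentiable g z ->
    'D_v g z = 'D_(dir2 j) g z + n *: 'D_(dir2 (~~ j)) g z.
  by move=> dg; rewrite /v deriveDv // deriveZv.
pose P (x : C) := part i x + m * part (~~ i) x.
have Plin x y : P (x + n *: y) = P x + n * P y.
  by rewrite /P; case: (i) => /=; rewrite /GRing.scale /=; ring.
have plin x y : part (~~ i) (x + n *: y) = part (~~ i) x + n * part (~~ i) y.
  by case: (i).
have DP u : 'D_u (fun z => P (f z)) = (fun z => P ('D_u f z)).
  by apply/funext => z; exact: combine.
have DDP u u' : 'D_u ('D_u' (fun z => P (f z))) z0 = P ('D_u ('D_u' f) z0).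
  exact: (etrans (congr1 (fun g : C -> R => derive g z0 u) (DP u')) (combine i m u z0 (sD u'))).
have DfE : 'D_v f = (fun z => 'D_(dir2 j) f z + n *: 'D_(dir2 (~~ j)) f z).
  by apply/funext => z; exact: Dv.
have DDv u : 'D_u ('D_v f) z0 = 'D_u ('D_(dir2 j) f) z0 + n *: 'D_u ('D_(dir2 (~~ j)) f) z0.
  exact: (etrans (congr1 (fun g : C -> C => derive g z0 u) DfE)
    (derive_lin1 n u (dk (dir2 j)) (dk (dir2 (~~ j))))).
have Dk u : 'D_u (fun z => part (~~ i) (f z)) z0 = part (~~ i) ('D_u f z0).
  by case: (i); [exact: derive_fst|exact: derive_snd].
have P1 p : P ('D_(dir2 p) f z0) = 0 by have := L0 p; rewrite !FE.
have P2 p q : L p q = P ('D_(dir2 p) ('D_(dir2 q) f) z0) by rewrite /L !FE.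
have hw0 : 'D_w (fun z => P (f z)) z0 = 0.
  exact: (etrans (combine i m w z0 sf) (P1 (~~ j))).
have hv0 : 'D_v (fun z => P (f z)) z0 = 0.
  exact: (etrans (combine i m v z0 sf)
    (linear_eq0 Plin (Dv f z0 (df z0)) (P1 j) (P1 (~~ j)))).
have kv0 : 'D_v (fun z => part (~~ i) (f z)) z0 = 0.
  have K : part (~~ i) ('D_v f z0) =
     part (~~ i) ('D_(dir2 j) f z0) + n * part (~~ i) ('D_(dir2 (~~ j)) f z0).
    exact: (etrans (congr1 (part (~~ i)) (Dv f z0 (df z0))) (plin _ _)).
  apply: (etrans (Dk v) (etrans K _)).
  by move: k0; rewrite !FE.
have kw0 : 'D_w (fun z => part (~~ i) (f z)) z0 != 0.
  suff K : part (~~ i) ('D_w f z0) != 0 by apply: contra K => /eqP E; apply/eqP; exact: (etrans (esym (Dk w)) E).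
  by move: kw; rewrite FE.
have Hvv : 'D_v ('D_v (fun z => P (f z))) z0 =
    L j j + n * L j (~~ j) + (n * L (~~ j) j + n * (n * L (~~ j) (~~ j))).
  rewrite !P2.
  exact: (etrans (DDP v v) (linear_expand2 Plin (DDv v) (Dv _ _ (dk _)) (Dv _ _ (dk _)))).
have Hww : 'D_w ('D_w (fun z => P (f z))) z0 = L (~~ j) (~~ j).
  by rewrite P2; exact: DDP.
have Hvw : 'D_v ('D_w (fun z => P (f z))) z0 = L j (~~ j) + n * L (~~ j) (~~ j).
  rewrite !P2.
  exact: (etrans (DDP v w) (etrans (congr1 P (Dv ('D_w f) z0 (dk w))) (Plin _ _))).
have Hwv : 'D_w ('D_v (fun z => P (f z))) z0 = L (~~ j) j + n * L (~~ j) (~~ j).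
  rewrite !P2.
  exact: (etrans (DDP w v) (etrans (congr1 P (DDv w)) (Plin _ _))).
apply: (singular_normal_form sf f0 D0 vw0 (esym hE) (esym kE) hv0 hw0 kv0 kw0).
  by apply: contra hvv => /eqP E; apply/eqP; exact: (etrans (esym Hvv) E).
apply: contra hess => /eqP E; apply/eqP; rewrite -[RHS]E.
apply: esym; apply: (etrans (congr2 (fun x y => x - y) (congr2 *%R Hvv Hww) (congr2 *%R Hvw Hwv))).
by ring.
Qed.

End Classification.

Theorem theorem2p1 (R : realType) :
  exists2 G : set (smooth_fun R), residual G &
    forall Psi : smooth_fun R, G Psi ->
    forall x0 y0 t0 : R, Psi (x0, y0, t0) = (0%R, 0%R) ->
      [\/ radially_equivalent (momentary Psi t0) (x0, y0) psi_regular,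
          radially_equivalent (momentary Psi t0) (x0, y0) psi_hyperbolic |
          radially_equivalent (momentary Psi t0) (x0, y0) psi_elliptic].
Proof.
pose F (k : nat) : set (smooth_fun R) :=
  if unpickle k is Some (N, b, i, j) then nondegenerate_on N b i j else setT.
exists (\bigcap_k F k).
  exists F => // k; rewrite /F; case: (unpickle k) => [[[[N b] i] j]|].
    by split; [exact: nondegenerate_open|exact: nondegenerate_dense].
  by split; [exact: openT|move=> O O0 _; rewrite setIT].
move=> Psi GPsi x0 y0 t0 P0; have sP := smooth_valP Psi.
apply: (classification (smooth_slice t0 sP) P0 (F := jet Psi (x0, y0, t0))).
  by move=> i s; rewrite /jet -iter_slice.
move=> b i j m n m1 n1.
pose p : R * R * R := (x0, y0, t0).
have pN : `|p| <= (Num.bound `|p|)%:R by apply/ltW/archi_boundP.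
have := GPsi (pickle (Num.bound `|p|, b, i, j)) I; rewrite /F pickleK => /(_ p m n pN m1 n1).
by [].
Qed.
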